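(* Let $\mathscr E^{lim}_T:\mathcal A_{iso}\to[0,\infty)$ be $$\mathscr E^{lim}_{T}(y):=\frac{\mu}{12}\int_\omega\left\{\Big|A_y(x')-\frac{12\delta_0}{\pi^2}\,\mathrm{diag}(-1,1)\Big|^2+\gamma\big(\mathrm{tr}\,A_y(x')\big)^2\right\}dx'+\frac{\mu\,\delta_0^2}{\pi^4}\Big(\frac{\pi^4-4\pi^2-48}{2}\Big)|\omega|.$$ Then $$\min_{\mathcal A_{iso}}\mathscr E^{lim}_T=\mathscr E^{lim}_T(y_T)=\frac{\mu\,\delta_0^2}{\pi^4}\left[12\Big(\frac{1+2\gamma}{1+\gamma}\Big)+\frac{\pi^4-4\pi^2-48}{2}\right]|\omega|,$$ where $y_T\in\mathcal A_{iso}$ is such that $$\text{either}\quad A_{y_T}\equiv\mathrm{diag}\Big(-\frac{12\delta_0}{\pi^2(1+\gamma)},0\Big)\quad\text{or}\quad A_{y_T}\equiv\mathrm{diag}\Big(0,\frac{12\delta_0}{\pi^2(1+\gamma)}\Big).$$ (That is, the minimum is attained, it has the stated value, and it is realised by any $y_T\in\mathcal A_{iso}$ whose second fundamental form is constantly equal to one of these two matrices; such $y_T$ exist in both cases.)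
   Context: $\omega\subset\mathbb R^2$ is a bounded Lipschitz domain with area $|\omega|$, having a closed set $\Sigma\subset\partial\omega$ with $\mathscr H^1(\Sigma)=0$ such that the outer unit normal exists and is continuous on $\partial\omega\setminus\Sigma$. $\mu>0$, $\delta_0>0$ and $\gamma>0$ are constants; in the paper $\gamma=\frac{W_{vol}''(1)}{2\mu+W_{vol}''(1)}$ for a function $W_{vol}$ that is $C^2$ near $1$ with $W_{vol}''(1)>0$ (so $0<\gamma<1$). With $\nabla'$ the gradient in $x'=(x_1,x_2)$ and $\mathrm I_2$ the $2\times2$ identity, $\mathcal A_{iso}:=\{y\in W^{2,2}(\omega,\mathbb R^3):(\nabla'y)^T\nabla'y=\mathrm I_2\text{ a.e. in }\omega\}$. For $y\in\mathcal A_{iso}$, $\nu:=\partial_{x_1}y\wedge\partial_{x_2}y$ (cross product) and $A_y:=(\nabla'y)^T\nabla'\nu$ is the second fundamental form. For a matrix $A$, $|A|^2=\mathrm{tr}(A^TA)$. *)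

(* Defs.v *)
From HB Require Import structures.
From mathcomp Require Import all_boot all_order all_algebra.
From mathcomp Require Import all_classical all_reals all_analysis.

Set Implicit Arguments.
Unset Strict Implicit.
Unset Printing Implicit Defensive.

Import Order.TTheory GRing.Theory Num.Theory.
Import numFieldNormedType.Exports.

Local Open Scope classical_set_scope.
Local Open Scope ring_scope.

Section PlaneDomains.
Context {R : realType}.

(* Borel-measurable representatives are used throughout, lebesgue_measure being
   a measure on the Borel sets. *)
Definition leb2 :
    {measure set (measurableTypeR R * measurableTypeR R) -> \bar R} :=
  (@lebesgue_measure R \x @lebesgue_measure R)%E.

(* The library norm on R * R is the sup norm: it serves only for the topology
   and for boundedness; metric notions below use the Euclidean distance. *)
Definition edist (p q : R * R) : R :=
  Num.sqrt ((p.1 - q.1) ^+ 2 + (p.2 - q.2) ^+ 2).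

(* The added 0 makes the diameter of the empty set 0 instead of -oo. *)
Definition ediam (A : set (R * R)) : \bar R :=
  ereal_sup (0%E |` [set (edist pq.1 pq.2)%:E | pq in A `*` A]).

Definition hausdorff1_pre (d : R) (A : set (R * R)) : \bar R :=
  ereal_inf [set (\sum_(0 <= k <oo) ediam (U k))%E |
    U in [set U : nat -> set (R * R) |
      A `<=` \bigcup_k U k /\ (forall k, (ediam (U k) <= d%:E)%E)]].

Definition hausdorff1 (A : set (R * R)) : \bar R :=
  ereal_sup [set hausdorff1_pre d A | d in [set d : R | 0 < d]].

Definition bdry (w : set (R * R)) : set (R * R) := closure w `\` w°.

(* Near p, and in the orthonormal frame (e, e^perp) with origin p, the set w
   is the strict epigraph of the Lipschitz function g. *)
Definition lipschitz_chart (w : set (R * R)) (p e : R * R) (g : R -> R) : Prop :=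
  [/\ e.1 ^+ 2 + e.2 ^+ 2 = 1,
      (exists L : R, L.-lipschitz g) &
      exists r h : R, [/\ 0 < r, 0 < h &
        forall s t : R, `|s| < r -> `|t| < h ->
          (w (p.1 + s * e.1 - t * e.2, p.2 + s * e.2 + t * e.1) <-> g s < t)]].

Definition bounded_lipschitz_domain (w : set (R * R)) : Prop :=
  [/\ w !=set0, open w, connected w, bounded_set w &
      forall p, bdry w p -> exists e g, lipschitz_chart w p e g].

(* In the frame (e, e^perp) the outer unit normal to {t > g s} at s = 0 is
   (g' 0, -1) / sqrt (1 + g' 0 ^ 2). *)
Definition outer_unit_normal (w : set (R * R)) (p n : R * R) : Prop :=
  exists e g, [/\ lipschitz_chart w p e g, derivable g 0 1 &
    let d := derive1 g 0 in let c := Num.sqrt (1 + d ^+ 2) in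
    n = ((d * e.1 + e.2) / c, (d * e.2 - e.1) / c)].

Definition normal_continuous_off_null_set (w : set (R * R)) : Prop :=
  exists S : set (R * R),
    [/\ closed S, S `<=` bdry w, hausdorff1 S = 0%E &
        exists n : R * R -> R * R,
          (forall p, (bdry w `\` S) p -> outer_unit_normal w p (n p)) /\
          {within bdry w `\` S, continuous n}].

End PlaneDomains.

Section Sobolev.
Context {R : realType}.
Implicit Types (w : set (R * R)) (f g phi : R * R -> R) (i : 'I_2).

Definition basis2 i : R * R := if i == ord0 then (1, 0) else (0, 1).

Definition pderiv i f : R * R -> R := fun x => 'D_(basis2 i) f x.

Definition smooth f : Prop :=
  forall (s : seq 'I_2) (x : R * R), differentiable (foldr pderiv f s) x.

Definition test_function w phi : Prop :=
  [/\ smooth phi, compact (closure [set x | phi x != 0]) &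
      closure [set x | phi x != 0] `<=` w].

(* The ascription selects the sigma-algebra structure on which leb2 is defined. *)
Definition mfun_on w f : Prop :=
  measurable_fun (w : set (measurableTypeR R * measurableTypeR R)) f.

Definition L1loc w f : Prop :=
  mfun_on w f /\
  forall K, compact K -> K `<=` w -> leb2.-integrable K (EFin \o f).

Definition L2 w f : Prop :=
  mfun_on w f /\ leb2.-integrable w (EFin \o (fun x => f x ^+ 2)).

Definition is_weak_partial w i f g : Prop :=
  [/\ L1loc w f, L1loc w g & forall phi, test_function w phi ->
      (\int[leb2]_(x in w) (f x * pderiv i phi x) =
       - \int[leb2]_(x in w) (g x * phi x))%R].

(* W^{k,2}(w) *)
Fixpoint sobolev2 (k : nat) w f : Prop :=
  L2 w f /\
  if k is k'.+1 then
    forall i, exists g, is_weak_partial w i f g /\ sobolev2 k' w g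
  else True.

(* A representative of the weak partial derivative, which is unique up to null
   sets when it exists (and the value is junk when it does not). *)
Definition weak_partial w i f : R * R -> R :=
  xget (fun _ => 0) [set g | is_weak_partial w i f g].

End Sobolev.

Section Isometries.
Context {R : realType}.
Implicit Types (w : set (R * R)) (y : R * R -> 'cV[R]_3).

Definition ae_on w (P : R * R -> Prop) : Prop :=
  {ae @leb2 R, forall x, w x -> P x}.

Definition wgrad w y (x : R * R) : 'M[R]_(3, 2) :=
  \matrix_(k, i) weak_partial w i (fun z => y z k ord0) x.

Definition crossp (u v : 'cV[R]_3) : 'cV[R]_3 :=
  (* row indices in 'I_3 are added modulo 3 *)
  \col_k (u (k + 1) ord0 * v (k + 2%:R) ord0 - u (k + 2%:R) ord0 * v (k + 1) ord0).

Definition A_iso w : set (R * R -> 'cV[R]_3) :=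
  [set y : R * R -> 'cV[R]_3 | (forall k, sobolev2 2 w (fun z => y z k ord0)) /\
           ae_on w (fun x => (wgrad w y x)^T *m wgrad w y x = 1%:M)].

Definition normal_field w y (x : R * R) : 'cV[R]_3 :=
  crossp (col ord0 (wgrad w y x)) (col ord_max (wgrad w y x)).

Definition second_ff w y (x : R * R) : 'M[R]_2 :=
  (wgrad w y x)^T *m wgrad w (normal_field w y) x.

Definition diag2 (a b : R) : 'M[R]_2 :=
  diag_mx (\row_i (if i == ord0 then a else b)).

(* |A|^2 *)
Definition frob2 (A : 'M[R]_2) : R := \tr (A^T *m A).

Definition E_lim (mu delta0 gamma : R) w y : \bar R :=
  ((mu / 12)%:E *
     \int[leb2]_(x in w)
       (frob2 (second_ff w y x - (12 * delta0 / pi ^+ 2) *: diag2 (-1) 1)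
        + gamma * (\tr (second_ff w y x)) ^+ 2)%:E
   + (mu * delta0 ^+ 2 / pi ^+ 4 * ((pi ^+ 4 - 4 * pi ^+ 2 - 48) / 2))%:E
     * leb2 w)%E.

Definition E_min (mu delta0 gamma : R) w : \bar R :=
  ((mu * delta0 ^+ 2 / pi ^+ 4 *
     (12 * ((1 + 2 * gamma) / (1 + gamma))
      + (pi ^+ 4 - 4 * pi ^+ 2 - 48) / 2))%:E * leb2 w)%E.

End Isometries.

Definition is_minimum (R : realType) (T : Type) (F : T -> \bar R) (S : set T)
    (m : \bar R) : Prop :=
  (exists2 y, S y & F y = m) /\ (forall y, S y -> (m <= F y)%E).

(* Main.v *)
Require Import Defs.
From HB Require Import structures.
From mathcomp Require Import all_boot all_order all_algebra.
From mathcomp Require Import all_classical all_reals all_analysis.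
From mathcomp Require Import measurable_realfun.
From mathcomp Require Import ring lra.

Set Implicit Arguments.
Unset Strict Implicit.
Unset Printing Implicit Defensive.

Import Order.TTheory GRing.Theory Num.Theory.
Import numFieldNormedType.Exports.

Local Open Scope classical_set_scope.
Local Open Scope ring_scope.

(* Proof idea.  Let c = 12 delta0 / pi^2 and let a_ij be the entries of A_y.  The surface is
   flat, so A_y is symmetric with determinant 0 (Gauss), and then the integrand equals
     c^2 (1 + 2 gamma) / (1 + gamma)
       + (1 + gamma) (a_11 - a_22 + c / (1 + gamma))^2 + 4 (1 + gamma) a_12^2,
   which gives the lower bound together with its two cases of equality with a_12 = 0; these
   are realised by cylinders.
   Gauss' equation for y in W^{2,2}: the first derivatives are orthonormal, so differentiating
   their products gives d_ij y . d_k y = 0; hence a_ij is - d_ij y . nu and det A_y is the sum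
   over k of the Jacobians of (d_1 y_k, d_2 y_k).  Integrating such a Jacobian by parts against
   a test function leaves the integrand d_1 y_k d_2 d_2 y_k d_1 phi - d_1 y_k d_1 d_2 y_k d_2 phi,
   whose sum over k is 0.  The product rule and this integration by parts need no
   mollification: they hold for difference quotients, which converge in L^2 near the support
   of the test function because they are averages of translates of the weak derivative. *)

(** * Lebesgue measure on the plane: boxes, translations, open sets *)

Section PlaneMeasure.
Context {R : realType}.
Local Notation T1 := (measurableTypeR R).
Local Notation T := (T1 * T1)%type.
Local Notation mu := (@lebesgue_measure R).

(** Functions on [w] are extended by zero, so that translation invariance of [leb2] holds on the
    whole plane without boundary terms; test functions keep a positive distance from the complement
    of [w], so that small translations never see the extension. The obstacle is that [weak_partial]
    is a choice among almost everywhere equal functions, and is junk unless a weak derivative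
    exists. Before A_y can be computed, the product rule must supply a weak derivative of the
    normal, a product of W^{1,2} functions whose derivatives are only integrable. Hence the limits
    of products: each pairs two sequences converging in L^2, and only the integral of the product
    has to converge. The tangential components of the second derivatives vanish as do the
    Christoffel symbols of a constant metric: d_ij y . d_l y is symmetric in i, j and antisymmetric
    in i, l. For a diagonal matrix, equality in the lower bound means a_11 a_22 = 0 and a_22 - a_11
    = c / (1 + gamma); the two solutions are the two matrices of the statement, with kappa = c / (1
    + gamma). *)

Definition box (p q : R * R) : set T := `]p.1, q.1] `*` `]p.2, q.2].

Definition cbox (p q : R * R) : set (R * R) := `[p.1, q.1] `*` `[p.2, q.2].

(** The smooth approximation of index [n] of the indicator of a box overhangs its right and upper
    sides by [n.+1%:R^-1]. *)
Definition enlarge (n : nat) (q : R * R) : R * R :=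
  (q.1 + n.+1%:R^-1, q.2 + n.+1%:R^-1).

(** Half-open boxes are stable under intersection and generate the Borel sets, so uniqueness of
    measures and Dynkin induction can start from them. *)
Definition boxes : set (set T) := [set box pq.1 pq.2 | pq in setT].

Lemma boxes_box p q : boxes (box p q).
Proof. by exists (p, q). Qed.

Lemma boxE p q (x : R * R) :
  box p q x <-> [/\ p.1 < x.1, x.1 <= q.1, p.2 < x.2 & x.2 <= q.2].
Proof.
rewrite /box /= !in_itv /=; split.
  by case=> /andP[? ?] /andP[? ?]; split.
by case=> -> -> -> ->.
Qed.

Lemma cboxE p q (x : R * R) :
  cbox p q x <-> [/\ p.1 <= x.1, x.1 <= q.1, p.2 <= x.2 & x.2 <= q.2].
Proof.
rewrite /cbox /= !in_itv /=; split.
  by case=> /andP[? ?] /andP[? ?]; split.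
by case=> -> -> -> ->.
Qed.

Lemma measurable_itvT1 (i : interval R) : @measurable _ T1 [set` i].
Proof. exact: (@measurable_itv R i). Qed.

Lemma measurable_box p q : measurable (box p q).
Proof. by apply: measurableX; exact: measurable_itvT1. Qed.

Lemma measurable_cbox p q : @measurable _ T (cbox p q).
Proof. by apply: measurableX; exact: measurable_itvT1. Qed.

Lemma boxI p q p' q' : box p q `&` box p' q' =
  box (Num.max p.1 p'.1, Num.max p.2 p'.2) (Num.min q.1 q'.1, Num.min q.2 q'.2).
Proof.
apply/seteqP; split=> x.
  by move=> [/boxE[? ? ? ?] /boxE[? ? ? ?]]; apply/boxE; split => /=;
    rewrite ?gt_max ?le_min; apply/andP.
move=> /boxE[] /=; rewrite !gt_max !le_min.
by move=> /andP[? ?] /andP[? ?] /andP[? ?] /andP[? ?]; split; apply/boxE.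
Qed.

Lemma setI_closed_boxes : setI_closed boxes.
Proof.
move=> _ _ [pq _ <-] [pq' _ <-].
exists ((Num.max pq.1.1 pq'.1.1, Num.max pq.1.2 pq'.1.2),
  (Num.min pq.2.1 pq'.2.1, Num.min pq.2.2 pq'.2.2)) => //.
by rewrite -boxI.
Qed.

Definition bigbox (n : nat) : set T := box (- n%:R, - n%:R) (n%:R, n%:R).

Lemma bigcup_bigbox : \bigcup_n bigbox n = setT.
Proof.
apply/seteqP; split=> // x _.
pose M := `|x.1| + `|x.2| + 1.
have M0 : 0 <= M by rewrite /M !addr_ge0.
exists (Num.bound M) => //; apply/boxE => /=.
have := archi_boundP M0; set n := _%:R => Mn.
have h1 : `|x.1| < n by apply: le_lt_trans Mn; rewrite /M -addrA lerDl addr_ge0.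
have h2 : `|x.2| < n.
  by apply: le_lt_trans Mn; rewrite /M addrAC lerDr addr_ge0.
move: h1 h2; rewrite !ltr_norml => /andP[? ?] /andP[? ?].
by split => //; exact: ltW.
Qed.

(** Both projections are measurable for the sigma-algebra generated by boxes, because a strip is a
    countable union of boxes of growing height or width. *)
Lemma measurable_boxes : @measurable _ T = <<s boxes >>.
Proof.
apply/seteqP; split; last first.
  apply: smallest_sub; first exact: sigma_algebra_measurable.
  by move=> _ [pq _ <-]; exact: measurable_box.
rewrite measurable_prod_measurableType.
apply: smallest_sub; first exact: smallest_sigma_algebra.
pose S : measurableType _ := g_sigma_algebraType boxes.
have ex_bigbox (x : T) : exists n, bigbox n x.
  by have : [set: T] x by []; rewrite -bigcup_bigbox => -[n _ ?]; exists n.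
have mfst : measurable_fun [set: S] (fst : S -> T1).
  apply: (@measurability _ _ _ _ setT _ (@ocitv R)) => //.
  move=> _ [_ [[a b] _ <-] <-].
  rewrite [X in measurable X](_ : _ = \bigcup_n box (a, - n%:R) (b, n%:R)).
    by apply: bigcupT_measurable => n; apply: sub_sigma_algebra; exists ((a, - n%:R), (b, n%:R)).
  apply/seteqP; split=> x.
    move=> [_ /=]; rewrite in_itv /= => /andP[? ?].
    by have [n /boxE /= [_ _ ? ?]] := ex_bigbox x; exists n => //; apply/boxE.
  move=> [n _ /boxE /= [? ? _ _]]; split=> //=; rewrite in_itv /=; exact/andP.
have msnd : measurable_fun [set: S] (snd : S -> T1).
  apply: (@measurability _ _ _ _ setT _ (@ocitv R)) => //.
  move=> _ [_ [[a b] _ <-] <-].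
  rewrite [X in measurable X](_ : _ = \bigcup_n box (- n%:R, a) (n%:R, b)).
    by apply: bigcupT_measurable => n; apply: sub_sigma_algebra; exists ((- n%:R, a), (n%:R, b)).
  apply/seteqP; split=> x.
    move=> [_ /=]; rewrite in_itv /= => /andP[? ?].
    by have [n /boxE /= [? ? _ _]] := ex_bigbox x; exists n => //; apply/boxE.
  move=> [n _ /boxE /= [_ _ ? ?]]; split=> //=; rewrite in_itv /=; exact/andP.
move=> _ [A mA [B mB <-]].
have -> : A `*` B = (setT `&` fst @^-1` A) `&` (setT `&` snd @^-1` B).
  by rewrite !setTI.
by apply: (@measurableI _ S); [exact: mfst|exact: msnd].
Qed.

Lemma leb2_boxE p q : leb2 (box p q) =
  (mu (`]p.1, q.1] : set T1) * mu (`]p.2, q.2] : set T1))%E.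
Proof.
by rewrite /leb2 /box /= product_measure1E //; exact: measurable_itvT1.
Qed.

Lemma mu_oc_fin (a b : R) : mu (`]a, b] : set T1) \is a fin_num.
Proof. by rewrite lebesgue_measure_itv; case: ifP. Qed.

Lemma leb2_box p q : (leb2 (box p q) < +oo)%E.
Proof. by rewrite leb2_boxE ltey_eq fin_numM ?mu_oc_fin. Qed.

(** Translation by [- s *: basis2 i], so that [u \o shift2 i s] is [u] moved forward by [s].
    Coordinates make measurability a matter of components. *)
Definition shift2 (i : 'I_2) (s : R) (x : T) : T :=
  if i == ord0 then (x.1 - s, x.2) else (x.1, x.2 - s).

Lemma shift2E i s (x : R * R) : shift2 i s x = x - s *: basis2 i.
Proof.
by rewrite /shift2 /basis2; case: x => a b; case: ifP => _;
  congr pair; rewrite /= /GRing.scale /= ?mulr1 ?mulr0 ?subr0.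
Qed.

Lemma measurable_shift2 i s : measurable_fun setT (shift2 i s).
Proof.
rewrite /shift2; case: (i == ord0); apply/measurable_fun_pairP; split => /=.
- apply: (@measurable_funB _ _ R) => //; exact: measurable_fst.
- exact: measurable_snd.
- exact: measurable_fst.
- apply: (@measurable_funB _ _ R) => //; exact: measurable_snd.
Qed.

Lemma shift2_box i s p q :
  shift2 i s @^-1` box p q = box (shift2 i (- s) p) (shift2 i (- s) q).
Proof.
apply/seteqP; split=> x; rewrite /preimage /= => /boxE; rewrite /shift2;
  case: ifP => _ /= [? ? ? ?]; apply/boxE => /=; split=> //; lra.
Qed.

Lemma mu_oc_shift (a b s : R) :
  mu (`]a - s, b - s] : set T1) = mu (`]a, b] : set T1).
Proof.
rewrite !lebesgue_measure_itv /= !lte_fin ltrD2r.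
by case: ifP => // _; congr (_%:E); ring.
Qed.

(** The image measure and [leb2] agree on boxes, and the plane is exhausted by boxes of finite
    measure, so they agree on all Borel sets. *)
Lemma leb2_shift i s (A : set T) : measurable A ->
  pushforward leb2 (shift2 i s) A = leb2 A.
Proof.
move=> mA; have mm : measurable_fun setT (shift2 i s) := measurable_shift2 i s.
have E A' : boxes A' -> pushforward leb2 (shift2 i s) A' = leb2 A'.
  move=> [[p q] _ <-]; rewrite /pushforward shift2_box !leb2_boxE.
  by rewrite /shift2; case: ifP => _ /=; rewrite !mu_oc_shift.
apply/esym; apply: (@measure_unique _ R T boxes bigbox measurable_boxes setI_closed_boxes
  (fun n => boxes_box _ _) bigcup_bigbox leb2 _ _ _ A mA).
- by move=> A' bA'; exact/esym/E.
- by move=> k; exact: leb2_box.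
Qed.

Lemma ge0_integral_shift2 i s (F : T -> \bar R) : measurable_fun setT F ->
  (forall x, (0 <= F x)%E) ->
  (\int[leb2]_x F (shift2 i s x) = \int[leb2]_x F x)%E.
Proof.
move=> mF F0; have mm := measurable_shift2 i s.
have := @ge0_integral_pushforward _ _ _ _ _ _ mm leb2 setT F measurableT mF
  (fun y _ => F0 y).
rewrite preimage_setT => /esym E.
rewrite -[LHS]/(\int[leb2]_x (F \o shift2 i s) x)%E {}E.
by apply: eq_measure_integral => A mA _; exact: leb2_shift.
Qed.

Lemma integrable_shift2 i s (F : T -> \bar R) : leb2.-integrable setT F ->
  leb2.-integrable setT (fun x => F (shift2 i s x)).
Proof.
move=> /integrableP [mF iF]; apply/integrableP; split.
  by apply: measurableT_comp => //; exact: measurable_shift2.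
rewrite (ge0_integral_shift2 i s (F := fun x => `|F x|%E)) //.
exact: measurableT_comp.
Qed.

Lemma integral_shift2 i s (F : T -> \bar R) : leb2.-integrable setT F ->
  (\int[leb2]_x F (shift2 i s x) = \int[leb2]_x F x)%E.
Proof.
move=> iF; have mm := measurable_shift2 i s; have mF := measurable_int _ iF.
have := @integral_pushforward _ _ _ _ _ _ mm leb2 setT F mF.
rewrite preimage_setT => /(_ (integrable_shift2 i s iF) measurableT) /esym E.
rewrite -[LHS]/(\int[leb2]_x (F \o shift2 i s) x)%E {}E.
by apply: eq_measure_integral => A mA _; exact: leb2_shift.
Qed.

Lemma Rintegral_shift2 i s (F : T -> R) : leb2.-integrable setT (EFin \o F) ->
  \int[leb2]_x F (shift2 i s x) = \int[leb2]_x F x.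
Proof. by move=> iF; rewrite /Rintegral -(integral_shift2 i s iF). Qed.

(** The box is a cell of the grid of mesh [1 / k.1.+1]. Cells are indexed by a countable type, which
    is what turns an open set into a countable union in [open_boxes]. *)
Lemma box_nbhs (V : set (R * R)) x : open V -> V x ->
  exists2 p, box p.1 p.2 x &
   exists k : nat * (int * int), cbox p.1 (enlarge k.1 p.2) `<=` V /\ p =
     ((k.2.1%:~R / k.1.+1%:R, k.2.2%:~R / k.1.+1%:R),
      ((k.2.1%:~R + 1) / k.1.+1%:R, (k.2.2%:~R + 1) / k.1.+1%:R)).
Proof.
rewrite openE => /(_ x) /[apply] /nbhs_ballP[e /= e0 eV].
(* An enlarged cell has side [2 / n.+1], hence the bound [e / 2] on the mesh. *)
have [n ne] : exists n, n.+1%:R^-1 < e / 2.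
  have [n _ /(_ n (leqnn n)) /= h] := near_infty_natSinv_lt (PosNum (divr_gt0 e0 (ltr0Sn R 1))).
  by exists n.
have n0 : 0 < n.+1%:R :> R by [].
(* [ceil - 1] and not [floor]: cells are open on the left and closed on the right. *)
pose j (t : R) : int := Num.ceil (t * n.+1%:R) - 1.
have jP t : (j t)%:~R / n.+1%:R < t <= ((j t)%:~R + 1) / n.+1%:R.
  rewrite ltr_pdivrMr // ler_pdivlMr // /j.
  rewrite intrB subrK. 
  have := ceil_itv (t * n.+1%:R).
  by rewrite intrB.
exists ((((j x.1)%:~R / n.+1%:R), ((j x.2)%:~R / n.+1%:R)),
  (((j x.1)%:~R + 1) / n.+1%:R, ((j x.2)%:~R + 1) / n.+1%:R)).
  apply/boxE => /=.
  by have /andP[? ?] := jP x.1; have /andP[? ?] := jP x.2.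
exists (n, (j x.1, j x.2)); split => //.
move=> y /cboxE /= [y1 y2 y3 y4]; apply: eV.
have L t u : (j t)%:~R / n.+1%:R <= u -> u <= ((j t)%:~R + 1) / n.+1%:R + n.+1%:R^-1 ->
    `|t - u| < e.
  have D : ((j t)%:~R + 1) / n.+1%:R = (j t)%:~R / n.+1%:R + n.+1%:R^-1 :> R.
    by rewrite mulrDl mul1r.
  have /andP := jP t; rewrite D; set A := (j t)%:~R / _; set B := n.+1%:R^-1.
  move: ne; rewrite -/B => ? [? ?] ? ?.
  by rewrite ltr_norml; apply/andP; split; lra.
by split; rewrite /ball /= ; apply: L.
Qed.

(** The empty box is the filler for the integers that encode no cell, or a cell whose enlargement
    leaves [V]. *)
Lemma open_boxes (V : set (R * R)) : open V ->
  exists p : nat -> (R * R) * (R * R),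
  (forall n, (exists N, cbox (p n).1 (enlarge N (p n).2) `<=` V) \/
     box (p n).1 (p n).2 = set0) /\
  V = \bigcup_n box (p n).1 (p n).2.
Proof.
move=> oV.
pose q (k : nat * (int * int)) : (R * R) * (R * R) :=
     ((k.2.1%:~R / k.1.+1%:R, k.2.2%:~R / k.1.+1%:R),
      ((k.2.1%:~R + 1) / k.1.+1%:R, (k.2.2%:~R + 1) / k.1.+1%:R)).
pose p n := if @unpickle (nat * (int * int))%type n is Some k then
  if `[< cbox (q k).1 (enlarge k.1 (q k).2) `<=` V >] then q k else ((0, 0), (0, 0)) else ((0, 0), (0, 0)).
have box0 : box (0, 0) (0, 0) = set0.
  by apply/seteqP; split=> // x /boxE /= [] /lt_le_trans /[apply]; rewrite ltxx.
have P n : (exists N, cbox (p n).1 (enlarge N (p n).2) `<=` V) \/ box (p n).1 (p n).2 = set0.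
  rewrite /p; case: unpickle => [k|]; last by right.
  by case: asboolP => h; [left; exists k.1|right].
exists p; split => //; apply/seteqP; split => x.
  move=> Vx; have [r rx [k [rV rk]]] := box_nbhs oV Vx.
  exists (pickle k) => //; rewrite /p pickleK.
  by have -> : q k = r; [rewrite rk|rewrite asboolT].
move=> [n _ bx]; case: (P n) => [|b0]; last by rewrite b0 in bx.
move=> [N]; apply; move: bx => /boxE[? ? ? ?]; apply/cboxE => /=.
have N0 : 0 <= N.+1%:R^-1 :> R by rewrite invr_ge0.
by split=> //; try exact: ltW; apply: ler_wpDr.
Qed.

Lemma open_measurable2 (V : set (R * R)) : open V -> @measurable _ T V.
Proof.
move=> /open_boxes[p [_ ->]]; apply: bigcupT_measurable => n.
exact: measurable_box.
Qed.

Lemma closed_measurable2 (V : set (R * R)) : closed V -> @measurable _ T V.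
Proof.
move=> cV; rewrite -(setCK V); apply: measurableC; apply: open_measurable2.
exact: closed_openC.
Qed.

Lemma continuous_measurable_fun2 (D : set T) (f : R * R -> R) : continuous f ->
  measurable_fun D (f : T -> R).
Proof.
move=> cf; apply: measurable_funTS.
apply: (@measurability _ _ _ _ setT _ _ (RGenOpens.measurableE R)).
move=> _ [_ [a [b ->] <-]]; rewrite setTI; apply: open_measurable2.
by move/continuousP: cf; apply; exact: interval_open.
Qed.

Lemma bounded_sub_bigbox (w : set (R * R)) : bounded_set w ->
  exists n, w `<=` bigbox n.
Proof.
move=> [M [_ bM]]; have M1 := bM (`|M| + 1) (ltr_pwDr ltr01 (ler_norm M)).
have M0 : 0 <= `|M| + 1 by rewrite addr_ge0.
exists (Num.bound (`|M| + 1)) => x wx; have := archi_boundP M0; set n := _%:R.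
move=> Mn; have /= := M1 x wx; rewrite prod_normE ge_max => /andP[x1 x2].
apply/boxE => /=; move: (le_lt_trans x1 Mn) (le_lt_trans x2 Mn).
by rewrite !ltr_norml => /andP[? ?] /andP[? ?]; split=> //; exact: ltW.
Qed.

Lemma bounded_leb2 (w : set (R * R)) : @measurable _ T w -> bounded_set w ->
  (leb2 w < +oo)%E.
Proof.
move=> mw /bounded_sub_bigbox[n wn]; apply: le_lt_trans (leb2_box (- n%:R, - n%:R) (n%:R, n%:R)).
by apply: le_measure => //; rewrite inE //; exact: measurable_box.
Qed.

End PlaneMeasure.

(** * Smooth functions and bumps of one variable *)

Section Smooth1.
Context {R : realType}.
Implicit Types (f g : R -> R) (n k : nat) (a b t : R).

(** Differentiability [n + 1] times: [Cn 0] already asks for one derivative. *)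
Fixpoint Cn n f : Prop := (forall x : R, derivable f x 1) /\
  if n is m.+1 then Cn m (derive1 f) else True.

Definition smooth1 f := forall n, Cn n f.

Lemma CnW n f : Cn n.+1 f -> Cn n f.
Proof. by elim: n f => [|n ih] f /= [? h]; split => //; apply: ih. Qed.

Lemma derive1_eq f (df : R -> R) : (forall x : R, is_derive x 1 f (df x)) -> derive1 f = df.
Proof. by move=> h; apply/funext => x; rewrite derive1E; apply: derive_val. Qed.

Lemma CnD n f g : Cn n f -> Cn n g -> Cn n (f \+ g).
Proof.
elim: n f g => [|n ih] f g /= [df Cf] [dg Cg].
  by split; [move=> x; exact: derivableD|].
split; first by move=> x; exact: derivableD.
have -> : derive1 (f \+ g) = derive1 f \+ derive1 g.
  by apply/funext => x /=; rewrite !derive1E deriveD.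
exact: ih.
Qed.

Lemma CnM n f g : Cn n f -> Cn n g -> Cn n (f \* g).
Proof.
elim: n f g => [|n ih] f g Cf Cg; have [df Cf'] := Cf; have [dg Cg'] := Cg.
  by split; [move=> x; exact: derivableM|].
split; first by move=> x; exact: derivableM.
have -> : derive1 (f \* g) = (f \* derive1 g) \+ (g \* derive1 f).
  by apply/funext => x /=; rewrite !derive1E deriveM.
by apply: CnD; apply: ih => //; exact: CnW.
Qed.

Lemma Cn_cst n (c : R) : Cn n (cst c).
Proof.
elim: n c => [|n ih] c; split => //.
have -> : derive1 (cst c : R -> R) = cst 0 by apply/funext => x; rewrite derive1_cst.
exact: ih.
Qed.

Lemma Cn_id n : Cn n (@id R).
Proof.
case: n => [|n]; split => //.
have -> : derive1 (@id R) = cst 1 by apply/funext => x; rewrite derive1E derive_id.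
exact: Cn_cst.
Qed.

Lemma is_derive_affine f (c d x : R) : derivable f (c * x + d) 1 ->
  is_derive x 1 (fun t => f (c * t + d)) (derive1 f (c * x + d) * c).
Proof.
move=> df; have hf : is_derive (c * x + d) 1 f (derive1 f (c * x + d)).
  by rewrite derive1E; apply/derivableP.
have hg : is_derive x 1 (fun t => c * t + d) c.
  by apply: is_derive_eq; rewrite /GRing.scale /= ?mulr1 ?mulr0 ?addr0 ?add0r.
exact: (@is_derive1_comp R f (fun t : R => c * t + d) x _ _ hf hg).
Qed.

Lemma Cn_affine n f (c d : R) : Cn n f -> Cn n (fun t => f (c * t + d)).
Proof.
elim: n f => [|n ih] f Cf; have [df Cf'] := Cf.
  by split; [move=> x; case: (is_derive_affine (df (c * x + d)))|].
have D (x : R) := is_derive_affine (df (c * x + d)).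
split; first by move=> x; case: (D x).
rewrite (derive1_eq D).
by apply: (CnM (g := cst c)); [exact: ih|exact: Cn_cst].
Qed.

Lemma Cn_sin n : Cn n (@sin R) /\ Cn n (@cos R).
Proof.
elim: n => [|n [cs cc]]; first by split; split => // x; exact: ex_derive.
have Es : derive1 (@sin R) = cos by apply: derive1_eq => x; exact: is_derive_sin.
have Ec : derive1 (@cos R) = cst (-1) \* sin.
  by apply: derive1_eq => x; apply: is_derive_eq; rewrite /= mulN1r.
split; split; [by move=> x; exact: ex_derive|by rewrite Es|by move=> x; exact: ex_derive|].
by rewrite Ec; apply: CnM => //; exact: Cn_cst.
Qed.

(** The powers of [t^-1] are included because the derivatives of exp(-1/t) stay in the span of this
    family. *)
Definition hexp (k : nat) (t : R) : R :=
  if 0 < t then t^-1 ^+ k * expR (- t^-1) else 0.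

Lemma hexp_ge0 k t : 0 <= hexp k t.
Proof.
rewrite /hexp; case: ifPn => // t0.
by rewrite mulr_ge0 ?expR_ge0 // exprn_ge0 // invr_ge0 ltW.
Qed.

(** With u = 1/t, the inequality e^x >= x at x = u / (k + 1), raised to the power k + 1, leaves one
    factor t after division by u^k. *)
Lemma hexp_le k t : 0 <= t -> hexp k t <= k.+1%:R ^+ k.+1 * t.
Proof.
rewrite /hexp; case: ifPn => [t0 _|_ t0]; last by rewrite mulr_ge0 // exprn_ge0.
have tV0 : 0 < t^-1 by rewrite invr_gt0.
rewrite expRN ler_pdivrMr ?expR_gt0 //.
have k0 : 0 < k.+1%:R :> R by [].
have -> : expR t^-1 = expR (t^-1 / k.+1%:R) ^+ k.+1.
  by rewrite -expRM_natl mulrCA mulfV ?mulr1 // gt_eqF.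
apply: (@le_trans _ _ (k.+1%:R ^+ k.+1 * t * (t^-1 / k.+1%:R) ^+ k.+1)).
  rewrite expr_div_n (exprS t^-1); set C := _ ^+ k.+1; set u := t^-1 ^+ k.
  have C0 : C != 0 by rewrite gt_eqF // exprn_gt0.
  have -> : C * t * (t^-1 * u / C) = (C / C) * (t / t) * u by ring.
  by rewrite (divff C0) divff ?mul1r // gt_eqF.
apply: ler_wpM2l; first by rewrite mulr_ge0 ?exprn_ge0 // ltW.
have u0 : 0 <= t^-1 / k.+1%:R by rewrite divr_ge0 // ltW.
rewrite lerXn2r ?nnegrE ?expR_ge0 //.
by apply: le_trans (expR_ge1Dx _); rewrite lerDr.
Qed.

Lemma is_derive_hexp k (t : R) :
  is_derive t 1 (hexp k) (hexp k.+2 t - k%:R * hexp k.+1 t).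
Proof.
have [t0|t0|<-] := ltgtP 0 t.
- have tn0 : t != 0 by rewrite gt_eqF.
  have E : \near t, hexp k t = (fun u => u^-1 ^+ k * expR (- u^-1)) t.
    near=> u; rewrite /hexp ifT //; near: u; exact: lt_nbhsr.
  have dV : is_derive t 1 (fun u : R => u^-1) (- t^-1 ^+ 2).
    split; first by apply: derivableV.
    rewrite (@deriveV _ _ (@id R)) // derive_id /GRing.scale /= mulr1.
    by rewrite exprVn.
  have de : is_derive t 1 (fun u : R => expR (- u^-1)) (expR (- t^-1) * t^-1 ^+ 2).
    have dN : is_derive t 1 (fun u : R => - u^-1) (t^-1 ^+ 2).
      by apply: is_derive_eq; rewrite opprK.
    exact: (@is_derive1_comp R expR (fun u : R => - u^-1) t _ _ _ dN).
  have D : is_derive t 1 (fun u : R => u^-1 ^+ k * expR (- u^-1))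
      (hexp k.+2 t - k%:R * hexp k.+1 t).
    have dk := @is_deriveX _ _ (fun u : R => u^-1) k t 1 _ dV.
    have dm := is_deriveM dk de.
    rewrite exprfctE in dm; apply: is_derive_eq dm _.
    rewrite /hexp t0 /GRing.scale /=.
    by case: k {E dk} => [|k] /=; rewrite !exprS ?expr0; ring.
  apply: near_eq_is_derive D; near=> u; rewrite /hexp ifT //; near: u.
  exact: lt_nbhsr.
- have -> : hexp k.+2 t - k%:R * hexp k.+1 t = 0.
    by rewrite /hexp ltNge (ltW t0) /= mulr0 subr0.
  have D : is_derive t (1 : R) (cst (0 : R)) (0 : R) by exact: is_derive_cst.
  apply: near_eq_is_derive D.
  near=> u; have u0 : u < 0 by near: u; exact: lt_nbhsl.
  by rewrite /hexp ltNge (ltW u0).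
- have -> : hexp k.+2 0 - k%:R * hexp k.+1 0 = 0.
    by rewrite /hexp ltxx mulr0 subr0.
  (* At 0 the difference quotient of [hexp k] is [hexp k.+1] on the right and 0 on the left;
     [hexp_le] bounds the former by a multiple of [s]. *)
  suff h : (fun s => s^-1 *: ((hexp k \o shift 0) (s *: (1 : R)) - hexp k 0)) @ 0^' --> (0 : R).
    by split; [apply/cvg_ex; exists 0|apply/cvg_lim].
  apply/cvgr0Pnorm_lt => e e0; have C0 : 0 < k.+2%:R ^+ k.+2 :> R by rewrite exprn_gt0.
  have h0 : hexp k 0 = 0 by rewrite /hexp ltxx.
  near=> s.
  rewrite /= h0 subr0 addr0 /GRing.scale /= mulr1 {1}/hexp.
  have s1 : `|s| < e / k.+2%:R ^+ k.+2.
    near: s; apply: dnbhs0_lt; exact: divr_gt0.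
  case: ifPn => s0; last by rewrite mulr0 normr0.
  have -> : s^-1 * (s^-1 ^+ k * expR (- s^-1)) = hexp k.+1 s.
    by rewrite /hexp s0 exprS mulrA.
  rewrite ger0_norm ?hexp_ge0 //; apply: le_lt_trans (hexp_le _ (ltW s0)) _.
  by rewrite mulrC -ltr_pdivlMr // -(gtr0_norm s0).
Unshelve. all: by end_near.
Qed.

Lemma Cn_hexp n k : Cn n (hexp k).
Proof.
elim: n k => [|n ih] k; split => //; try by move=> x; case: (is_derive_hexp k x).
rewrite (derive1_eq (is_derive_hexp k)).
have -> : (fun t => hexp k.+2 t - k%:R * hexp k.+1 t) =
    hexp k.+2 \+ (cst (- k%:R) \* hexp k.+1).
  by apply/funext => t /=; rewrite mulNr.
by apply: CnD => //; apply: CnM => //; exact: Cn_cst.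
Qed.

(** The first factor is positive for [t > a], the second for [t < b + n.+1%:R^-1]. The argument of
    the second is at least [n.+1] on all of [t <= b], and eventually negative at each [t > b], so
    the limit is the indicator of []a, b]] with the right endpoint included. *)
Definition bump (n : nat) (a b t : R) : R :=
  hexp 0 (n.+1%:R * (t - a)) * hexp 0 (n.+1%:R ^+ 2 * (b - t) + n.+1%:R).

Lemma smooth1_bump n a b : smooth1 (bump n a b).
Proof.
move=> m; pose N : R := n.+1%:R.
rewrite (_ : bump n a b = (fun t => hexp 0 (N * t + (- (N * a)))) \*
   (fun t => hexp 0 (- N ^+ 2 * t + (N ^+ 2 * b + N)))); last first.
  by apply/funext => t /=; congr (hexp 0 _ * hexp 0 _); rewrite /N; ring.
by apply: CnM; apply: Cn_affine; exact: Cn_hexp.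
Qed.

Lemma hexp0_le1 t : 0 <= hexp 0 t <= 1.
Proof.
rewrite hexp_ge0 /hexp; case: ifP => t0 //=.
by rewrite mul1r -expR0 ler_expR oppr_le0 invr_ge0 ltW.
Qed.

Lemma bump_le1 n a b t : 0 <= bump n a b t <= 1.
Proof.
have /andP[h0 h1] := hexp0_le1 (n.+1%:R * (t - a)).
have /andP[k0 k1] := hexp0_le1 (n.+1%:R ^+ 2 * (b - t) + n.+1%:R).
by rewrite /bump mulr_ge0 //= mulr_ile1.
Qed.

Lemma bump_supp n a b t : bump n a b t != 0 -> a < t < b + n.+1%:R^-1.
Proof.
have N0 : 0 < n.+1%:R :> R by [].
rewrite /bump mulf_eq0 negb_or => /andP[].
rewrite {1}/hexp; case: ifPn => [|_]; last by rewrite eqxx.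
rewrite pmulr_rgt0 // subr_gt0 => -> _.
rewrite {1}/hexp; case: ifPn => [|_]; last by rewrite eqxx.
rewrite (_ : _ + _ = n.+1%:R ^+ 2 * (b + n.+1%:R^-1 - t)); last first.
  by move: N0; set N := n.+1%:R => N0; field; exact: lt0r_neq0.
by rewrite pmulr_rgt0 ?subr_gt0 ?exprn_gt0.
Qed.

Lemma bump_shift n a b s t : bump n a b (t + s) = bump n (a - s) (b - s) t.
Proof. by rewrite /bump; congr (hexp 0 _ * hexp 0 _); ring. Qed.

Lemma hexp0_cvg (u : nat -> R) : (forall n, n.+1%:R <= u n) \/
   (exists2 c, 0 < c & forall n, u n = n.+1%:R * c) ->
  hexp 0 (u n) @[n --> \oo] --> (1 : R).
Proof.
move=> h.
have [c c0 hu] : exists2 c, 0 < c & forall n, n.+1%:R * c <= u n.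
  by case: h => [h|[c c0 h]]; [exists 1 => // n; rewrite mulr1|exists c => // n; rewrite h].
have -> : (fun n => hexp 0 (u n)) = (fun n => expR (- (u n)^-1)).
  apply/funext => n; rewrite /hexp ifT ?mul1r //.
  by apply: lt_le_trans (hu n); rewrite mulr_gt0.
rewrite -expR0.
apply: continuous_cvg; first exact: continuous_expR.
rewrite -oppr0; apply: cvgN.
apply: (@squeeze_cvgr _ _ _ _ (cst 0) (fun n => c^-1 * n.+1%:R^-1)).
- near=> n; have p : 0 < n.+1%:R * c by rewrite mulr_gt0.
  have pu := lt_le_trans p (hu n).
  by rewrite invr_ge0 (ltW pu) /= -invfM mulrC lef_pV2.
- exact: cvg_cst.
- rewrite -(mulr0 c^-1); apply: cvgM; first exact: cvg_cst.
  exact: cvg_harmonic.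
Unshelve. all: by end_near.
Qed.

Lemma bump_cvg a b t :
  bump n a b t @[n --> \oo] --> (\1_(`]a, b]) t : R).
Proof.
rewrite indicE mem_setE in_itv /=.
have [ta|at_] := ltP a t; last first.
  rewrite (_ : (fun n => _) = cst 0); first exact: cvg_cst.
  apply/funext => n; rewrite /bump {1}/hexp ifF ?mul0r //.
  by apply/negbTE; rewrite -leNgt pmulr_rle0 // subr_le0.
have [tb|bt] := leP t b; rewrite /=.
  rewrite -(mulr1 (1%:R)); apply: cvgM; apply: hexp0_cvg.
    by right; exists (t - a); rewrite ?subr_gt0.
  by left => n; rewrite lerDr mulr_ge0 ?exprn_ge0 // subr_ge0.
have p : 0 < t - b by rewrite subr_gt0.
apply: cvg_near_cst; near=> n.
rewrite /bump mulrC {1}/hexp ifF ?mul0r //.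
apply/negbTE; rewrite -leNgt; have N0 : 0 < n.+1%:R :> R by [].
have : n.+1%:R^-1 < t - b.
  by near: n; exact: near_infty_natSinv_lt (PosNum p).
set N := n.+1%:R in N0 * => Nt.
have -> : N ^+ 2 * (b - t) + N = N ^+ 2 * (N^-1 - (t - b)).
  by field; exact: lt0r_neq0.
by rewrite pmulr_rle0 ?exprn_gt0 // subr_le0 ltW.
Unshelve. all: by end_near.
Qed.

End Smooth1.

(** * Tensor products of bumps as test functions of the plane *)

Section Smooth2.
Context {R : realType}.
Implicit Types (x : R * R) (i : 'I_2) (a b : R -> R).

Lemma continuous_fst2 : continuous (fst : R * R -> R).
Proof. by move=> x; exact: cvg_fst. Qed.

Lemma continuous_snd2 : continuous (snd : R * R -> R).
Proof. by move=> x; exact: cvg_snd. Qed.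

Lemma differentiable_fst2 x : differentiable (fst : R * R -> R) x.
Proof. by apply: linear_differentiable; exact: continuous_fst2. Qed.

Lemma differentiable_snd2 x : differentiable (snd : R * R -> R) x.
Proof. by apply: linear_differentiable; exact: continuous_snd2. Qed.

Definition tens a b (x : R * R) : R := a x.1 * b x.2.

Lemma is_derive_line (f : R * R -> R) x i (s : R) :
  differentiable f (x + s *: basis2 i) ->
  is_derive s 1 (fun t : R => f (x + t *: basis2 i)) (pderiv i f (x + s *: basis2 i)).
Proof.
move=> df; have dv : derivable f (x + s *: basis2 i) (basis2 i).
  exact: diff_derivable.
have E : (fun h : R => h^-1 *: (((fun t : R => f (x + t *: basis2 i)) \o shift s) (h *: (1 : R)) -
    f (x + s *: basis2 i))) =
  (fun h : R => h^-1 *: ((f \o shift (x + s *: basis2 i)) (h *: basis2 i) -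
    f (x + s *: basis2 i))).
  apply/funext => h /=; congr (_ *: (f _ - _)).
  by rewrite [h%:A]mulr1 scalerDl addrCA.
split; first by rewrite /derivable E.
by rewrite /pderiv /derive E.
Qed.

Lemma differentiable_tens a b x : derivable a x.1 1 -> derivable b x.2 1 ->
  differentiable (tens a b) x.
Proof.
move=> /derivable1_diffP da /derivable1_diffP db.
apply: (@differentiableM _ _ (a \o fst) (b \o snd)).
  by apply: differentiable_comp => //; exact: differentiable_fst2.
by apply: differentiable_comp => //; exact: differentiable_snd2.
Qed.

Lemma pderiv_tens a b x i : (forall t, derivable a t 1) -> (forall t, derivable b t 1) ->
  pderiv i (tens a b) x = if i == ord0 then tens (derive1 a) b x else tens a (derive1 b) x.
Proof.
move=> da db.
have := @is_derive_line (tens a b) x i 0; rewrite scale0r addr0.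
move=> /(_ (differentiable_tens (da _) (db _))) [_ <-].
rewrite /basis2 /tens; case: ifP => _ /=.
  have -> : (fun t : R => a (x.1 + t *: 1) * b (x.2 + t *: 0)) =
     (fun t => a (1 * t + x.1)) \* cst (b x.2).
    by apply/funext => t /=; rewrite /GRing.scale /= mulr0 addr0 mulr1 mul1r addrC.
  have D := is_derive_affine (c := 1) (d := x.1) (x := 0) (da _).
  rewrite deriveM; [|by case: D|exact: derivable_cst].
  by rewrite derive_cst scaler0 add0r (@derive_val _ _ _ _ _ _ _ D) mulr1 mulr0 add0r mulrC.
have -> : (fun t : R => a (x.1 + t *: 0) * b (x.2 + t *: 1)) =
     cst (a x.1) \* (fun t => b (1 * t + x.2)).
  by apply/funext => t /=; rewrite /GRing.scale /= mulr0 addr0 mulr1 mul1r addrC.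
have D := is_derive_affine (c := 1) (d := x.2) (x := 0) (db _).
rewrite deriveM; [|exact: derivable_cst|by case: D].
by rewrite derive_cst scaler0 addr0 (@derive_val _ _ _ _ _ _ _ D) mulr1 mulr0 add0r.
Qed.

Lemma smooth1_derive1 a : smooth1 a -> smooth1 (derive1 a).
Proof. by move=> sa n; have [] := sa n.+1. Qed.

Lemma smooth1_derivable a : smooth1 a -> forall t, derivable a t 1.
Proof. by move=> sa t; have [] := sa 0. Qed.

Lemma smooth_tens a b : smooth1 a -> smooth1 b -> smooth (tens a b).
Proof.
move=> sa sb s.
(* Iterated partial derivatives of a tensor product are again tensor products of smooth functions,
   and these are differentiable. *)
suff [c [d [sc sd ->]]] : exists c d, [/\ smooth1 c, smooth1 d & foldr pderiv (tens a b) s = tens c d].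
  by move=> x; apply: differentiable_tens; exact: smooth1_derivable.
elim: s => [|i s [c [d [sc sd E]]]]; first by exists a, b.
rewrite /= E; have := pderiv_tens _ i (smooth1_derivable sc) (smooth1_derivable sd).
case: (i == ord0) => h.
  by exists (derive1 c), d; split=> //; [exact: smooth1_derive1|exact/funext].
by exists c, (derive1 d); split=> //; [exact: smooth1_derive1|exact/funext].
Qed.

Definition tbump n (p q : R * R) := tens (bump n p.1 q.1) (bump n p.2 q.2).

Lemma tbump_supp n p q x : tbump n p q x != 0 -> cbox p (enlarge n q) x.
Proof.
rewrite /tbump /tens mulf_eq0 negb_or => /andP[/bump_supp/andP[h1 h2] /bump_supp/andP[h3 h4]].
by apply/cboxE; split; exact: ltW.
Qed.

Lemma closed_cbox (p q : R * R) : closed (cbox p q).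
Proof.
rewrite /cbox (_ : _ `*` _ = (fst @^-1` `[p.1, q.1]) `&` (snd @^-1` `[p.2, q.2])) //.
apply: closedI; apply: closed_comp.
- by move=> ? _; exact: continuous_fst2.
- exact: itv_closed.
- by move=> ? _; exact: continuous_snd2.
- exact: itv_closed.
Qed.

Lemma compact_cbox (p q : R * R) : compact (cbox p q).
Proof. by apply: compact_setX; exact: segment_compact. Qed.

Lemma tbump_test (w : set (R * R)) n p q : cbox p (enlarge n q) `<=` w ->
  test_function w (tbump n p q).
Proof.
move=> sw.
have S : closure [set x | tbump n p q x != 0] `<=` cbox p (enlarge n q).
  have -> := (closure_id _).1 (@closed_cbox p (enlarge n q)).
  by apply: closure_subset => x; exact: tbump_supp.
split; [by apply: smooth_tens; exact: smooth1_bump| |exact: subset_trans sw].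
by apply: subclosed_compact S; [exact: closed_closure|exact: compact_cbox].
Qed.

Lemma tbump_le1 n p q x : 0 <= tbump n p q x <= 1.
Proof.
have /andP[h1 h2] := bump_le1 n p.1 q.1 x.1.
have /andP[h3 h4] := bump_le1 n p.2 q.2 x.2.
by rewrite /tbump /tens mulr_ge0 // mulr_ile1.
Qed.

Lemma tbump_shift n p q i s x :
  tbump n p q (shift2 i s x) = tbump n (shift2 i (- s) p) (shift2 i (- s) q) x.
Proof.
by rewrite /tbump /tens /shift2; case: (i == ord0); rewrite /= opprK bump_shift opprK.
Qed.

Lemma tbump_cvg p q x : tbump n p q x @[n --> \oo] --> (\1_(box p q) x : R).
Proof.
rewrite (_ : \1_(box p q) x = \1_(`]p.1, q.1]) x.1 * \1_(`]p.2, q.2]) x.2).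
  by apply: cvgM; exact: bump_cvg.
by rewrite !indicE -natrM mulnb; congr (_%:R); rewrite -in_setX.
Qed.

End Smooth2.

(** * Dominated convergence for real-valued integrals *)

Section RealConvergence.
Context d (T : measurableType d) (R : realType) (mu : {measure set T -> \bar R}).
Variables (D : set T).
Hypothesis mD : measurable D.
Implicit Types f g : T -> R.

Lemma integrable_dominated f g : measurable_fun D f ->
  (forall x, D x -> `|f x| <= g x) -> mu.-integrable D (EFin \o g) ->
  mu.-integrable D (EFin \o f).
Proof.
move=> mf fg ig; apply: le_integrable ig => //; first exact/measurable_EFinP.
move=> x Dx /=; rewrite lee_fin; apply: le_trans (fg x Dx) _.
exact: ler_norm.
Qed.

Lemma Rintegral_dominated_cvg (f_ : nat -> T -> R) f g :
  (forall n, measurable_fun D (f_ n)) ->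
  (forall x, D x -> f_ n x @[n --> \oo] --> f x) ->
  mu.-integrable D (EFin \o g) ->
  (forall n x, D x -> `|f_ n x| <= g x) ->
  mu.-integrable D (EFin \o f) /\
  \int[mu]_(x in D) f_ n x @[n --> \oo] --> \int[mu]_(x in D) f x.
Proof.
move=> mf cf ig fg.
have mf0 : measurable_fun D f by apply: (measurable_fun_cvg mf) => x; exact: cf.
have [] := @dominated_convergence _ T R mu D mD (fun n x => (f_ n x)%:E)
  (EFin \o f) (EFin \o g).
- by move=> n; exact/measurable_EFinP.
- exact/measurable_EFinP.
- by apply: aeW => x Dx; apply: cvg_EFin; [exact: nearW|exact: cf].
- exact: ig.
- by apply: aeW => x n Dx; rewrite lee_fin; exact: fg.
move=> fi _ h; split=> //; apply: fine_cvg.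
by rewrite fineK //; exact: integrable_fin_num.
Qed.

End RealConvergence.

(** * The fundamental lemma of the calculus of variations *)

Section Fundamental.
Context {R : realType}.
Local Notation T1 := (measurableTypeR R).
Local Notation T := (T1 * T1)%type.
Implicit Types (w V : set (R * R)) (f g : R * R -> R) (i : 'I_2).

Lemma subset_cbox (p q p' q' : R * R) : p'.1 <= p.1 -> p'.2 <= p.2 ->
  q.1 <= q'.1 -> q.2 <= q'.2 -> cbox p q `<=` cbox p' q'.
Proof. by move=> ? ? ? ? x /cboxE[? ? ? ?]; apply/cboxE; split; lra. Qed.

Lemma le_enlarge n N (q q' : R * R) : (N <= n)%N -> q.1 <= q'.1 -> q.2 <= q'.2 ->
  (enlarge n q).1 <= (enlarge N q').1 /\ (enlarge n q).2 <= (enlarge N q').2.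
Proof.
move=> Nn q1 q2.
have : n.+1%:R^-1 <= N.+1%:R^-1 :> R by rewrite lef_pV2 ?posrE // ler_nat.
by rewrite /enlarge /= => h; split; exact: lerD.
Qed.

Lemma mfun_tbump n p q (D : set T) : measurable_fun D (tbump n p q : T -> R).
Proof.
apply: continuous_measurable_fun2 => x; apply: differentiable_continuous.
by have [/(_ [::] x)] := @tbump_test R (cbox p (enlarge n q)) n p q (fun _ => id).
Qed.

(** The functions [tbump n p' q'] tend to the indicator of the box and are bounded by 1. All of this
    happens inside one compact box, where [g] is integrable and so [|g|] dominates. *)
Lemma box_integral0 (p q : R * R) N g (w : set (R * R)) :
  open w -> cbox p (enlarge N q) `<=` w ->
  measurable_fun (w : set T) g ->
  leb2.-integrable (cbox p (enlarge N q)) (EFin \o g) ->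
  (forall n p' q', cbox p' (enlarge n q') `<=` cbox p (enlarge N q) ->
    \int[leb2]_(x in w) (g x * tbump n p' q' x) = 0) ->
  forall p' q', p.1 <= p'.1 -> p.2 <= p'.2 -> q'.1 <= q.1 -> q'.2 <= q.2 ->
  (\int[leb2]_(x in box p' q') (g x)%:E = 0)%E.
Proof.
move=> ow Kw mg ig H p' q' p1 p2 q1 q2; set K := cbox p (enlarge N q) in Kw ig H.
have mK : @measurable _ T K by exact: measurable_cbox.
have N0 : 0 <= N.+1%:R^-1 :> R by rewrite invr_ge0.
have bK : box p' q' `<=` K.
  move=> x /boxE[? ? ? ?]; apply/cboxE => /=; move: N0; set d := _^-1 => d0.
  by split; lra.
have mgK : measurable_fun K (g : T -> R).
  by apply: measurable_funS mg => //; exact: open_measurable2.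
have [|_ hc] := @Rintegral_dominated_cvg _ T R leb2 K mK
  (fun n x => g x * tbump n p' q' x) (fun x => g x * \1_(box p' q') x)
  (fun x => `|g x|)
  (fun n => measurable_funM mgK (@mfun_tbump n p' q' K))
  (fun x _ => cvgM (cvg_cst _) (@tbump_cvg _ p' q' x)) (integrable_norm ig).
  move=> n x _; rewrite normrM ler_piMr //.
  by have /andP[h0 h1] := tbump_le1 n p' q' x; rewrite ger0_norm.
(* Only for [n >= N] does the overhang of [tbump n p' q'] fit into the room left by [enlarge N]. *)
have H0 : \forall n \near \oo,
    \int[leb2]_(x in K) (g x * tbump n p' q' x) = 0.
  near=> n; have nN : (N <= n)%N by near: n; exists N.
  have [e1 e2] := le_enlarge nN q1 q2.
  have sK := subset_cbox p1 p2 e1 e2.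
  rewrite -(H n p' q' sK) Rintegral_mkcond [RHS]Rintegral_mkcond.
  apply: eq_Rintegral => x _; rewrite !patchE.
  case: ifPn => xK; first by rewrite ifT // inE; apply: Kw; rewrite inE in xK.
  case: ifPn => // _; have [->|/tbump_supp/sK Kx] := eqVneq (tbump n p' q' x) 0.
    by rewrite mulr0.
  by rewrite notin_setE in xK.
have E : \int[leb2]_(x in K) (g x * \1_(box p' q') x) = 0.
  rewrite -(cvg_lim (@Rhausdorff R) hc); apply: cvg_lim; first exact: Rhausdorff.
  exact: cvg_near_cst.
have igb : leb2.-integrable (box p' q') (EFin \o g).
  by apply: integrableS ig => //; exact: measurable_box.
rewrite -[LHS]fineK; last by apply: integrable_fin_num => //; exact: measurable_box.
congr (_%:E); rewrite -[RHS]E [LHS](@Rintegral_mkcond _ _ _ leb2 (box p' q') g).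
rewrite [RHS]Rintegral_mkcond; apply: eq_Rintegral => x _; rewrite !patchE.
have [xb|xb] := boolP (x \in box p' q').
  by rewrite ifT ?indicE ?xb ?mulr1 // inE; apply: bK; rewrite inE in xb.
by case: ifP => //; rewrite indicE (negbTE xb) mulr0.
Unshelve. all: by end_near.
Qed.

(** Dynkin induction carries the vanishing of the integral from sub-boxes to all Borel subsets of
    the box, and a function with all these integrals 0 is 0 almost everywhere. *)
Lemma box_ae0 (p q : R * R) N g (w : set (R * R)) :
  open w -> cbox p (enlarge N q) `<=` w ->
  measurable_fun (w : set T) g ->
  leb2.-integrable (cbox p (enlarge N q)) (EFin \o g) ->
  (forall n p' q', cbox p' (enlarge n q') `<=` cbox p (enlarge N q) ->
    \int[leb2]_(x in w) (g x * tbump n p' q' x) = 0) ->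
  {ae @leb2 R, forall x, box p q x -> g x = 0}.
Proof.
move=> ow Kw mg ig H; have Hb := box_integral0 ow Kw mg ig H.
have mQ := @measurable_box R p q; set Q := box p q in mQ *.
have QK : Q `<=` cbox p (enlarge N q).
  have N0 : 0 <= N.+1%:R^-1 :> R by rewrite invr_ge0.
  move=> x /boxE[? ? ? ?]; apply/cboxE => /=; move: N0; set e := _^-1 => e0.
  by split; lra.
have mK := @measurable_cbox R p (enlarge N q).
have igQ : leb2.-integrable Q (EFin \o g) by exact: integrableS ig.
have igE (E : set T) : measurable E -> leb2.-integrable (E `&` Q) (EFin \o g).
  by move=> mE; apply: integrableS igQ => //; exact: measurableI.
have P (E : set T) : measurable E -> (\int[leb2]_(x in E `&` Q) (g x)%:E = 0)%E.
  rewrite measurable_boxes.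
  apply: (dynkin_induction (P := fun E : set T => (\int[leb2]_(x in E `&` Q) (g x)%:E = 0)%E)
    measurable_boxes setI_closed_boxes).
  - by rewrite setTI; exact: Hb.
  - move=> _ [[p' q'] _ <-] /=; rewrite /Q boxI.
    by apply: Hb; rewrite /= ?le_max ?ge_min lexx ?orbT.
  - move=> S mS S0.
    have QE : Q = (S `&` Q) `|` (~` S `&` Q) by rewrite -setIUl setUv setTI.
    have : (\int[leb2]_(x in Q) (g x)%:E = 0)%E by exact: Hb.
    rewrite {1}QE integral_setU_EFin //=.
    + by rewrite S0 add0e.
    + exact: measurableI.
    + by apply: measurableI => //; exact: measurableC.
    + by rewrite -QE; apply/measurable_EFinP; exact: measurable_int igQ.
    + by apply/disj_setPS => x [[Sx _] [nSx _]].
  - move=> F mF tF F0; rewrite setI_bigcupl integral_bigcup.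
    + by rewrite eseries0 // => n _ _; exact: F0.
    + exact: trivIset_setIr.
    + by move=> k; exact: measurableI.
    + by rewrite -setI_bigcupl; apply: igE; exact: bigcupT_measurable.
have : ae_eq leb2 Q (EFin \o g) (cst 0%E).
  apply: integral_ae_eq => //.
  move=> E EQ mE; rewrite integral0 -(P E mE); congr integral.
  by apply/esym/setIidl.
apply: filterS => x h Qx; have := h Qx.
by move=> [].
Qed.

(** Testing against [tbump] alone matters later: these functions are stable under translation
    ([weak_diff]), and their partial derivatives visibly commute ([weak_partialC]). *)
Theorem fundamental_lemma w g : open w -> L1loc w g ->
  (forall n p q, cbox p (enlarge n q) `<=` w ->
    \int[leb2]_(x in w) (g x * tbump n p q x) = 0) ->
  {ae @leb2 R, forall x, w x -> g x = 0}.
Proof.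
move=> ow [mg ig] H; have [p [pP wE]] := open_boxes ow.
have : {ae @leb2 R, forall x, forall n, box (p n).1 (p n).2 x -> g x = 0}.
  apply: ae_foralln => n; case: (pP n) => [[N Nw]|->]; last exact: aeW.
  apply: (box_ae0 (N := N) ow Nw mg).
    by apply: ig => //; exact: compact_cbox.
  by move=> m p' q' s; apply: H; exact: subset_trans Nw.
by apply: filterS => x h; rewrite wE => -[n _]; exact: h.
Qed.

End Fundamental.

(** * Local integrability, test functions, uniqueness of weak derivatives *)

Section TestFunctions.
Context {R : realType}.
Local Notation T1 := (measurableTypeR R).
Local Notation T := (T1 * T1)%type.
Implicit Types (w V K : set (R * R)) (f g phi psi : R * R -> R) (i : 'I_2).

Lemma ae_leb2S (P Q : R * R -> Prop) : (forall x, P x -> Q x) ->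
  {ae @leb2 R, forall x, P x} -> {ae @leb2 R, forall x, Q x}.
Proof. by move=> PQ; apply: (@filterS _ _ (ae_filter_ringOfSetsType leb2)). Qed.

Lemma ae_leb2S2 (P Q S : R * R -> Prop) : (forall x, P x -> Q x -> S x) ->
  {ae @leb2 R, forall x, P x} -> {ae @leb2 R, forall x, Q x} ->
  {ae @leb2 R, forall x, S x}.
Proof. by move=> PQ; apply: (@filterS2 _ _ (ae_filter_ringOfSetsType leb2)). Qed.

Definition csupp phi : set (R * R) := closure [set x | phi x != 0].

Lemma csupp_off phi x : ~ csupp phi x -> phi x = 0.
Proof.
by move=> nx; apply: contra_notP nx => /eqP nx; exact: subset_closure.
Qed.

Lemma test_continuous w phi : test_function w phi -> continuous phi.
Proof. by move=> [sp _ _] x; apply: differentiable_continuous; exact: (sp [::]). Qed.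

Lemma test_differentiable w phi : test_function w phi ->
  forall x, differentiable phi x.
Proof. by move=> [sp _ _] x; exact: (sp [::]). Qed.

Lemma test_pderiv_continuous w i phi : test_function w phi ->
  continuous (pderiv i phi).
Proof. by move=> [sp _ _] x; apply: differentiable_continuous; exact: (sp [:: i]). Qed.

Lemma pderiv_off K i phi : closed K -> (forall x, ~ K x -> phi x = 0) ->
  forall x, ~ K x -> pderiv i phi x = 0.
Proof.
move=> cK phi0 x Kx; rewrite /pderiv (near_eq_derive (g := cst 0)) ?derive_cst //.
have : nbhs x (~` K) by apply: open_nbhs_nbhs; split=> //; exact: closed_openC.
by apply: filterS => y; exact: phi0.
Qed.

Lemma continuous_compact_bounded psi K : continuous psi -> compact K ->
  (forall x, ~ K x -> psi x = 0) -> exists2 M : R, 0 <= M & forall x, `|psi x| <= M.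
Proof.
move=> cp cK p0.
have /compact_bounded[M [_ bM]] := continuous_compact (continuous_subspaceT cp) cK.
have h := bM (`|M| + 1) (ltr_pwDr ltr01 (ler_norm M)).
exists (`|M| + 1) => [|x]; first exact: addr_ge0.
have [Kx|Kx] := pselect (K x); first by apply: h; exists x.
by rewrite p0 // normr0 addr_ge0.
Qed.

Lemma compact_closed2 K : compact K -> closed K.
Proof. by apply: compact_closed; exact: norm_hausdorff. Qed.

Lemma compact_measurable2 K : compact K -> @measurable _ T K.
Proof. by move=> cK; apply: closed_measurable2; exact: compact_closed2. Qed.

Lemma compact_finite2 K : compact K -> (leb2 (K : set T) < +oo)%E.
Proof.
by move=> cK; apply: bounded_leb2; [exact: compact_measurable2|exact: compact_bounded].
Qed.

Lemma integrable_mul_cont w g psi K : open w -> L1loc w g -> continuous psi ->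
  compact K -> K `<=` w -> (forall x, ~ K x -> psi x = 0) ->
  leb2.-integrable (w : set T) (EFin \o (fun x => g x * psi x)).
Proof.
move=> ow [mg ig] cp cK Kw p0.
have mw := open_measurable2 ow; have mK := compact_measurable2 cK.
have [M M0 bM] := continuous_compact_bounded cp cK p0.
have mp D : measurable_fun D (psi : T -> R) by exact: continuous_measurable_fun2.
have iK : leb2.-integrable K (EFin \o (fun x : T => g x * psi x)).
  apply: (@integrable_dominated _ T R leb2 K mK _ (fun x => M * `|g x|)) => //.
  - by apply: measurable_funM => //; exact: measurable_funS mg.
  - by move=> x _; rewrite normrM mulrC ler_wpM2r.
  - by apply: (integrableZl mK M (f := EFin \o (fun x => `|g x|))); exact: integrable_norm (ig _ cK Kw).
have := (integrable_mkcond _ mK).1 iK.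
rewrite -[X in integrable _ _ X](_ : (EFin \o (fun x => g x * psi x)) \_ w = _).
  by move/(integrable_mkcond _ mw).2.
apply/funext => x; rewrite !patchE.
have [xK|xK] := boolP (x \in K); first by rewrite ifT // inE; apply: Kw; rewrite inE in xK.
by case: ifP => // _ /=; rewrite p0 ?mulr0 //; rewrite notin_setE in xK.
Qed.

Lemma integrable_mul_test w g phi : open w -> L1loc w g -> test_function w phi ->
  leb2.-integrable (w : set T) (EFin \o (fun x => g x * phi x)).
Proof.
move=> ow lg tp; have [_ cK Kw] := tp.
by apply: (integrable_mul_cont ow lg (test_continuous tp) cK Kw) => x; exact: csupp_off.
Qed.

Lemma integrable_mul_pderiv w g phi i : open w -> L1loc w g -> test_function w phi ->
  leb2.-integrable (w : set T) (EFin \o (fun x => g x * pderiv i phi x)).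
Proof.
move=> ow lg tp; have [_ cK Kw] := tp.
apply: (integrable_mul_cont ow lg (test_pderiv_continuous tp) cK Kw).
by apply: pderiv_off; [exact: closed_closure|exact: csupp_off].
Qed.

Lemma L1locB w f g : open w -> L1loc w f -> L1loc w g -> L1loc w (f \- g).
Proof.
move=> ow [mf lf] [mg lg]; split; first exact: measurable_funB.
move=> K cK Kw; have mK := compact_measurable2 cK.
have := integrableB mK (lf K cK Kw) (lg K cK Kw).
by apply: eq_integrable => // x _; rewrite /= EFinB.
Qed.

Lemma L1loc_ae_eq0 w g : open w -> L1loc w g ->
  (forall phi, test_function w phi -> \int[leb2]_(x in w) (g x * phi x) = 0) ->
  {ae @leb2 R, forall x, w x -> g x = 0}.
Proof.
move=> ow lg H; apply: fundamental_lemma => // n p q pq; apply: H.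
exact: tbump_test.
Qed.

Lemma weak_partial_unique w i f g h : open w ->
  is_weak_partial w i f g -> is_weak_partial w i f h ->
  {ae @leb2 R, forall x, w x -> g x = h x}.
Proof.
move=> ow [lf lg Hg] [_ lh Hh]; have mw := open_measurable2 ow.
have : {ae @leb2 R, forall x, w x -> (g \- h) x = 0}.
  apply: L1loc_ae_eq0 => //; first exact: L1locB.
  move=> phi tp.
  under eq_Rintegral do rewrite mulrBl.
  rewrite RintegralB //; try exact: integrable_mul_test.
  have /eqP := Hg phi tp; rewrite (Hh phi tp) eqr_opp => /eqP ->.
  by rewrite subrr.
by apply: ae_leb2S => x h0 wx; apply/eqP; rewrite -subr_eq0; apply/eqP/h0.
Qed.

(** [weak_partial] is a choice: it becomes usable once some weak derivative is exhibited, and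
    uniqueness then identifies the two almost everywhere. *)
Lemma weak_partialP w i f g : open w -> is_weak_partial w i f g ->
  is_weak_partial w i f (weak_partial w i f) /\
  {ae @leb2 R, forall x, w x -> weak_partial w i f x = g x}.
Proof.
move=> ow h; have h2 : is_weak_partial w i f (weak_partial w i f).
  exact: (@xgetPex _ _ [set g | is_weak_partial w i f g] (ex_intro _ g h)).
by split=> //; exact: weak_partial_unique h2 h.
Qed.

(** Measurability of the new functions is assumed because the Borel sigma-algebra is not complete
    for [leb2]: it does not pass to almost everywhere equal functions. *)
Lemma is_weak_partial_ae w i f f' g g' : open w -> is_weak_partial w i f g ->
  mfun_on w f' -> mfun_on w g' ->
  {ae @leb2 R, forall x, w x -> f x = f' x} ->
  {ae @leb2 R, forall x, w x -> g x = g' x} ->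
  is_weak_partial w i f' g'.
Proof.
move=> ow [lf lg H] mf' mg' ff gg; have mw := open_measurable2 ow.
have L f0 f1 : L1loc w f0 -> mfun_on w f1 ->
    {ae @leb2 R, forall x, w x -> f0 x = f1 x} -> L1loc w f1.
  move=> [mf0 lf0] mf1 e; split => // K cK Kw; have mK := compact_measurable2 cK.
  apply/integrableP; split.
    by apply/measurable_EFinP; exact: measurable_funS mf1.
  have /integrableP[mfK] := lf0 K cK Kw.
  congr (_ < _)%E; apply: ae_eq_integral => //.
  - exact: measurableT_comp.
  - apply: measurableT_comp => //; apply/measurable_EFinP; exact: measurable_funS mf1.
  - by apply: ae_leb2S e => x h Kx /=; rewrite h //; exact: Kw.
split; [exact: L ff|exact: L gg|].
have I f0 f1 psi : mfun_on w f0 -> mfun_on w f1 -> continuous psi ->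
    {ae @leb2 R, forall x, w x -> f0 x = f1 x} ->
    \int[leb2]_(x in w) (f0 x * psi x) = \int[leb2]_(x in w) (f1 x * psi x).
  move=> m0 m1 cp e; congr fine; apply: ae_eq_integral => //.
  - apply/measurable_EFinP; apply: measurable_funM => //.
    exact: continuous_measurable_fun2.
  - apply/measurable_EFinP; apply: measurable_funM => //.
    exact: continuous_measurable_fun2.
  - by apply: ae_leb2S e => x h wx /=; rewrite h.
move=> phi tp.
rewrite -(I f f') //; [|by case: lf|exact: test_pderiv_continuous tp].
rewrite -(I g g') //; [|by case: lg|exact: test_continuous tp].
exact: H.
Qed.

End TestFunctions.

(** * Square-integrable functions on the plane, their translates and averages *)

Section L2Plane.
Context {R : realType}.
Local Notation T1 := (measurableTypeR R).
Local Notation T := (T1 * T1)%type.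
Implicit Types (u v : T -> R) (i : 'I_2).

(** The square of the L^2 norm. Keeping the square makes the triangle inequality [sqnD] a
    consequence of the pointwise bound (a + b)^2 <= 2 a^2 + 2 b^2. *)
Definition sqn u : \bar R := (\int[leb2]_x ((u x) ^+ 2)%:E)%E.

#[local] Arguments sqn u%_R.

Definition L2T u := measurable_fun setT u /\ (sqn u < +oo)%E.

Lemma sqn_ge0 u : (0 <= sqn u)%E.
Proof. by apply: integral_ge0 => x _; rewrite lee_fin sqr_ge0. Qed.

Lemma sqnE u : L2T u -> sqn u = (\int[leb2]_x (u x ^+ 2))%:E.
Proof. by move=> [_ fu]; rewrite /Rintegral fineK // ge0_fin_numE ?sqn_ge0. Qed.

Lemma measurable_sq u : measurable_fun setT u ->
  measurable_fun setT (fun x => ((u x) ^+ 2)%:E).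
Proof. by move=> mu; apply/measurable_EFinP; exact: measurable_funX. Qed.

Lemma le_sqn u v : measurable_fun setT u -> measurable_fun setT v ->
  (forall x, `|u x| <= `|v x|) -> (sqn u <= sqn v)%E.
Proof.
move=> mu mv uv; apply: ge0_le_integral => //.
- by move=> x _; rewrite lee_fin sqr_ge0.
- exact: measurable_sq.
- exact: measurable_sq.
- by move=> x _; rewrite lee_fin -(real_normK (num_real (u x)))
    -(real_normK (num_real (v x))) lerXn2r ?nnegrE.
Qed.

Lemma sqnZ (c : R) u : measurable_fun setT u ->
  sqn (fun x => c * u x) = ((c ^+ 2)%:E * sqn u)%E.
Proof.
move=> mu; rewrite /sqn; under eq_integral do rewrite exprMn EFinM.
rewrite ge0_integralZl //; first exact: measurable_sq.
- by move=> x _; rewrite lee_fin sqr_ge0.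
- by rewrite lee_fin sqr_ge0.
Qed.

Lemma sqnD u v : measurable_fun setT u -> measurable_fun setT v ->
  (sqn (u \+ v) <= 2%:E * sqn u + 2%:E * sqn v)%E.
Proof.
move=> mu mv; rewrite /sqn.
have p (w : T -> R) (x : T) : setT x -> (0 <= (w x ^+ 2)%:E)%E by move=> _; rewrite lee_fin sqr_ge0.
rewrite -!ge0_integralZl //; try exact: measurable_sq; try exact: p.
rewrite -ge0_integralD //=; try (by move=> x _; rewrite mule_ge0 // p);
  try (by apply: measurable_funeM; exact: measurable_sq).
apply: ge0_le_integral => //=; try (by move=> x _; rewrite ?adde_ge0 ?mule_ge0 ?p ?lee_fin ?sqr_ge0 //).
- by apply: measurable_sq; exact: measurable_funD.
- by apply: emeasurable_funD; apply: measurable_funeM; exact: measurable_sq.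
- move=> x _; rewrite -!EFinM -EFinD lee_fin; have := sqr_ge0 (u x - v x); nra.
Qed.

Lemma sqn_shift i s u : measurable_fun setT u -> sqn (u \o shift2 i s) = sqn u.
Proof.
move=> mu; rewrite /sqn -[RHS](ge0_integral_shift2 i s) //.
- exact: measurable_sq.
- by move=> x; rewrite lee_fin sqr_ge0.
Qed.

Lemma measurable_comp_shift2 i s u : measurable_fun setT u ->
  measurable_fun setT (u \o shift2 i s).
Proof. by move=> mu; apply: measurableT_comp => //; exact: measurable_shift2. Qed.

Lemma L2TD u v : L2T u -> L2T v -> L2T (u \+ v).
Proof.
move=> [mu fu] [mv fv]; split; first exact: measurable_funD.
by apply: le_lt_trans (sqnD mu mv) _; rewrite lte_add_pinfty // lte_mul_pinfty.
Qed.

Lemma L2TZ (c : R) u : L2T u -> L2T (fun x => c * u x).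
Proof.
move=> [mu fu]; split; first exact: measurable_funM.
by rewrite sqnZ // lte_mul_pinfty // lee_fin sqr_ge0.
Qed.

Lemma L2TB u v : L2T u -> L2T v -> L2T (u \- v).
Proof.
move=> Lu Lv; have := L2TD Lu (L2TZ (-1) Lv).
by congr L2T; apply/funext => x /=; rewrite mulN1r.
Qed.

Lemma L2T_shift i s u : L2T u -> L2T (u \o shift2 i s).
Proof.
by move=> [mu fu]; split; [exact: measurable_comp_shift2|rewrite sqn_shift].
Qed.

Lemma L2T_le u v : measurable_fun setT u -> L2T v -> (forall x, `|u x| <= `|v x|) ->
  L2T u.
Proof.
by move=> mu [mv fv] uv; split=> //; apply: le_lt_trans fv; exact: le_sqn.
Qed.

Lemma L2T_mul_bounded u v (M : R) : L2T u -> measurable_fun setT v ->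
  (forall x, `|v x| <= M) -> L2T (fun x => u x * v x).
Proof.
move=> Lu mv bv; have [mu _] := Lu.
apply: (L2T_le _ (L2TZ M Lu)); first exact: measurable_funM.
move=> x; rewrite mulrC !normrM ler_wpM2r //.
exact: le_trans (bv x) (ler_norm M).
Qed.

Lemma integrable_sq u : L2T u -> leb2.-integrable setT (EFin \o (fun x => u x ^+ 2)).
Proof.
move=> [mu fu]; apply/integrableP; split; first exact: measurable_sq.
by under eq_integral do rewrite /= ger0_norm ?sqr_ge0 //.
Qed.

Lemma integrable_mulL2 u v : L2T u -> L2T v ->
  leb2.-integrable setT (EFin \o (fun x => u x * v x)).
Proof.
move=> Lu Lv; have [mu fu] := Lu; have [mv fv] := Lv.
apply: (@integrable_dominated _ T R leb2 setT measurableT _ (fun x => u x ^+ 2 + v x ^+ 2)).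
- exact: measurable_funM.
- move=> x _; rewrite ler_norml; have := sqr_ge0 (u x - v x).
  by have := sqr_ge0 (u x + v x); have := sqr_ge0 (u x); have := sqr_ge0 (v x); nra.
- by have := integrableD measurableT (integrable_sq Lu) (integrable_sq Lv).
Qed.

Definition cvgL2 (u_ : nat -> T -> R) u := sqn (u_ n \- u) @[n --> \oo] --> 0%E.

Lemma cvgL2P (u_ : nat -> T -> R) u :
  cvgL2 u_ u <-> forall e : R, 0 < e -> \forall n \near \oo, (sqn (u_ n \- u) <= e%:E)%E.
Proof.
split.
  move=> + e e0; move/fine_cvgP => [fu].
  move/cvgr0Pnorm_le => /(_ e e0) h; near=> n.
  have f1 : sqn (u_ n \- u) \is a fin_num by near: n.
  rewrite -(fineK f1) lee_fin; apply: le_trans (ler_norm _) _.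
  by near: n.
move=> h; apply/fine_cvgP; split.
  have := h 1 ltr01; apply: filterS => n hn.
  by rewrite ge0_fin_numE ?sqn_ge0 //; apply: le_lt_trans hn _; rewrite ltry.
apply/cvgr0Pnorm_le => e e0; have := h e e0; apply: filterS => n hn.
rewrite ger0_norm ?fine_ge0 ?sqn_ge0 //= -lee_fin fineK //.
by rewrite ge0_fin_numE ?sqn_ge0 //; apply: le_lt_trans hn _; rewrite ltry.
Unshelve. all: by end_near.
Qed.

Lemma le_cvgn (a_ : nat -> R) (a b : R) : a_ n @[n --> \oo] --> a ->
  (forall n, a_ n <= b) -> a <= b.
Proof.
move=> ca ab; rewrite -(cvg_lim (@Rhausdorff R) ca).
by apply: limr_le; [apply/cvg_ex; exists a|exact: nearW].
Qed.

Lemma cvgL2_dominated (u_ : nat -> T -> R) u v :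
  (forall n, measurable_fun setT (u_ n)) ->
  (forall x, u_ n x @[n --> \oo] --> u x) -> L2T v ->
  (forall n x, `|u_ n x| <= v x) -> L2T u /\ cvgL2 u_ u.
Proof.
move=> mu_ cu Lv uv.
have mu : measurable_fun setT u by apply: (measurable_fun_cvg mu_) => x _; exact: cu.
have ux x : `|u x| <= v x by apply: le_cvgn (cvg_norm (cu x)) _ => n; exact: uv.
have v0 x : 0 <= v x by apply: le_trans (ux x).
split; first by apply: (L2T_le mu Lv) => x; rewrite (ger0_norm (v0 x)).
have c0 x : setT x -> (u_ n x - u x) ^+ 2 @[n --> \oo] --> (0 : R).
  move=> _; rewrite -[X in _ --> X](mul0r 0) -{1 2}(subrr (u x)).
  by apply: cvgM; apply: cvgB; first [exact: cu|exact: cvg_cst].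
have b0 n x : setT x -> `|(u_ n x - u x) ^+ 2| <= 4 * v x ^+ 2.
  move=> _; rewrite ger0_norm ?sqr_ge0 //.
  have := uv n x; have := ux x; rewrite !ler_norml => /andP[? ?] /andP[? ?].
  by nra.
have i0 : leb2.-integrable setT (EFin \o (fun x => 4 * v x ^+ 2)).
  exact: (integrableZl measurableT 4 (integrable_sq Lv)).
have [_] := @Rintegral_dominated_cvg _ T R leb2 setT measurableT
  (fun n x => (u_ n x - u x) ^+ 2) (cst 0) (fun x => 4 * v x ^+ 2)
  (fun n => measurable_funX _ (measurable_funB (mu_ n) mu)) c0 i0 b0.
rewrite Rintegral_cst // mul0r => h.
have L n : L2T (u_ n \- u).
  apply: (L2T_le _ (L2TZ 2 Lv)); first exact: measurable_funB.
  move=> x; rewrite [X in _ <= X]ger0_norm ?mulr_ge0 //=.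
  have := uv n x; have := ux x; rewrite !ler_norml => /andP[? ?] /andP[? ?].
  by apply/andP; split; lra.
apply/cvgL2P => e e0; move/cvgr0Pnorm_le: h => /(_ e e0); apply: filterS => n hn.
by rewrite sqnE // lee_fin; exact: le_trans (ler_norm _) hn.
Qed.

Lemma L2T_int u : L2T u -> sqn u \is a fin_num.
Proof. by move=> [_ fu]; rewrite ge0_fin_numE ?sqn_ge0. Qed.

Lemma young (d a v : R) : 0 < d -> `|a * v| <= d^-1 * a ^+ 2 + d * v ^+ 2.
Proof.
move=> d0; have -> : d^-1 * a ^+ 2 + d * v ^+ 2 = d^-1 * (a ^+ 2 + (d * v) ^+ 2).
  by field; exact: lt0r_neq0.
rewrite -(ler_pM2l d0) mulrA divff ?gt_eqF // mul1r -{1}(gtr0_norm d0) -normrM.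
rewrite mulrCA ler_norml; have := sqr_ge0 (a - d * v); have := sqr_ge0 (a + d * v).
by have := sqr_ge0 a; have := sqr_ge0 (d * v); nra.
Qed.

(* [2ab <= e a^2 + b^2/e], applied to [a = u_n - u], [b = v] and conversely *)
Lemma cvgL2_mul (u_ v_ : nat -> T -> R) u v :
  (forall n, L2T (u_ n)) -> (forall n, L2T (v_ n)) -> L2T u -> L2T v ->
  cvgL2 u_ u -> cvgL2 v_ v ->
  \int[leb2]_x (u_ n x * v_ n x) @[n --> \oo] --> \int[leb2]_x (u x * v x).
Proof.
move=> Lu_ Lv_ Lu Lv cu cv; apply/cvgrPdist_le => e e0.
(* The constants are fitted to the final bound [c * (m + m) + d * A], each of whose two terms is
   [e / 2]; the 1 in [A] only keeps it positive. *)
pose A := fine (sqn u) + fine (sqn v) + 1.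
have A0 : 0 < A by rewrite /A ltr_wpDl // addr_ge0 // fine_ge0 // sqn_ge0.
pose d := e / 2 / A; have d0 : 0 < d by rewrite !divr_gt0.
pose c := 1 + d^-1; have c0 : 0 < c by rewrite /c addr_gt0 // invr_gt0.
pose m := e / 4 / c; have m0 : 0 < m by rewrite !divr_gt0.
have hu := (cvgL2P _ _).1 cu m m0; have hv := (cvgL2P _ _).1 cv m m0.
near=> n.
have un : (sqn (u_ n \- u) <= m%:E)%E by near: n.
have vn : (sqn (v_ n \- v) <= m%:E)%E by near: n.
have LUn := L2TB (Lu_ n) Lu; have LVn := L2TB (Lv_ n) Lv.
rewrite -RintegralB //; [|exact: integrable_mulL2..].
apply: le_trans (le_normr_Rintegral _ _) _ => //.
  by have := integrableB measurableT (integrable_mulL2 Lu Lv) (integrable_mulL2 (Lu_ n) (Lv_ n)).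
pose B x := c * ((u_ n \- u) x ^+ 2 + (v_ n \- v) x ^+ 2) + d * (u x ^+ 2 + v x ^+ 2).
have iD (f g : T -> R) : leb2.-integrable setT (EFin \o f) ->
    leb2.-integrable setT (EFin \o g) -> leb2.-integrable setT (EFin \o (fun x => f x + g x)).
  by move=> i1 i2; have := integrableD measurableT i1 i2.
have iZ (k : R) (f : T -> R) : leb2.-integrable setT (EFin \o f) ->
    leb2.-integrable setT (EFin \o (fun x => k * f x)).
  by move=> i1; have := integrableZl measurableT k i1.
have iB : leb2.-integrable setT (EFin \o B).
  by apply: (iD); apply: iZ; apply: iD; exact: integrable_sq.
apply: (@le_trans _ _ (\int[leb2]_x B x)).
  apply: le_Rintegral => //.
    apply: integrable_norm.
    by have := integrableB measurableT (integrable_mulL2 Lu Lv) (integrable_mulL2 (Lu_ n) (Lv_ n)).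
  move=> x _; rewrite /B /= distrC.
  set a := u_ n x - u x; set b := v_ n x - v x.
  have -> : u_ n x * v_ n x - u x * v x = a * b + a * v x + b * u x.
    by rewrite /a /b; ring.
  apply: le_trans (ler_normD _ _) _; apply: le_trans (lerD (ler_normD _ _) (lexx _)) _.
  have := young a b ltr01; have := young a (v x) d0; have := young b (u x) d0.
  rewrite invr1 /c; lra.
rewrite /B RintegralD //; [|by apply: iZ; apply: iD; exact: integrable_sq..].
rewrite !RintegralZl //; [|by apply: iD; exact: integrable_sq..].
rewrite !RintegralD //; [|exact: integrable_sq..].
have R1 w : L2T w -> \int[leb2]_x (w x ^+ 2) = fine (sqn w) by [].
rewrite !R1 //.
move: un vn; rewrite -(fineK (L2T_int LUn)) -(fineK (L2T_int LVn)) !lee_fin.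
set a := fine _; set b := fine _ => am bm.
have -> : e = c * (m + m) + d * A by rewrite /m /d; field; rewrite !gt_eqF.
apply: lerD.
  by rewrite ler_pM2l // lerD.
by rewrite ler_pM2l // /A lerDl.
Unshelve. all: by end_near.
Qed.
(** Sequences make dominated convergence applicable; shifts in the positive direction suit boxes
    that are open on the left and closed on the right. *)
Definition translation_cvg i u := forall s_ : nat -> R, (forall n, 0 < s_ n) ->
  s_ n @[n --> \oo] --> (0 : R) -> cvgL2 (fun n => u \o shift2 i (s_ n)) u.

Lemma translation_cvgZ i (c : R) u : L2T u -> translation_cvg i u ->
  translation_cvg i (fun x => c * u x).
Proof.
move=> Lu tu s_ s0 cs; have [mu _] := Lu; apply/cvgL2P => e e0.
have k0 : 0 < c ^+ 2 + 1 by rewrite ltr_wpDl // sqr_ge0.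
have := (cvgL2P _ _).1 (tu s_ s0 cs) (e / (c ^+ 2 + 1)) (divr_gt0 e0 k0).
apply: filterS => n hn.
have -> : ((fun x => c * u x) \o shift2 i (s_ n)) \- (fun x => c * u x) =
    (fun x => c * ((u \o shift2 i (s_ n)) \- u) x).
  by apply/funext => x /=; rewrite mulrBr.
have LD := L2TB (L2T_shift i (s_ n) Lu) Lu.
rewrite sqnZ; last by case: LD.
move: hn; rewrite -(fineK (L2T_int LD)) lee_fin -EFinM lee_fin ler_pdivlMr //.
by have := fine_ge0 (sqn_ge0 ((u \o shift2 i (s_ n)) \- u)); set a := fine _; nra.
Qed.

Lemma translation_cvgD i u v : L2T u -> L2T v -> translation_cvg i u -> translation_cvg i v ->
  translation_cvg i (u \+ v).
Proof.
move=> Lu Lv tu tv s_ s0 cs; apply/cvgL2P => e e0.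
have e4 : 0 < e / 4 by rewrite divr_gt0.
have := (cvgL2P _ _).1 (tv s_ s0 cs) (e / 4) e4.
have := (cvgL2P _ _).1 (tu s_ s0 cs) (e / 4) e4.
apply: filterS2 => n hu hv.
have -> : ((u \+ v) \o shift2 i (s_ n)) \- (u \+ v) =
   ((u \o shift2 i (s_ n)) \- u) \+ ((v \o shift2 i (s_ n)) \- v).
  by apply/funext => x /=; ring.
have [LU _] := L2TB (L2T_shift i (s_ n) Lu) Lu.
have [LV _] := L2TB (L2T_shift i (s_ n) Lv) Lv.
apply: le_trans (sqnD LU LV) _.
have -> : e = 2 * (e / 4) + 2 * (e / 4) by field.
by rewrite [leRHS]EFinD !EFinM leeD // lee_pmul2l.
Qed.

(** The translate of [u_ k \- u] is as small as [u_ k \- u] itself, so the property is closed under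
    L^2 limits. Two uses of [sqnD] give the weights 4 + 4 + 2, hence [e / 10]. *)
Lemma translation_cvg_lim i (u_ : nat -> T -> R) u : (forall k, L2T (u_ k)) -> L2T u ->
  (forall k, translation_cvg i (u_ k)) -> cvgL2 u_ u -> translation_cvg i u.
Proof.
move=> Lu_ Lu tu_ cu s_ s0 cs; apply/cvgL2P => e e0.
have e10 : 0 < e / 10 by rewrite divr_gt0.
have [k _ /(_ k (leqnn k)) /= hk] := (cvgL2P _ _).1 cu (e / 10) e10.
have := (cvgL2P _ _).1 (tu_ k s_ s0 cs) (e / 10) e10.
apply: filterS => n hn.
have -> : (u \o shift2 i (s_ n)) \- u =
   (((u_ k \o shift2 i (s_ n)) \- u_ k) \+ (u_ k \- u)) \+
     (fun x => (-1) * ((u_ k \- u) \o shift2 i (s_ n)) x).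
  by apply/funext => x /=; ring.
have LD := L2TB (Lu_ k) Lu; have LS := L2TB (L2T_shift i (s_ n) (Lu_ k)) (Lu_ k).
have [m1 _] := LS; have [m2 _] := LD; have LE := L2T_shift i (s_ n) LD; have [m3 _] := LE.
apply: le_trans (sqnD (measurable_funD m1 m2) (L2TZ (-1) LE).1) _.
rewrite sqnZ // sqrrN expr1n mul1e sqn_shift //.
have -> : e = 2 * (2 * (e / 10) + 2 * (e / 10)) + 2 * (e / 10) by field.
rewrite [leRHS]EFinD EFinM [X in (_ <= _ + X)%E]EFinM; apply: leeD.
  rewrite lee_pmul2l //; apply: le_trans (sqnD m1 m2) _.
  by rewrite [leRHS]EFinD !EFinM leeD // lee_pmul2l.
by rewrite lee_pmul2l.
Qed.

Definition ind (A : set T) : T -> R := \1_A.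

Lemma L2T_ind (A : set T) : measurable A -> (leb2 A < +oo)%E -> L2T (ind A).
Proof.
move=> mA fA; split; first exact: measurable_indic.
rewrite /sqn (eq_integral (fun x => (\1_A x)%:E)); last first.
  by move=> x _; rewrite /ind indicE; case: (x \in A); rewrite ?expr1n ?expr0n.
by rewrite integral_indic // setIT.
Qed.

Lemma ind_le (A B : set T) x : A `<=` B -> `|ind A x| <= `|ind B x|.
Proof.
move=> AB; rewrite /ind !indicE; have [xA|xA] := boolP (x \in A).
  by rewrite (_ : x \in B) // inE; apply: AB; rewrite inE in xA.
by rewrite normr0 normr_ge0.
Qed.

(** For small positive [s], [a < t - s <= b] and [a < t <= b] agree at every [t], endpoints
    included, so the indicators converge at every point. The box enlarged by a bound [S] of all the
    shifts dominates them. *)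
Lemma translation_cvg_box i p q : translation_cvg i (ind (box p q)).
Proof.
move=> s_ s0 cs.
have [S sS] : exists S : R, forall n, s_ n <= S.
  have /cvg_seq_bounded [M [_ bM]] : cvgn s_ by apply/cvg_ex; exists 0.
  exists (`|M| + 1) => n; apply: le_trans (ler_norm _) _.
  by apply: bM => //; rewrite ltr_pwDr // ler_norm.
pose q' := (q.1 + S, q.2 + S).
have S0 : 0 < S by apply: lt_le_trans (s0 0) (sS 0).
have fq : (leb2 (box p q') < +oo)%E by exact: leb2_box.
have [] // := @cvgL2_dominated (fun n => ind (box p q) \o shift2 i (s_ n))
  (ind (box p q)) (ind (box p q')).
- by move=> n; apply: measurable_comp_shift2; apply: measurable_indic; exact: measurable_box.
- move=> x; apply: cvg_near_cst.
  suff : \forall n \near \oo, (box p q (shift2 i (s_ n) x) <-> box p q x).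
    apply: filterS => n h; rewrite /ind /= !indicE; congr (_%:R).
    congr nat_of_bool; exact: (asbool_equiv_eq h).
  have sm (d : R) : 0 < d -> \forall n \near \oo, s_ n < d.
    by move=> d0; exact: (cvgr_lt _ cs).
  have key (a b t : R) : \forall n \near \oo, (a < t - s_ n <= b) = (a < t <= b).
    pose d := if a < t then t - a else 1; pose d' := if t <= b then 1 else t - b.
    have d0 : 0 < d by rewrite /d; case: ifP => // h; rewrite subr_gt0.
    have d0' : 0 < d' by rewrite /d'; case: (leP t b) => // h; rewrite subr_gt0.
    apply: filterS2 (sm d d0) (sm d' d0') => n; rewrite /d /d'; have := s0 n.
    case: (ltP a t) => h1; case: (leP t b) => h2 h3 h4 h5 /=.
    - by apply/andP; split; lra.
    - by apply/negbTE/negP => /andP[? ?]; lra.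
    - by apply/negbTE/negP => /andP[? ?]; lra.
    - by apply/negbTE/negP => /andP[? ?]; lra.
  have keyP (a b t t' : R) : (a < t <= b) = (a < t' <= b) ->
      (a < t /\ t <= b <-> a < t' /\ t' <= b).
    by move=> h; split=> /andP; [rewrite h|rewrite -h] => /andP.
  rewrite /shift2; case: (i == ord0).
    apply: filterS (key p.1 q.1 x.1) => n /keyP [h1 h2].
    by split=> /boxE /= [? ? ? ?]; apply/boxE => /=; split=> //; tauto.
  apply: filterS (key p.2 q.2 x.2) => n /keyP [h1 h2].
  by split=> /boxE /= [? ? ? ?]; apply/boxE => /=; split=> //; tauto.
- by apply: L2T_ind => //; exact: measurable_box.
- move=> n x; rewrite -[X in _ <= X]ger0_norm; last by rewrite /ind indicE.
  rewrite /ind /= !indicE; case: (boolP (_ \in box p q)); last by rewrite normr0.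
  rewrite inE => /boxE h; suff -> : x \in box p q' by [].
  rewrite inE; apply/boxE; have := s0 n; have := sS n; move: h; rewrite /shift2 /q'.
  by case: (i == ord0) => /= -[? ? ? ?] ? ?; split=> //=; lra.
Qed.

Lemma indCI (S B : set T) : ind (~` S `&` B) = ind B \+ (fun x => (-1) * ind (S `&` B) x).
Proof.
apply/funext => x; rewrite /ind /= !indicE !in_setI in_setC.
by case: (x \in S); case: (x \in B); rewrite /= ?mulr0 ?addr0 // mulr1 subrr.
Qed.

Lemma indUI (S U B : set T) : S `&` U = set0 ->
  ind ((S `|` U) `&` B) = ind (S `&` B) \+ ind (U `&` B).
Proof.
move=> SU; apply/funext => x; rewrite /ind /= !indicE !in_setI in_setU.
have : x \notin S `&` U by rewrite SU in_set0.
rewrite in_setI; case: (x \in S); case: (x \in U) => //= _;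
  by case: (x \in B); rewrite ?addr0 ?add0r.
Qed.

(** Dynkin induction from boxes: complements are differences, and a countable disjoint union is the
    L^2 limit of its finite parts. The intersection with [bigbox k] keeps all measures finite. *)
Lemma translation_cvg_set i k (E : set T) : measurable E -> translation_cvg i (ind (E `&` bigbox k)).
Proof.
have mB : measurable (bigbox k : set T) by exact: measurable_box.
have fB (A : set T) : measurable A -> (leb2 (A `&` bigbox k) < +oo)%E.
  move=> mA; apply: le_lt_trans (leb2_box (- k%:R, - k%:R) (k%:R, k%:R)).
  by apply: le_measure; rewrite ?inE //; exact: measurableI.
have LB (A : set T) : measurable A -> L2T (ind (A `&` bigbox k)).
  by move=> mA; apply: L2T_ind; [exact: measurableI|exact: fB].
rewrite measurable_boxes.
apply: (dynkin_induction (P := fun E : set T => translation_cvg i (ind (E `&` bigbox k)))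
  measurable_boxes setI_closed_boxes).
- by rewrite setTI; exact: translation_cvg_box.
- by move=> _ [[p q] _ <-] /=; rewrite /bigbox boxI; exact: translation_cvg_box.
- move=> S mS tS; have LS := LB _ mS.
  rewrite indCI.
  apply: translation_cvgD; [by rewrite -(setTI (bigbox k)); exact: LB|exact: L2TZ| |].
    exact: translation_cvg_box.
  exact: translation_cvgZ.
- move=> F mF tF tcF.
  pose u_ n := ind (\big[setU/set0]_(j < n) F j `&` bigbox k).
  have mU n : measurable (\big[setU/set0]_(j < n) F j) by exact: bigsetU_measurable.
  have mUF : measurable (\bigcup_k F k) by exact: bigcupT_measurable.
  have LT : L2T (ind (bigbox k)) by rewrite -(setTI (bigbox k)); exact: LB.
  have [] := @cvgL2_dominated u_ (ind (\bigcup_k F k `&` bigbox k)) (ind (bigbox k)).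
  + by move=> n; have [] := LB _ (mU n).
  + move=> x; apply: cvg_near_cst.
    have [[m _ Fm]|nF] := pselect ((\bigcup_k F k) x).
      near=> n; rewrite /u_ /ind !indicE !in_setI; congr ((_ && _)%:R).
      have mn : (m < n)%N by near: n; exists m.+1.
      have -> : x \in \bigcup_k F k by rewrite inE; exists m.
      by apply: mem_set; rewrite -bigcup_mkord; exists m.
    apply: nearW => n; rewrite /u_ /ind !indicE !in_setI; congr ((_ && _)%:R).
    rewrite [RHS]memNset //; apply: memNset => h; apply: nF.
    by rewrite -bigcup_mkord in h; have [m _ Fm] := h; exists m.
  + exact: LT.
  + move=> n x; rewrite -[X in _ <= X]ger0_norm; last by rewrite /ind indicE.
    by apply: ind_le => y [].
  move=> _ cu; apply: (translation_cvg_lim _ _ _ cu); [by move=> n; exact: LB|exact: LB|].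
  elim=> [|n ih].
    rewrite /u_ big_ord0 set0I; have -> : ind set0 = (fun x => 0 * ind (bigbox k) x).
      by apply/funext => x; rewrite /ind indic0 mul0r.
    by apply: translation_cvgZ => //; exact: translation_cvg_box.
  have -> : u_ n.+1 = u_ n \+ ind (F n `&` bigbox k).
    rewrite /u_ big_ord_recr /= indUI // -bigcup_mkord.
    apply/seteqP; split=> // x [[m /= mn Fm] Fn].
    by have := tF m n I I; move=> h; move: mn; rewrite h ?ltnn //; exists x.
  by apply: translation_cvgD => //; exact: LB.
Unshelve. all: by end_near.
Qed.

Lemma indI (A B : set T) x : ind (A `&` B) x = ind A x * ind B x.
Proof. by rewrite /ind !indicE in_setI -natrM mulnb. Qed.

Lemma translation_cvg_sum (I : Type) i (s : seq I) (F : I -> T -> R) :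
  (forall j, L2T (F j) /\ translation_cvg i (F j)) ->
  L2T (fun x => \sum_(j <- s) F j x) /\ translation_cvg i (fun x => \sum_(j <- s) F j x).
Proof.
move=> h; elim: s => [|a s [ihL ihT]].
  have -> : (fun x => \sum_(j <- [::]) F j x) = (fun x => 0 * ind (bigbox 0) x).
    by apply/funext => x; rewrite big_nil mul0r.
  have L0 : L2T (ind (bigbox 0)).
    by apply: L2T_ind; [exact: measurable_box|exact: leb2_box].
  by split; [exact: L2TZ|apply: translation_cvgZ => //; exact: translation_cvg_box].
have -> : (fun x => \sum_(j <- a :: s) F j x) = F a \+ (fun x => \sum_(j <- s) F j x).
  by apply/funext => x; rewrite big_cons.
by have [La ta] := h a; split; [exact: L2TD|exact: translation_cvgD].
Qed.

Import HBNNSimple.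

Lemma translation_cvg_ge0 i u : L2T u -> (forall x, 0 <= u x) -> translation_cvg i u.
Proof.
move=> Lu u0; have [mu _] := Lu.
have mf : measurable_fun setT (EFin \o u) by exact/measurable_EFinP.
pose g := nnsfun_approx measurableT mf.
have u0' x : setT x -> (0 <= (EFin \o u) x)%E by move=> _; rewrite lee_fin.
have gc x : g n x @[n --> \oo] --> u x.
  have := @cvg_nnsfun_approx _ T R setT measurableT _ mf u0' x I.
  by move/fine_cvg.
have gu n x : g n x <= u x.
  rewrite -(cvg_lim (@Rhausdorff R) (gc x)).
  apply: (@nondecreasing_cvgn_le _ (fun n => g n x)).
    by move=> a b ab; have /lefP := @nd_nnsfun_approx _ T R setT measurableT _ mf a b ab; exact.
  by apply/cvg_ex; exists (u x).
have g0 n x : 0 <= g n x by [].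
(* The truncation gives every level set finite measure, that of the value 0 included, so that
   [translation_cvg_set] applies to each term of the simple function. *)
pose u_ n x := g n x * ind (bigbox n) x.
have LB n (A : set T) : measurable A -> L2T (ind (A `&` bigbox n)).
  move=> mA; have mAB : measurable (A `&` bigbox n).
    by apply: measurableI => //; exact: measurable_box.
  apply: L2T_ind => //; apply: le_lt_trans (leb2_box (- n%:R, - n%:R) (n%:R, n%:R)).
  by apply: le_measure; rewrite ?inE //; exact: measurable_box.
have Lt n : L2T (u_ n) /\ translation_cvg i (u_ n).
  have -> : u_ n = (fun x => \sum_(y <- finmap.enum_fset (fset_set (range (g n))))
      y * ind (g n @^-1` [set y] `&` bigbox n) x).
    apply/funext => x; rewrite /u_ fimfunE fsbig_finite //= mulr_suml.
    by apply: eq_bigr => y _; rewrite -mulrA; congr (_ * _); exact/esym/indI.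
  apply: translation_cvg_sum => y; have mg : measurable (g n @^-1` [set y]) by exact: measurable_sfunP.
  by have L := LB n _ mg; split; [exact: L2TZ|apply: translation_cvgZ => //; exact: translation_cvg_set].
have ib n x : 0 <= ind (bigbox n) x <= 1.
  by rewrite /ind indicE; case: (_ \in _); rewrite ?lexx ?ler01.
have [] := @cvgL2_dominated u_ u u.
- by move=> n; have [[]] := Lt n.
- move=> x; rewrite -[X in _ --> X]mulr1; apply: cvgM; first exact: gc.
  apply: cvg_near_cst; have : [set: T] x by [].
  rewrite -bigcup_bigbox => -[m _ /boxE /= [x1 x2 x3 x4]].
  near=> n; have mn : (m <= n)%N by near: n; exists m.
  rewrite /ind indicE mem_set //; apply/boxE => /=.
  have : m%:R <= n%:R :> R by rewrite ler_nat.
  by move: x1 x2 x3 x4; set a := m%:R; set b := n%:R => ? ? ? ? ?; split; lra.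
- exact: Lu.
- move=> n x; have /andP[i0 i1] := ib n x; rewrite /u_ ger0_norm ?mulr_ge0 //.
  by apply: le_trans (gu n x); rewrite ler_piMr.
move=> _ cu; apply: (translation_cvg_lim _ Lu _ cu) => n; by have [] := Lt n.
Unshelve. all: by end_near.
Qed.

Theorem L2_translation_cvg i u : L2T u -> translation_cvg i u.
Proof.
move=> Lu; have [mu _] := Lu.
have Lp : L2T (u^\+)%R.
  apply: (L2T_le _ Lu); first exact: measurable_funrpos.
  by move=> x; rewrite /funrpos; case: (leP (u x) 0) => h; rewrite ?normr0.
have Ln : L2T (u^\-)%R.
  apply: (L2T_le _ Lu); first exact: measurable_funrneg.
  by move=> x; rewrite /funrneg; case: (leP (- u x) 0) => h; rewrite ?normr0 ?normrN.
have -> : u = (u^\+)%R \+ (fun x => (-1) * (u^\-)%R x).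
  apply/funext => x /=; rewrite mulN1r; rewrite /funrpos /funrneg.
  by case: (leP (u x) 0) => h1; case: (leP (- u x) 0) => h2; lra.
apply: translation_cvgD => //; first exact: L2TZ.
  by apply: translation_cvg_ge0 => // x; rewrite /funrpos le_max lexx orbT.
by apply: translation_cvgZ => //; apply: translation_cvg_ge0 => // x; rewrite /funrneg le_max lexx orbT.
Qed.

Local Notation mu := (@lebesgue_measure R).

Lemma measurable_shift_pair i u : measurable_fun setT u ->
  measurable_fun setT (fun z : T * T1 => u (shift2 i z.2 z.1)).
Proof.
move=> mu_; apply: (measurableT_comp mu_).
have m1 : measurable_fun setT (fun z : T * T1 => z.1.1 : T1).
  by apply: measurableT_comp => //; exact: measurable_fst.
have m2 : measurable_fun setT (fun z : T * T1 => z.1.2 : T1).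
  by apply: measurableT_comp => //; exact: measurable_snd.
have m3 : measurable_fun setT (fun z : T * T1 => z.2 : T1) by exact: measurable_snd.
rewrite /shift2; case: (i == ord0); apply/measurable_fun_pairP; split => //=.
- exact: (@measurable_funB _ _ R).
- exact: (@measurable_funB _ _ R).
Qed.

Lemma sigma_finite_leb2 : sigma_finite [set: T] (@leb2 R).
Proof.
exists bigbox; first by rewrite bigcup_bigbox.
by move=> n; split; [exact: measurable_box|exact: leb2_box].
Qed.

(** [leb2] together with the sigma-finiteness that the theorems of Tonelli and Fubini require. *)
Definition leb2s : {sigma_finite_measure set T -> \bar R} :=
  HB.pack (@leb2 R : set T -> \bar R) (Measure.class (@leb2 R))
    (Measure_isSigmaFinite.Build _ _ _ (@leb2 R) sigma_finite_leb2).

Lemma tonelli_leb2 (I : set T1) (F : T * T1 -> \bar R) : measurable I ->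
  measurable_fun setT F -> (forall z, 0 <= F z)%E ->
  (\int[leb2]_x \int[mu]_(s in I) F (x, s) =
   \int[mu]_(s in I) \int[leb2]_x F (x, s))%E.
Proof.
move=> mI mF F0.
pose G z := (F z * (\1_I z.2)%:E)%E.
have mG : measurable_fun setT G.
  apply: emeasurable_funM => //; apply/measurable_EFinP.
  by apply: measurableT_comp (measurable_snd); exact: measurable_indic.
have G0 z : (0 <= G z)%E by rewrite /G mule_ge0 // lee_fin indicE.
have := @fubini_tonelli _ _ T T1 R leb2s mu G mG G0.
rewrite (_ : (\int[leb2s]_x \int[mu]_y G (x, y))%E =
  (\int[leb2]_x \int[mu]_(s in I) F (x, s))%E); last first.
  apply: eq_integral => x _; rewrite [RHS]integral_mkcond; apply: eq_integral => s _.
  by rewrite /G /= patchE indicE; case: ifP; rewrite ?mule1 ?mule0.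
move=> ->; rewrite [RHS]integral_mkcond; apply: eq_integral => s _.
rewrite patchE /G /= indicE; case: ifP => _.
  by apply: eq_integral => x _; rewrite mule1.
by rewrite integral0_eq // => x _; rewrite mule0.
Qed.

Definition seg (h : R) : set T1 := `[0, h].

Lemma measurable_seg h : measurable (seg h).
Proof. exact: measurable_itvT1. Qed.

(** When [u] is the weak derivative of a function in direction [i], this average is the backward
    difference quotient of that function ([weak_diff]). *)
Definition avg i (h : R) u (x : T) : R :=
  h^-1 * \int[mu]_(s in seg h) u (shift2 i s x).

Lemma mu_cc (h : R) : 0 <= h -> mu (seg h) = h%:E.
Proof.
move=> h0; rewrite lebesgue_measure_itv /= lte_fin.
case: ltP => h1; first by rewrite sube0.
by congr (_%:E); apply/eqP; rewrite eq_le h0 h1.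
Qed.

Lemma measurable_integral_seg (h : R) (G : T * T1 -> \bar R) :
  measurable_fun setT G -> (forall z, 0 <= G z)%E ->
  measurable_fun setT (fun x => \int[mu]_(s in seg h) G (x, s))%E.
Proof.
move=> mG G0; pose H z := (G z * (\1_(seg h) z.2)%:E)%E.
have mI := measurable_seg h.
have mH : measurable_fun setT H.
  apply: emeasurable_funM => //; apply/measurable_EFinP.
  by apply: measurableT_comp (measurable_snd); exact: measurable_indic.
have H0 z : (0 <= H z)%E by rewrite /H mule_ge0 // lee_fin indicE.
have := @measurable_fun_fubini_tonelli_F _ _ T T1 R mu H mH H0.
congr measurable_fun; apply/funext => x; rewrite [RHS]integral_mkcond.
apply: eq_integral => s _; rewrite /H /= patchE indicE.
by case: ifP; rewrite ?mule1 ?mule0.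
Qed.

(** The positive and negative parts are treated separately by Tonelli, since at this stage the inner
    integral need not be finite. *)
Lemma measurable_avg i (h : R) u : measurable_fun setT u ->
  measurable_fun setT (avg i h u).
Proof.
move=> mu_; apply: measurable_funM => //.
have mI := measurable_seg h.
have mp := measurable_shift_pair i mu_.
apply: measurableT_comp; first exact: fine_measurable.
under eq_fun do rewrite integralE.
apply: emeasurable_funB.
- pose G (z : T * T1) : \bar R := ((EFin \o (fun z : T * T1 => u (shift2 i z.2 z.1)))^\+ z)%E.
  have : measurable_fun setT G by apply: measurable_funepos; exact/measurable_EFinP.
  move=> mG; have G0 z : (0 <= G z)%E by exact: funepos_ge0.
  have := measurable_integral_seg h mG G0; congr measurable_fun.
  by apply/funext => x; apply: eq_integral => s _; rewrite /G !funeposE.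
- pose G (z : T * T1) : \bar R := ((EFin \o (fun z : T * T1 => u (shift2 i z.2 z.1)))^\- z)%E.
  have : measurable_fun setT G by apply: measurable_funeneg; exact/measurable_EFinP.
  move=> mG; have G0 z : (0 <= G z)%E by exact: funeneg_ge0.
  have := measurable_integral_seg h mG G0; congr measurable_fun.
  by apply/funext => x; apply: eq_integral => s _; rewrite /G !funenegE.
Qed.

Lemma integrable_cst_seg (h c : R) : 0 <= h -> mu.-integrable (seg h) (EFin \o cst c).
Proof.
move=> h0; have mI := measurable_seg h; apply/integrableP; split.
  by apply/measurable_EFinP; exact: measurable_cst.
have := integral_cst mu mI `|c%:E|%E => ->.
by rewrite [X in (_ * X)%E](mu_cc h0) -EFinM ltry.
Qed.

Lemma jensen_seg (h : R) (a : T1 -> R) : 0 < h -> measurable_fun setT a ->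
  mu.-integrable (seg h) (EFin \o (fun s => a s ^+ 2)) ->
  mu.-integrable (seg h) (EFin \o a) /\
  (h^-1 * \int[mu]_(s in seg h) a s) ^+ 2 <= h^-1 * \int[mu]_(s in seg h) (a s ^+ 2).
Proof.
move=> h0 ma i2; have mI := measurable_seg h; have h0' := ltW h0.
have ia : mu.-integrable (seg h) (EFin \o a).
  apply: (@integrable_dominated _ T1 R mu _ mI _ (fun s => 1 + a s ^+ 2)).
  - exact: measurable_funTS.
  - by move=> s _; rewrite ler_norml; have := sqr_ge0 (a s - 1); have := sqr_ge0 (a s + 1); nra.
  - by have := integrableD mI (integrable_cst_seg 1 h0') i2.
split => //; set A := \int[mu]_(s in _) a s; set B := \int[mu]_(s in _) (a s ^+ 2).
have iZ : mu.-integrable (seg h) (EFin \o (fun s => (- 2 * (h^-1 * A)) * a s)).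
  exact: (integrableZl mI _ ia).
(* Jensen's inequality for the square, as nonnegativity of the variance around the mean
   [h^-1 * A]. *)
have : 0 <= \int[mu]_(s in seg h) (a s - h^-1 * A) ^+ 2.
  by apply: Rintegral_ge0 => s _; exact: sqr_ge0.
have -> : \int[mu]_(s in seg h) (a s - h^-1 * A) ^+ 2 =
  \int[mu]_(s in seg h) (a s ^+ 2 + ((- 2 * (h^-1 * A)) * a s + (h^-1 * A) ^+ 2)).
  by apply: eq_Rintegral => s _; ring.
rewrite RintegralD //; last first.
  by have := integrableD mI iZ (integrable_cst_seg ((h^-1 * A) ^+ 2) h0').
rewrite RintegralD //; last exact: integrable_cst_seg.
rewrite RintegralZl // Rintegral_cst // [X in fine X](mu_cc h0') /= -/A -/B => H.
have -> : h^-1 * B = (h^-1 * A) ^+ 2 + h^-1 * (B + (- 2 * (h^-1 * A) * A + (h^-1 * A) ^+ 2 * h)).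
  by field; exact: lt0r_neq0.
by rewrite lerDl mulr_ge0 // invr_ge0 ltW.
Qed.

(** [avg i h u \- u] is the average of the differences between translates and [u]: Jensen's
    inequality in [s] at each point, then Tonelli to integrate in [x] first. *)
Lemma sqn_avg_le i (h e : R) u : 0 < h -> measurable_fun setT u ->
  (forall s, 0 <= s <= h -> (sqn ((u \o shift2 i s) \- u) <= e%:E)%E) ->
  (sqn (avg i h u \- u) <= e%:E)%E.
Proof.
move=> h0 mu_ H; have mI := measurable_seg h.
pose a x s := u (shift2 i s x) - u x.
pose F (z : T * T1) := ((a z.1 z.2) ^+ 2)%:E.
have ma2 : measurable_fun setT (fun z : T * T1 => a z.1 z.2).
  apply: measurable_funB; first exact: measurable_shift_pair.
  by apply: measurableT_comp => //; exact: measurable_fst.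
have mF : measurable_fun setT F by apply/measurable_EFinP; exact: measurable_funX.
have F0 z : (0 <= F z)%E by rewrite /F lee_fin sqr_ge0.
have max x : measurable_fun setT (a x : T1 -> R).
  apply: measurable_funB => //.
  have mpx : measurable_fun setT (fun s : T1 => (x, s) : T * T1).
    by apply: measurable_fun_pair.
  exact: (measurableT_comp (measurable_shift_pair i mu_) mpx).
have pw x : ((((avg i h u \- u) x) ^+ 2)%:E <=
    h^-1%:E * \int[mu]_(s in seg h) F (x, s))%E.
  (* Where the inner integral is infinite the bound is trivial; elsewhere [a x] is square-integrable
     on the segment and [jensen_seg] applies. *)
  have [foo|] := boolP (\int[mu]_(s in seg h) F (x, s) == +oo)%E.
    by rewrite (eqP foo) gt0_muley ?leey // lte_fin invr_gt0.
  rewrite -ltey => Ffin.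
  have i2 : mu.-integrable (seg h) (EFin \o (fun s => a x s ^+ 2)).
    apply/integrableP; split.
      by apply: measurable_funTS; apply/measurable_EFinP; exact: measurable_funX.
    by under eq_integral do rewrite /= ger0_norm ?sqr_ge0 //.
  have [ia J] := jensen_seg h0 (max x) i2.
  have -> : (avg i h u \- u) x = h^-1 * \int[mu]_(s in seg h) a x s.
    rewrite /a RintegralB //.
    - rewrite Rintegral_cst // [X in fine X](mu_cc (ltW h0)) /= mulrBr; congr (_ - _).
      by rewrite mulrCA mulVf ?mulr1 // gt_eqF.
    - have := integrableD mI ia (integrable_cst_seg (u x) (ltW h0)).
      by apply: eq_integrable => // s _ /=; rewrite -EFinD /a subrK.
    - exact: integrable_cst_seg (ltW h0).
  apply: le_trans (_ : _ <= (h^-1 * \int[mu]_(s in seg h) (a x s ^+ 2))%:E)%E _.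
    by rewrite lee_fin.
  rewrite EFinM /Rintegral fineK //.
  by apply: integrable_fin_num.
apply: (@le_trans _ _ (\int[leb2]_x (h^-1%:E * \int[mu]_(s in seg h) F (x, s)))%E).
  apply: ge0_le_integral => //.
  - by move=> x _; rewrite lee_fin sqr_ge0.
  - by apply: measurable_sq; apply: measurable_funB => //; exact: measurable_avg.
  - by apply: measurable_funeM; exact: measurable_integral_seg.
have hV : (0 <= h^-1%:E :> \bar R)%E by rewrite lee_fin invr_ge0 ltW.
rewrite ge0_integralZl //; [|exact: measurable_integral_seg|by move=> x _; exact: integral_ge0].
rewrite tonelli_leb2 //.
apply: (@le_trans _ _ (h^-1%:E * \int[mu]_(s in seg h) (cst e%:E s))%E).
  apply: lee_wpmul2l => //; apply: ge0_le_integral => //.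
  - by move=> s _; exact: integral_ge0.
  - by apply: measurable_funTS; exact: (@measurable_fun_fubini_tonelli_G _ _ T T1 R leb2s F mF F0).
rewrite integral_cst // [X in (_ * (_ * X))%E](mu_cc (ltW h0)) -!EFinM lee_fin.
by rewrite mulrCA mulVf ?mulr1 // gt_eqF.
Qed.

End L2Plane.
Arguments sqn {R} u%_R.

(** * Difference quotients as averages of the weak derivative *)

Section DifferenceQuotients.
Context {R : realType}.
Local Notation T1 := (measurableTypeR R).
Local Notation T := (T1 * T1)%type.
Local Notation mu := (@lebesgue_measure R).
Implicit Types (u v : T -> R) (i j : 'I_2) (w V K : set (R * R)).

Lemma shift2_0 i (x : T) : shift2 i 0 x = x.
Proof. by rewrite /shift2; case: x => a b; case: (i == ord0); rewrite /= subr0. Qed.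

Lemma shift2_add i s t (x : T) : shift2 i s (shift2 i t x) = shift2 i (s + t) x.
Proof.
rewrite /shift2; case: (i == ord0) => /=; congr pair;
  by rewrite opprD addrA addrAC.
Qed.

(** Failure for every [d] would produce positive shifts tending to 0 that contradict
    [L2_translation_cvg]. The shift 0 is excluded by hand, as it changes nothing. *)
Lemma L2_translation_modulus i u (e : R) : L2T u -> 0 < e ->
  exists2 d : R, 0 < d & forall s, 0 <= s <= d ->
    (sqn ((u \o shift2 i s) \- u) <= e%:E)%E.
Proof.
move=> Lu e0; apply: contrapT => H.
have {}H (n : nat) : exists s : R, 0 < s <= n.+1%:R^-1 /\
    (e%:E < sqn ((u \o shift2 i s) \- u))%E.
  apply: contrapT => Hn; apply: H; exists n.+1%:R^-1; first by rewrite invr_gt0.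
  move=> s /andP[s0 sn]; rewrite leNgt; apply/negP => es; apply: Hn; exists s.
  split=> //; rewrite sn andbT lt_neqAle s0 andbT eq_sym; apply/eqP => s00.
  move: es; rewrite s00; have -> : (u \o shift2 i 0) \- u = fun=> 0.
    by apply/funext => x /=; rewrite shift2_0 subrr.
  rewrite /sqn integral0_eq; last by move=> x _; rewrite expr0n.
  by rewrite lte_fin ltNge (ltW e0).
have [s_ sP] := choice H.
have s0 n : 0 < s_ n by have [/andP[]] := sP n.
have cs : s_ n @[n --> \oo] --> (0 : R).
  apply: (@squeeze_cvgr _ _ _ _ (cst 0) (fun n => n.+1%:R^-1)).
  - by apply: nearW => n; have [/andP[/ltW -> ->]] := sP n.
  - exact: cvg_cst.
  - exact: cvg_harmonic.
have [n _ /(_ n (leqnn n)) /=] := (cvgL2P _ _).1 (L2_translation_cvg i Lu s0 cs) e e0.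
by rewrite leNgt (sP n).2.
Qed.

Lemma avg_cvg i u (h_ : nat -> R) : L2T u -> (forall n, 0 < h_ n) ->
  h_ n @[n --> \oo] --> (0 : R) -> cvgL2 (fun n => avg i (h_ n) u) u.
Proof.
move=> Lu h0 ch; apply/cvgL2P => e e0; have [mu_ _] := Lu.
have [d d0 H] := L2_translation_modulus i Lu e0.
have : \forall n \near \oo, h_ n < d by exact: (cvgr_lt _ ch).
apply: filterS => n hd; apply: sqn_avg_le => // s /andP[s0 sh]; apply: H.
by rewrite s0 (le_trans sh) // ltW.
Qed.

Lemma L2T_avg i u (h : R) : L2T u -> 0 < h -> L2T (avg i h u).
Proof.
move=> Lu h0; have [mu_ fu] := Lu; have ma := measurable_avg i h mu_.
have LD : L2T (avg i h u \- u).
  split; first exact: measurable_funB.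
  (* By [sqnD] and translation invariance each difference of a translate and [u] has squared norm at
     most 2 + 2 times that of [u]. *)
  apply: (@le_lt_trans _ _ (4 * fine (sqn u))%:E); last exact: ltry.
  apply: sqn_avg_le => // s _.
  have -> : (u \o shift2 i s) \- u = (u \o shift2 i s) \+ (fun x => (-1) * u x).
    by apply/funext => x /=; rewrite mulN1r.
  apply: le_trans (sqnD (measurable_comp_shift2 i s mu_) (L2TZ (-1) Lu).1) _.
  rewrite sqnZ // sqrrN expr1n mul1e sqn_shift // -(fineK (L2T_int Lu)).
  by rewrite -!EFinM -EFinD lee_fin; lra.
have := L2TD LD Lu; congr L2T; apply/funext => x /=; exact: subrK.
Qed.

Lemma L2T_integrable u (A : set T) : L2T u -> measurable A -> (leb2 A < +oo)%E ->
  leb2.-integrable A (EFin \o u).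
Proof.
move=> Lu mA fA; have [mu_ _] := Lu.
have /(integrableS measurableT mA (@subsetT _ A)) := integrable_mulL2 Lu (L2T_ind mA fA).
apply: eq_integrable => // x xA /=; by rewrite /ind indicE xA mulr1.
Qed.

Lemma L2T_L1loc w u : L2T u -> L1loc w u.
Proof.
move=> Lu; have [mu_ _] := Lu; split; first exact: measurable_funTS.
move=> K cK _; apply: L2T_integrable => //; first exact: compact_measurable2.
exact: compact_finite2.
Qed.

Lemma L2T_patch w (f : R * R -> R) : open w -> L2 w f -> L2T (f \_ w).
Proof.
move=> ow [mf /integrableP[_ i2]]; have mw := open_measurable2 ow.
split; first by apply/(measurable_restrictT f mw).
apply: le_lt_trans i2; rewrite /sqn [leRHS]integral_mkcond.
rewrite le_eqVlt; apply/orP; left; apply/eqP; apply: eq_integral => x _.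
by rewrite !patchE; case: ifP => _ /=; rewrite ?ger0_norm ?sqr_ge0 // expr0n.
Qed.

(** The bound [C], uniform in [s], makes [F] integrable on the plane times [seg h]. The real inner
    integral represents the extended one only where the latter is finite, which holds for almost
    every [x]. *)
Lemma fubini_leb2 (h : R) (F : T * T1 -> R) (C : R) : 0 < h ->
  measurable_fun setT F ->
  (forall s, seg h s -> (\int[leb2]_x `|(F (x, s))%:E| <= C%:E)%E) ->
  leb2.-integrable setT (EFin \o (fun x => \int[mu]_(s in seg h) F (x, s))) /\
  \int[leb2]_x (\int[mu]_(s in seg h) F (x, s)) =
  \int[mu]_(s in seg h) (\int[leb2]_x F (x, s)).
Proof.
move=> h0 mF H; have mI := measurable_seg h.
pose G (z : T * T1) := (F z * \1_(seg h) z.2)%:E.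
have mG : measurable_fun setT G.
  apply/measurable_EFinP; apply: measurable_funM => //.
  by apply: measurableT_comp (measurable_snd); exact: measurable_indic.
have GE x s : G (x, s) = ((fun s => (F (x, s))%:E) \_ (seg h)) s.
  by rewrite /G patchE indicE /=; case: ifP; rewrite ?mulr1 ?mulr0.
have iG : (leb2s \x mu)%E.-integrable setT G.
  apply/(integrable21ltyP leb2s mu mG).
  apply: (@le_lt_trans _ _ (\int[mu]_(s in seg h) (cst C%:E s))%E); last first.
    by rewrite integral_cst // [X in (_ * X)%E](mu_cc (ltW h0)) -EFinM ltry.
  rewrite [leRHS]integral_mkcond; apply: ge0_le_integral => //.
  - by move=> s _; exact: integral_ge0.
  - apply: (@measurable_fun_fubini_tonelli_G _ _ T T1 R leb2s (abse \o G)).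
      exact: measurableT_comp.
    by move=> z; exact: abse_ge0.
  - by apply/(measurable_restrictT _ mI); exact: measurable_cst.
  - move=> s _; rewrite patchE; case: ifPn => sI.
      rewrite inE in sI; apply: le_trans (H s sI).
      rewrite le_eqVlt; apply/orP; left; apply/eqP; apply: eq_integral => x _.
      by rewrite GE patchE mem_set.
    rewrite integral0_eq // => x _; rewrite GE patchE (negbTE sI) abse0 //.
have EF := Fubini iG.
have i1 := integrable_fubini_F iG.
have a1 := ae_integrable1 iG.
have mR : measurable_fun setT (fun x : T => \int[mu]_(s in seg h) F (x, s)).
  apply: measurableT_comp; first exact: fine_measurable.
  have := measurable_fubini_F iG; congr measurable_fun; apply/funext => x.
  by rewrite /fubini_F [RHS]integral_mkcond; apply: eq_integral => s _.
have aeq : {ae @leb2 R, forall x, setT x -> fubini_F mu G x =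
    (\int[mu]_(s in seg h) F (x, s))%:E}.
  apply: ae_leb2S a1 => x ix _; rewrite /fubini_F /Rintegral fineK.
    by rewrite [RHS]integral_mkcond; apply: eq_integral => s _.
  have := integrable_fin_num measurableT ix.
  by rewrite [X in _ -> X \is a fin_num]integral_mkcond; congr (_ \is a fin_num);
    apply: eq_integral => s _.
have mR' := (measurable_EFinP _ _).2 mR.
split.
  apply/integrableP; split => //.
  have /integrableP[_] := i1; congr (_ < _)%E.
  apply: ae_eq_integral => //.
  - by apply: measurableT_comp => //; exact: measurable_int i1.
  - exact: measurableT_comp.
  - by apply: ae_leb2S aeq => x E xT; rewrite E.
rewrite {1}/Rintegral.
rewrite -(_ : \int[leb2]_x fubini_F mu G x =
    \int[leb2]_x (\int[mu]_(s in seg h) F (x, s))%:E)%E; last first.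
  by apply: ae_eq_integral => //; exact: measurable_int i1.
have -> : (\int[leb2]_x fubini_F mu G x)%E = (\int[leb2s]_x (\int[mu]_y G (x, y)))%E by [].
rewrite EF /Rintegral [X in _ = fine X]integral_mkcond; congr fine.
apply: eq_integral => s _; rewrite patchE; case: ifPn => sI.
  rewrite -[LHS]fineK; last first.
    rewrite inE in sI; apply: integrable_fin_num => //; apply/integrableP; split.
      by apply: (measurableT_comp mG); exact: measurable_fun_pair.
    apply: (@le_lt_trans _ _ C%:E); last exact: ltry.
    apply: le_trans (H s sI); rewrite le_eqVlt; apply/orP; left; apply/eqP.
    by apply: eq_integral => x _; rewrite GE patchE mem_set.
  congr (_%:E); congr fine; apply: eq_integral => x _.
  by rewrite GE patchE sI.
by rewrite integral0_eq // => x _; rewrite GE patchE (negbTE sI).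
Qed.

Lemma pderiv_shift2 i j s (f : R * R -> R) x :
  pderiv i (f \o shift2 j s) x = pderiv i f (shift2 j s x).
Proof.
rewrite /pderiv /derive.
suff -> : (fun h : R => h^-1 *: (((f \o shift2 j s) \o shift x) (h *: basis2 i) -
    (f \o shift2 j s) x)) =
  (fun h : R => h^-1 *: ((f \o shift (shift2 j s x)) (h *: basis2 i) -
    f (shift2 j s x))) by [].
by apply/funext => h /=; rewrite !shift2E addrA.
Qed.

Lemma shift2N_line i s (x : R * R) : shift2 i (- s) x = x + s *: basis2 i.
Proof. by rewrite shift2E scaleNr opprK. Qed.

Lemma line_FTC i (phi : R * R -> R) x (h : R) : 0 < h ->
  (forall y, differentiable phi y) -> continuous (pderiv i phi) ->
  \int[mu]_(s in seg h) pderiv i phi (shift2 i (- s) x) =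
  phi (shift2 i (- h) x) - phi x.
Proof.
move=> h0 dphi cphi; rewrite /Rintegral.
pose F s := phi (x + s *: basis2 i).
pose f s := pderiv i phi (x + s *: basis2 i).
have cl : continuous (fun s : R => x + s *: basis2 i).
  by move=> s; apply: cvgD; [exact: cvg_cst|apply: cvgZl; exact: cvg_id].
have D (s : R) : is_derive s 1 F (f s) by exact: is_derive_line.
have cf : continuous f by move=> s; apply: (continuous_comp (cl s) (cphi _)).
have cF : continuous F by move=> s; apply: (continuous_comp (cl s)); exact: differentiable_continuous.
have E : (\int[mu]_(s in seg h) (f s)%:E = (F h)%:E - (F 0)%:E)%E.
  apply: continuous_FTC2; first exact: h0.
  - exact: continuous_subspaceT.
  - split.
    + by move=> s _; case: (D s).
    + exact: cvg_at_right_filter (cF 0).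
    + exact: cvg_at_left_filter (cF h).
  - by move=> s _; rewrite derive1E; apply: derive_val.
have E' : (\int[mu]_(s in seg h) (pderiv i phi (shift2 i (- s) x))%:E =
    (F h)%:E - (F 0)%:E)%E.
  by rewrite -E; apply: eq_integral => s _; rewrite /f shift2N_line.
by rewrite E' /= /F scale0r addr0 shift2N_line.
Qed.

Lemma enlarge_shift2 n i s (q : R * R) :
  enlarge n (shift2 i s q) = shift2 i s (enlarge n q).
Proof. by rewrite /enlarge /shift2; case: (i == ord0); rewrite /= addrAC. Qed.

Lemma cbox_shift2 i s p q (y : R * R) :
  cbox (shift2 i s p) (shift2 i s q) y -> cbox p q (shift2 i (- s) y).
Proof.
by rewrite /shift2; case: (i == ord0) => /cboxE /= [? ? ? ?]; apply/cboxE => /=; split=> //; lra.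
Qed.

Lemma Rintegral_patch w (f psi : R * R -> R) :
  \int[leb2]_(x in w) (f x * psi x) = \int[leb2]_x ((f \_ w) x * psi x).
Proof.
rewrite Rintegral_mkcond; apply: eq_Rintegral => x _; rewrite !patchE.
by case: ifP; rewrite ?mul0r.
Qed.

Lemma integrable_patch w (f : R * R -> R) : open w -> bounded_set w -> L2 w f ->
  leb2.-integrable setT (EFin \o (f \_ w)).
Proof.
move=> ow bw Lf; have mw := open_measurable2 ow.
have Lt := L2T_patch ow Lf.
have := L2T_integrable Lt mw (bounded_leb2 mw bw).
move/(integrable_mkcond _ mw).1; congr (_.-integrable _ _).
by apply/funext => x; rewrite /patch /=; case: (x \in w).
Qed.

Lemma RintegralZl_meas d (S : measurableType d) (m : {measure set S -> \bar R})
    (D : set S) (f : S -> R) : measurable D -> measurable_fun D f ->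
  forall c : R, \int[m]_(x in D) (c * f x) = c * \int[m]_(x in D) f x.
Proof.
move=> mD mf c; have [->|c0] := eqVneq c 0.
  by rewrite mul0r; under eq_Rintegral do rewrite mul0r; rewrite Rintegral_cst // mul0r.
have [i_|ni] := pselect (m.-integrable D (EFin \o f)); first exact: RintegralZl.
have N (g : S -> R) : measurable_fun D g -> ~ m.-integrable D (EFin \o g) ->
    \int[m]_(x in D) g x = 0.
  move=> mg ng; have mg' := (measurable_EFinP _ _).2 mg.
  rewrite /Rintegral; have : (\int[m]_(x in D) (g x)%:E)%E \isn't a fin_num.
    apply/negP; rewrite -(integral_fin_num_abs m mD mg) => h.
    by apply: ng; apply/integrableP.
  by case: (\int[m]_(x in D) (g x)%:E)%E.
rewrite !N ?mulr0 //; first exact: measurable_funM.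
move=> /(integrableZl mD c^-1) h; apply: ni; apply: eq_integrable h => // x _.
by rewrite /= -EFinM mulrA mulVf // mul1r.
Qed.

Lemma integrable_mul_bounded u v (M : R) : leb2.-integrable setT (EFin \o u) ->
  measurable_fun setT v -> (forall x, `|v x| <= M) ->
  leb2.-integrable setT (EFin \o (fun x => u x * v x)).
Proof.
move=> iu mv bv; have /measurable_EFinP mu_ := measurable_int _ iu.
apply: (@integrable_dominated _ T R leb2 setT measurableT _ (fun x => M * `|u x|)).
- exact: measurable_funM.
- by move=> x _; rewrite normrM mulrC ler_wpM2r.
- exact: (integrableZl measurableT M (integrable_norm iu)).
Qed.

Lemma test_bounded w phi : test_function w phi ->
  exists2 M : R, 0 <= M & forall x, `|phi x| <= M.
Proof.
move=> tV; have [_ cK _] := tV.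
by apply: (continuous_compact_bounded (test_continuous tV) cK) => x; exact: csupp_off.
Qed.

Lemma test_off w phi x : test_function w phi -> ~ w x -> phi x = 0.
Proof. by move=> [_ _ Kw] wx; apply: csupp_off => /Kw. Qed.

Lemma test_pderiv_off i w phi x : test_function w phi -> ~ w x -> pderiv i phi x = 0.
Proof.
move=> [_ cK Kw] wx; apply: (@pderiv_off _ (csupp phi)) => [||/Kw //].
- exact: closed_closure.
- exact: csupp_off.
Qed.

Lemma test_pderiv_bounded i w phi : test_function w phi ->
  exists2 M : R, 0 <= M & forall x, `|pderiv i phi x| <= M.
Proof.
move=> tV; have [_ cK _] := tV.
apply: (continuous_compact_bounded (test_pderiv_continuous tV) cK).
by apply: pderiv_off; [exact: closed_closure|exact: csupp_off].
Qed.

(** The fundamental theorem of calculus along segments, moved to the test function: tested against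
    [phi], the averaged derivative becomes by Fubini an integral over [s] of weak-derivative
    identities for the translates of [phi], and [line_FTC] integrates the derivative of [phi] along
    the segment. *)
Lemma weak_diff w V i f g (h : R) : open w -> bounded_set w -> open V -> 0 < h ->
  L2 w f -> L2 w g -> is_weak_partial w i f g ->
  (forall x s, V x -> 0 <= s <= h -> w (shift2 i s x)) ->
  {ae @leb2 R, forall x, V x ->
    (f \_ w) x - (f \_ w) (shift2 i h x) = h * avg i h (g \_ w) x}.
Proof.
move=> ow bw oV h0 Lf Lg [_ _ wfg] VW.
have Lft := L2T_patch ow Lf; have Lgt := L2T_patch ow Lg.
have ift := integrable_patch ow bw Lf; have igt := integrable_patch ow bw Lg.
set ft := f \_ w in Lft ift *; set gt := g \_ w in Lgt igt *.
have [mft _] := Lft; have [mgt _] := Lgt.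
pose G x := ft x - ft (shift2 i h x) - h * avg i h gt x.
have LG : L2T G.
  by apply: L2TB; [apply: L2TB => //; exact: L2T_shift|apply: L2TZ; exact: L2T_avg].
suff : {ae @leb2 R, forall x, V x -> G x = 0}.
  by apply: ae_leb2S => x H Vx; apply/eqP; rewrite -subr_eq0; apply/eqP; exact: H.
apply: fundamental_lemma => //; first exact: L2T_L1loc.
move=> n p q pqV; set phi := tbump n p q.
have tV : test_function V phi by exact: tbump_test.
have cphi := test_continuous tV; have cdphi := @test_pderiv_continuous _ _ i _ tV.
have phi1 x : `|phi x| <= 1.
  by have /andP[a b] := tbump_le1 n p q x; rewrite ger0_norm.
have [M M0 bM] := test_pderiv_bounded i tV.
have mphi D : measurable_fun D (phi : T -> R) by exact: continuous_measurable_fun2.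
have mdphi D : measurable_fun D (pderiv i phi : T -> R) by exact: continuous_measurable_fun2.
pose F1 (z : T * T1) := - ft z.1 * pderiv i phi (shift2 i (- z.2) z.1).
pose F2 (z : T * T1) := gt (shift2 i z.2 z.1) * phi z.1.
have mneg : measurable_fun setT (fun z : T * T1 => (z.1, - z.2) : T * T1).
  apply: measurable_fun_pair; first exact: measurable_fst.
  by apply: measurable_funN => //; exact: measurable_snd.
have mF1 : measurable_fun setT F1.
  apply: measurable_funM.
    by apply: measurable_funN; apply: measurableT_comp => //; exact: measurable_fst.
  exact: (measurableT_comp (measurable_shift_pair i (mdphi setT)) mneg).
have mF2 : measurable_fun setT F2.
  apply: measurable_funM; first exact: measurable_shift_pair.
  by apply: measurableT_comp; [exact: mphi|exact: measurable_fst].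
have nfin (u : T -> R) : leb2.-integrable setT (EFin \o u) ->
    (\int[leb2]_x `|(u x)%:E| = (fine (\int[leb2]_x `|(u x)%:E|))%:E)%E.
  move=> /integrableP[_ fu]; rewrite fineK // ge0_fin_numE //.
  exact: integral_ge0.
have [|_ E1] := @fubini_leb2 h F1 (M * fine (\int[leb2]_x `|(ft x)%:E|)) h0 mF1.
  move=> s _; rewrite EFinM -nfin // -ge0_integralZl //; last first.
    by apply: measurableT_comp => //; exact: measurable_int ift.
  apply: ge0_le_integral => //.
  - apply: measurableT_comp => //; apply/measurable_EFinP; apply: (measurableT_comp mF1).
    exact: measurable_fun_pair.
  - by apply: measurable_funeM; apply: measurableT_comp => //; exact: measurable_int ift.
  - by move=> x _; rewrite /F1 /= -EFinM lee_fin normrM normrN mulrC ler_wpM2r.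
have [|iF2 E2] := @fubini_leb2 h F2 (fine (\int[leb2]_x `|(gt x)%:E|)) h0 mF2.
  move=> s _; rewrite -nfin //.
  rewrite -(ge0_integral_shift2 i s (F := fun x => `|(gt x)%:E|%E)) //; last first.
    by apply: measurableT_comp => //; exact: measurable_int igt.
  apply: ge0_le_integral => //.
  - apply: measurableT_comp => //; apply/measurable_EFinP; apply: (measurableT_comp mF2).
    exact: measurable_fun_pair.
  - apply: measurableT_comp => //; apply/measurable_EFinP.
    exact: measurable_comp_shift2.
  - by move=> x _; rewrite /F2 /= lee_fin normrM ler_piMr.
(* For fixed [s] the translation is passed from [gt] to [phi]. The translated [phi] is still a test
   function on [w], because [VW] keeps the whole segment inside [w]. *)
have E3 s : seg h s -> \int[leb2]_x F2 (x, s) = \int[leb2]_x F1 (x, s).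
  rewrite /seg /= in_itv /= => sh.
  have tw : test_function w (phi \o shift2 i (- s)).
    have -> : phi \o shift2 i (- s) = tbump n (shift2 i s p) (shift2 i s q).
      by apply/funext => x; rewrite /phi /= tbump_shift opprK.
    apply: tbump_test => y; rewrite enlarge_shift2 => /cbox_shift2/pqV Vy.
    by have := VW _ _ Vy sh; rewrite shift2_add subrr shift2_0.
  have E : \int[leb2]_x (ft x * pderiv i (phi \o shift2 i (- s)) x) =
      - \int[leb2]_x (gt x * (phi \o shift2 i (- s)) x).
    by have := wfg _ tw; rewrite (Rintegral_patch w f) (Rintegral_patch w g).
  have mds : measurable_fun setT (pderiv i (phi \o shift2 i (- s)) : T -> R).
    by apply: continuous_measurable_fun2; exact: test_pderiv_continuous tw.
  transitivity (\int[leb2]_x (gt x * (phi \o shift2 i (- s)) x)).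
    rewrite -(Rintegral_shift2 i s (F := fun x => gt x * (phi \o shift2 i (- s)) x)).
      by apply: eq_Rintegral => x _; rewrite /F2 /= shift2_add addNr shift2_0.
    apply: (integrable_mul_bounded (M := 1) igt); first exact: measurable_comp_shift2.
    by move=> x; exact: phi1.
  have := RintegralZl_meas leb2 measurableT (measurable_funM mft mds) (-1).
  rewrite mulN1r E opprK => <-; apply: eq_Rintegral => x _.
  by rewrite /F1 /= pderiv_shift2 mulN1r mulNr.
have FT x : \int[mu]_(s in seg h) pderiv i phi (shift2 i (- s) x) =
    phi (shift2 i (- h) x) - phi x.
  by apply: line_FTC => // y; exact: test_differentiable tV y.
have mpx x : measurable_fun setT (fun s : T1 => (x, s) : T * T1).
  exact: measurable_fun_pair.
have mgs x : measurable_fun (seg h) (fun s : T1 => gt (shift2 i s x)).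
  apply: measurable_funTS.
  exact: (measurableT_comp (measurable_shift_pair i mgt) (mpx x)).
have mps x : measurable_fun (seg h) (fun s : T1 => pderiv i phi (shift2 i (- s) x)).
  apply: measurable_funTS; apply: (measurableT_comp
    (measurable_shift_pair i (mdphi setT)) (g := fun s : T1 => (x, - s) : T * T1)).
  by apply: measurable_fun_pair => //; exact: measurable_funN.
have b1 x : `|phi (shift2 i (- h) x)| <= 1 by exact: phi1.
have mS := measurable_comp_shift2 i (- h) (mphi setT).
have iA := integrable_mul_bounded ift (mphi setT) phi1.
have iB := integrable_mul_bounded ift mS b1.
have iC : leb2.-integrable setT (EFin \o (fun x => ft (shift2 i h x) * phi x)).
  exact: (integrable_mul_bounded (integrable_shift2 i h ift) (mphi setT) phi1).
have hV : h != 0 by rewrite gt_eqF.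
transitivity (\int[leb2]_x (ft x * phi x - ft (shift2 i h x) * phi x -
    \int[mu]_(s in seg h) F2 (x, s))).
  rewrite Rintegral_patch; apply: eq_Rintegral => x _.
  have -> : \int[mu]_(s in seg h) F2 (x, s) = h * avg i h gt x * phi x.
    rewrite (_ : h * avg i h gt x = \int[mu]_(s in seg h) gt (shift2 i s x)); last first.
      by rewrite /avg mulrA (divff hV) mul1r.
    rewrite mulrC.
    rewrite -(RintegralZl_meas mu (measurable_seg h) (mgs x)).
    by apply: eq_Rintegral => s _; rewrite mulrC.
  rewrite patchE; case: ifPn => xV; first by rewrite /G; ring.
  rewrite notin_setE in xV.
  by rewrite (test_off tV xV) !mulr0 !subr0.
have iAC : leb2.-integrable setT (EFin \o (fun x => ft x * phi x - ft (shift2 i h x) * phi x)).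
  by have := integrableB measurableT iA iC.
rewrite RintegralB // RintegralB // E2.
have -> : \int[mu]_(s in seg h) \int[leb2]_x F2 (x, s) =
    \int[leb2]_x (ft x * phi x) - \int[leb2]_x (ft x * phi (shift2 i (- h) x)).
  transitivity (\int[mu]_(s in seg h) \int[leb2]_x F1 (x, s)).
    by apply: eq_Rintegral => s; rewrite inE; exact: E3.
  rewrite -E1 -RintegralB //; apply: eq_Rintegral => x _.
  transitivity (- ft x * \int[mu]_(s in seg h) pderiv i phi (shift2 i (- s) x)).
    by rewrite -(RintegralZl_meas mu (measurable_seg h) (mps x)).
  by rewrite FT; ring.
rewrite -(Rintegral_shift2 i (- h) iC).
under [X in _ - X - _]eq_Rintegral do rewrite shift2_add subrr shift2_0.
by rewrite subrr.
Qed.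
End DifferenceQuotients.

(** * Product rule and Jacobians for weak derivatives; smooth functions *)

Section SobolevProducts.
Context {R : realType}.
Local Notation T1 := (measurableTypeR R).
Local Notation T := (T1 * T1)%type.
Local Notation mu := (@lebesgue_measure R).
Implicit Types (u v : T -> R) (i j : 'I_2) (w V : set (R * R)).

Lemma cvgL2_ae (u_ v_ : nat -> T -> R) u :
  (forall n, measurable_fun setT (u_ n)) -> (forall n, measurable_fun setT (v_ n)) ->
  measurable_fun setT u ->
  (forall n, {ae @leb2 R, forall x, u_ n x = v_ n x}) -> cvgL2 u_ u -> cvgL2 v_ u.
Proof.
move=> mu_ mv_ mu0 H; rewrite /cvgL2.
suff -> : (fun n => sqn (u_ n \- u)) = (fun n => sqn (v_ n \- u)) by [].
apply/funext => n; apply: ae_eq_integral => //.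
- by apply: measurable_sq; exact: measurable_funB.
- by apply: measurable_sq; exact: measurable_funB.
- by apply: ae_leb2S (H n) => x E _ /=; rewrite E.
Qed.

Lemma cvgL2_cst u : cvgL2 (fun=> u) u.
Proof.
rewrite /cvgL2; suff -> : sqn (u \- u) = 0%E by exact: cvg_cst.
by apply: integral0_eq => x _ /=; rewrite subrr expr0n.
Qed.

Lemma cvgL2D (u_ v_ : nat -> T -> R) u v :
  (forall n, L2T (u_ n)) -> (forall n, L2T (v_ n)) -> L2T u -> L2T v ->
  cvgL2 u_ u -> cvgL2 v_ v -> cvgL2 (fun n => u_ n \+ v_ n) (u \+ v).
Proof.
move=> Lu_ Lv_ Lu Lv cu cv; apply/cvgL2P => e e0.
have e4 : 0 < e / 4 by rewrite divr_gt0.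
have := (cvgL2P _ _).1 cv (e / 4) e4; have := (cvgL2P _ _).1 cu (e / 4) e4.
apply: filterS2 => n hu hv.
have -> : (u_ n \+ v_ n) \- (u \+ v) = (u_ n \- u) \+ (v_ n \- v).
  by apply/funext => x /=; ring.
have [LU _] := L2TB (Lu_ n) Lu; have [LV _] := L2TB (Lv_ n) Lv.
apply: le_trans (sqnD LU LV) _.
have -> : e = 2 * (e / 4) + 2 * (e / 4) by field.
by rewrite [leRHS]EFinD !EFinM leeD // lee_pmul2l.
Qed.

(** u_n psi_n - u psi splits into (u_n - u) psi_n, small by the uniform bound [M], and u (psi_n -
    psi), which converges by domination. *)
Lemma cvgL2_mulb (u_ psi_ : nat -> T -> R) u psi (M : R) :
  (forall n, L2T (u_ n)) -> L2T u -> cvgL2 u_ u ->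
  (forall n, measurable_fun setT (psi_ n)) -> (forall n x, `|psi_ n x| <= M) ->
  (forall x, psi_ n x @[n --> \oo] --> psi x) ->
  L2T (fun x => u x * psi x) /\
  cvgL2 (fun n x => u_ n x * psi_ n x) (fun x => u x * psi x).
Proof.
move=> Lu_ Lu cu mpsi bpsi cpsi; have [mu0 _] := Lu.
have M0 : 0 <= M by apply: le_trans (bpsi 0%N (0, 0)).
have Lu' : L2T (fun x => M * `|u x|).
  apply: (L2T_le _ (L2TZ M Lu)); first by apply: measurable_funM => //; exact: measurableT_comp.
  by move=> x; rewrite !normrM normr_id.
have Lw n : L2T (fun x => u x * psi_ n x) by exact: L2T_mul_bounded (bpsi n).
have [] := @cvgL2_dominated R (fun n x => u x * psi_ n x) (fun x => u x * psi x)
  (fun x => M * `|u x|).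
- by move=> n; have [] := Lw n.
- by move=> x; apply: cvgM; [exact: cvg_cst|exact: cpsi].
- exact: Lu'.
- by move=> n x; rewrite normrM mulrC ler_wpM2r.
move=> Lp c1; split=> //.
have LD n := L2TB (Lu_ n) Lu.
have LDp n : L2T (fun x => (u_ n \- u) x * psi_ n x) by exact: L2T_mul_bounded (bpsi n).
have c2 : cvgL2 (fun n x => (u_ n \- u) x * psi_ n x) (fun=> 0).
  apply/cvgL2P => e e0; have k0 : 0 < M ^+ 2 + 1 by rewrite ltr_wpDl // sqr_ge0.
  have := (cvgL2P _ _).1 cu (e / (M ^+ 2 + 1)) (divr_gt0 e0 k0).
  apply: filterS => n hn.
  apply: (@le_trans _ _ (sqn (fun x => M * (u_ n \- u) x))).
    apply: le_sqn.
    - by apply: measurable_funB => //; have [] := LDp n.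
    - by have [] := L2TZ M (LD n).
    - move=> x /=; rewrite subr0 mulrC !normrM (ger0_norm M0).
      by rewrite ler_wpM2r.
  rewrite sqnZ; last by have [] := LD n.
  move: hn; rewrite -(fineK (L2T_int (LD n))) lee_fin -EFinM lee_fin ler_pdivlMr //.
  by have := fine_ge0 (sqn_ge0 (u_ n \- u)); set a := fine _; nra.
have L0 : L2T (fun=> 0 : R).
  have := L2TZ 0 Lu; congr L2T; apply/funext => x; exact: mul0r.
have := cvgL2D LDp Lw L0 Lp c2 c1.
have -> : (fun n => (fun x => (u_ n \- u) x * psi_ n x) \+ (fun x => u x * psi_ n x)) =
    (fun n x => u_ n x * psi_ n x).
  by apply/funext => n; apply/funext => x /=; ring.
by congr cvgL2; apply/funext => x /=; rewrite add0r.
Qed.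

Lemma cvgL2_shift j (u_ : nat -> T -> R) u (s_ : nat -> R) :
  (forall n, L2T (u_ n)) -> L2T u -> cvgL2 u_ u -> (forall n, 0 <= s_ n) ->
  s_ n @[n --> \oo] --> (0 : R) -> cvgL2 (fun n => u_ n \o shift2 j (s_ n)) u.
Proof.
move=> Lu_ Lu cu s0 cs.
have Lz : L2T (fun=> 0 : R).
  have := L2TZ 0 Lu; congr L2T; apply/funext => x; exact: mul0r.
have c1 : cvgL2 (fun n => (u_ n \- u) \o shift2 j (s_ n)) (fun=> 0).
  rewrite /cvgL2; suff -> : (fun n => sqn (((u_ n \- u) \o shift2 j (s_ n)) \- (fun=> 0))) =
    (fun n => sqn (u_ n \- u)) by [].
  apply/funext => n; have [m _] := L2TB (Lu_ n) Lu; rewrite -[RHS](sqn_shift j (s_ n) m).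
  by congr sqn; apply/funext => x /=; rewrite subr0.
have c2 : cvgL2 (fun n => u \o shift2 j (s_ n)) u.
  apply/cvgL2P => e e0; have [d d0 H] := L2_translation_modulus j Lu e0.
  have : \forall n \near \oo, s_ n < d by exact: (cvgr_lt _ cs).
  by apply: filterS => n nd; apply: H; rewrite s0 ltW.
have := cvgL2D (fun n => L2T_shift j (s_ n) (L2TB (Lu_ n) Lu))
  (fun n => L2T_shift j (s_ n) Lu) Lz Lu c1 c2.
have -> : (fun n => ((u_ n \- u) \o shift2 j (s_ n)) \+ (u \o shift2 j (s_ n))) =
    (fun n => u_ n \o shift2 j (s_ n)).
  by apply/funext => n; apply/funext => x /=; ring.
by congr cvgL2; apply/funext => x /=; rewrite add0r.
Qed.

Lemma ae_shift2 j s (P : R * R -> Prop) : {ae @leb2 R, forall x, P x} ->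
  {ae @leb2 R, forall x, P (shift2 j s x)}.
Proof.
move=> [N [mN N0 PN]]; have mS : measurable (shift2 j s @^-1` N).
  by have := measurable_shift2 j s measurableT mN; rewrite setTI.
exists (shift2 j s @^-1` N); split=> //.
  by have := leb2_shift j s mN; rewrite /pushforward => ->.
by move=> x /= nP; apply: PN.
Qed.

Lemma shift2C i j s t (x : T) :
  shift2 i s (shift2 j t x) = shift2 j t (shift2 i s x).
Proof.
rewrite /shift2; case: (i == ord0); case: (j == ord0) => //=; congr pair; ring.
Qed.

Lemma ball_shift2 i s (r : R) (x y : R * R) : 0 <= s -> ball x r y ->
  ball x (r + s) (shift2 i s y).
Proof.
move=> s0 [/= b1 b2]; move: b1 b2; rewrite /ball /= !ltr_norml => /andP[? ?] /andP[? ?].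
by rewrite /shift2; case: (i == ord0); split; rewrite /ball /= ltr_norml;
  apply/andP; split; lra.
Qed.

Lemma compact_margin K w : open w -> compact K -> K `<=` w ->
  exists2 d : R, 0 < d & forall x, K x -> ball x d `<=` w.
Proof.
move=> ow /compact_near_coveringP cK Kw.
have : \forall e \near (0 : R)^'+, K `<=` [set x | ball x e `<=` w].
  apply: (cK R (0 : R)^'+ (fun e x => ball x e `<=` w)) => x /Kw wx.
  have /nbhs_ballP[e /= e0 eV] : nbhs x w by exact: open_nbhs_nbhs.
  near=> y d => /= z dz; apply: eV.
  have -> : e = e / 2 + e / 2 by field.
  apply: (@ball_triangle _ _ y).
    by near: y; apply: nbhsx_ballx; rewrite divr_gt0.
  apply: le_ball dz; near: d; apply: nbhs_right_le; exact: divr_gt0.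
move=> H; have [d [d0 Hd]] : exists d : R, 0 < d /\ K `<=` [set x | ball x d `<=` w].
  near (0 : R)^'+ => d; exists d; split; last by near: d.
  by near: d; exact: nbhs_right_gt.
by exists d.
Unshelve. all: by end_near.
Qed.

Lemma continuous_shift2 i s : continuous (shift2 i s : R * R -> R * R).
Proof.
rewrite (_ : shift2 i s = fun x => x - s *: basis2 i); last by apply/funext => x; rewrite shift2E.
by move=> x; apply: cvgB; [exact: cvg_id|exact: cvg_cst].
Qed.

(** Backward quotients go on Sobolev functions, where [weak_diff] makes them averages. The forward
    quotients [fdq] are minus their adjoints and fall on test functions ([dq_parts]). *)
Definition dq i (h : R) u x := h^-1 * (u x - u (shift2 i h x)).

Definition fdq i (h : R) u x := h^-1 * (u (shift2 i (- h) x) - u x).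

(* Test functions are supported in V, with room for the finitely many
   translations by at most [h_ n] that are applied to them below. *)
Record margin w (phi : R * R -> R) V (h_ : nat -> R) : Prop := Margin {
  margin_open : open V;
  margin_gt0 : forall n, 0 < h_ n;
  margin_cvg : h_ n @[n --> \oo] --> (0 : R);
  margin_off : forall x, ~ V x -> phi x = 0;
  margin_shift_off : forall i n x, ~ V x -> phi (shift2 i (- h_ n) x) = 0;
  margin_in : forall i j n s t x, V x -> 0 <= s <= h_ n -> 0 <= t <= h_ n ->
    w (shift2 i s (shift2 j t x)) }.

Lemma test_margin w phi : open w -> test_function w phi ->
  exists V h_, margin w phi V h_.
Proof.
move=> ow [_ cK Kw]; have [d d0 Kd] := compact_margin ow cK Kw.
(* Steps are at most d/4 and [V] is the d/3-neighbourhood of the support. Two steps from [V] stay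
   within d/3 + d/4 + d/4 < d of the support, and one step from outside [V] cannot reach it since
   d/4 < d/3. *)
pose h_ (n : nat) : R := d / 4 * n.+1%:R^-1.
have N0 (n : nat) : 0 < n.+1%:R^-1 :> R by rewrite invr_gt0.
have N1 (n : nat) : n.+1%:R^-1 <= 1 :> R by rewrite invf_le1 // ler1n.
have h0 n : 0 < h_ n by rewrite mulr_gt0 // divr_gt0.
have hd n : h_ n <= d / 4 by rewrite ler_piMr // divr_ge0 // ltW.
exists (\bigcup_(x in csupp phi) ball x (d / 3)), h_; split=> //.
- by apply: bigcup_open => x _; exact: ball_open.
- rewrite -(mulr0 (d / 4)); apply: cvgM; first exact: cvg_cst.
  exact: cvg_harmonic.
- move=> x nV; apply: csupp_off => xK; apply: nV; exists x => //.
  by apply: ballxx; rewrite divr_gt0.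
- move=> i n x nV; apply: csupp_off => xK; apply: nV; exists (shift2 i (- h_ n) x) => //.
  have := @ball_shift2 i (h_ n) (d / 3 - h_ n) _ _ (ltW (h0 n))
     (ballxx (shift2 i (- h_ n) x) _).
  rewrite shift2_add subrr shift2_0 subrK; apply.
  by have := hd n; lra.
- move=> i j n s t x [z zK zx] /andP[s0 sh] /andP[t0 th].
  apply: (Kd z zK); apply: le_ball (ball_shift2 i s0 (ball_shift2 j t0 zx)).
  by have := hd n; lra.
Qed.

Lemma L2T_dq i (h : R) u : L2T u -> L2T (dq i h u).
Proof.
by move=> Lu; have := L2TZ h^-1 (L2TB Lu (L2T_shift i h Lu)); congr L2T.
Qed.

(** Difference quotients are averages of [g] only near the support, so they are multiplied by
    [psi_ n], which vanishes off [V]. The further translation by [s_ n] is there for the translated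
    factor in the discrete product rule for Jacobians. *)
Lemma dq_cvg w V phi h_ i j f g (s_ : nat -> R) (psi_ : nat -> T -> R) psi (M : R) :
  open w -> bounded_set w -> margin w phi V h_ ->
  L2 w f -> L2 w g -> is_weak_partial w i f g ->
  (forall n, 0 <= s_ n <= h_ n) ->
  (forall n, measurable_fun setT (psi_ n)) -> (forall n x, `|psi_ n x| <= M) ->
  (forall x, psi_ n x @[n --> \oo] --> psi x) ->
  (forall n x, ~ V x -> psi_ n x = 0) ->
  L2T (fun x => (g \_ w) x * psi x) /\
  (forall n, L2T (fun x => dq i (h_ n) (f \_ w) (shift2 j (s_ n) x) * psi_ n x)) /\
  cvgL2 (fun n x => dq i (h_ n) (f \_ w) (shift2 j (s_ n) x) * psi_ n x)
    (fun x => (g \_ w) x * psi x).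
Proof.
move=> ow bw [oV h0 ch _ _ VW] Lf Lg wfg sh mpsi bpsi cpsi psiV.
have Lft := L2T_patch ow Lf; have Lgt := L2T_patch ow Lg.
have cs : s_ n @[n --> \oo] --> (0 : R).
  by apply: squeeze_cvgr (cvg_cst 0) ch; exact: nearW.
have La n : L2T (avg i (h_ n) (g \_ w)) by exact: L2T_avg.
have s0 n : 0 <= s_ n by have /andP[] := sh n.
have ca := cvgL2_shift j La Lgt (avg_cvg i Lgt h0 ch) s0 cs.
have Las n := L2T_shift j (s_ n) (La n).
have [Lp cp] := cvgL2_mulb Las Lgt ca mpsi bpsi cpsi.
have Ldq n := L2T_dq i (h_ n) Lft.
have Ld n : L2T (fun x => dq i (h_ n) (f \_ w) (shift2 j (s_ n) x) * psi_ n x).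
  exact: L2T_mul_bounded (L2T_shift j (s_ n) (Ldq n)) (mpsi n) (bpsi n).
split=> //; split=> //.
apply: cvgL2_ae cp => //.
- by move=> n; have [m _] := L2T_mul_bounded (Las n) (mpsi n) (bpsi n).
- by move=> n; have [] := Ld n.
- by have [] := Lp.
(* [V'] is the image of [V] under the translation, so that the identity of [weak_diff] on [V'] can
   be read at translated points of [V]. *)
move=> n; pose V' := shift2 j (- s_ n) @^-1` V.
have oV' : open V'.
  by apply: open_comp => // x _; exact: continuous_shift2.
have H : {ae @leb2 R, forall x, V' x ->
    (f \_ w) x - (f \_ w) (shift2 i (h_ n) x) = h_ n * avg i (h_ n) (g \_ w) x}.
  apply: weak_diff => // x s Vx hs.
  have := VW i j n s (s_ n) _ Vx hs (sh n).
  by rewrite shift2_add subrr shift2_0.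
apply: ae_leb2S (ae_shift2 j (s_ n) H) => x Hx /=.
have [xV|xV] := pselect (V x); last by rewrite psiV // !mulr0.
rewrite /dq Hx ?mulKf ?gt_eqF //.
by rewrite /V' /= shift2_add addNr shift2_0.
Qed.

Lemma dq_parts i (h : R) (F phi : T -> R) (M : R) : leb2.-integrable setT (EFin \o F) ->
  measurable_fun setT phi -> (forall x, `|phi x| <= M) ->
  \int[leb2]_x (dq i h F x * phi x) = - \int[leb2]_x (F x * fdq i h phi x).
Proof.
move=> iF mphi bphi.
have mS := measurable_comp_shift2 i (- h) mphi.
have bS x : `|(phi \o shift2 i (- h)) x| <= M by exact: bphi.
have iA := integrable_mul_bounded iF mphi bphi.
have iB := integrable_mul_bounded (integrable_shift2 i h iF) mphi bphi.
have iC := integrable_mul_bounded iF mS bS.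
have E : \int[leb2]_x (F (shift2 i h x) * phi x) =
    \int[leb2]_x (F x * phi (shift2 i (- h) x)).
  rewrite -(Rintegral_shift2 i h iC); apply: eq_Rintegral => x _ /=.
  by rewrite shift2_add addNr shift2_0.
have -> : \int[leb2]_x (dq i h F x * phi x) =
    h^-1 * (\int[leb2]_x (F x * phi x) - \int[leb2]_x (F (shift2 i h x) * phi x)).
  rewrite -RintegralB // -RintegralZl //.
    by apply: eq_Rintegral => x _; rewrite /dq; ring.
  by have := integrableB measurableT iA iB.
have -> : \int[leb2]_x (F x * fdq i h phi x) =
    h^-1 * (\int[leb2]_x (F x * phi (shift2 i (- h) x)) - \int[leb2]_x (F x * phi x)).
  rewrite -RintegralB // -RintegralZl //.
    by apply: eq_Rintegral => x _; rewrite /fdq; ring.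
  by have := integrableB measurableT iC iA.
rewrite E; set a := Rintegral _ _ _; set b := Rintegral _ _ _; ring.
Qed.

Lemma fdq_cvg i (h_ : nat -> R) (psi : R * R -> R) x : differentiable psi x ->
  (forall n, 0 < h_ n) -> h_ n @[n --> \oo] --> (0 : R) ->
  fdq i (h_ n) psi x @[n --> \oo] --> pderiv i psi x.
Proof.
move=> dpsi h0 ch.
have dv : derivable psi x (basis2 i) by exact: diff_derivable.
have := (cvg_at_rightP _ _ _).1 (cvg_dnbhs_at_right dv) h_ (conj h0 ch).
apply: cvg_trans; apply: near_eq_cvg; apply: nearW => n.
by rewrite /fdq shift2N_line /= [x + _]addrC.
Qed.

Lemma fdq_bound i (h : R) (psi : R * R -> R) (M : R) x : 0 < h ->
  (forall y, differentiable psi y) -> (forall y, `|pderiv i psi y| <= M) ->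
  `|fdq i h psi x| <= M.
Proof.
move=> h0 dpsi bpsi.
have D (s : R) : is_derive s 1 (fun s => psi (x + s *: basis2 i)) (pderiv i psi (x + s *: basis2 i)).
  exact: is_derive_line.
have [|c _] := MVT h0 (fun s _ => D s).
  apply: derivable_within_continuous => s _; by case: (D s).
rewrite scale0r addr0 subr0 => E.
by rewrite /fdq shift2N_line E mulrC mulfK ?gt_eqF.
Qed.

Lemma fdq_off w V phi h_ i n x : margin w phi V h_ -> ~ V x -> fdq i (h_ n) phi x = 0.
Proof.
by move=> m xV; rewrite /fdq (margin_off m xV) (margin_shift_off m _ _ xV) subrr mulr0.
Qed.

Lemma measurable_fdq i (h : R) (phi : T -> R) : measurable_fun setT phi ->
  measurable_fun setT (fdq i h phi).
Proof.
move=> mphi; apply: measurable_funM => //; apply: measurable_funB => //.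
exact: measurable_comp_shift2.
Qed.

Lemma dq_parts_cvg w V phi h_ i (F : T -> R) : test_function w phi ->
  margin w phi V h_ -> leb2.-integrable setT (EFin \o F) ->
  \int[leb2]_x (dq i (h_ n) F x * phi x) @[n --> \oo] -->
  - \int[leb2]_x (F x * pderiv i phi x).
Proof.
move=> tw m iF; have [M M0 bM] := test_pderiv_bounded i tw.
have [M' _ bM'] := test_bounded tw.
have h0 := margin_gt0 m.
have mphi : measurable_fun setT (phi : T -> R).
  by apply: continuous_measurable_fun2; exact: test_continuous tw.
have mF : measurable_fun setT F by have /measurable_EFinP := measurable_int _ iF.
rewrite (_ : (fun n => _) = (fun n => - \int[leb2]_x (F x * fdq i (h_ n) phi x))); last first.
  by apply/funext => n; exact: dq_parts bM'.
apply: cvgN.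
have [] // := @Rintegral_dominated_cvg _ T R leb2 setT measurableT
  (fun n x => F x * fdq i (h_ n) phi x) (fun x => F x * pderiv i phi x) (fun x => M * `|F x|).
- by move=> n; apply: measurable_funM => //; exact: measurable_fdq.
- move=> x _; apply: cvgM; first exact: cvg_cst.
  by apply: fdq_cvg h0 (margin_cvg m); exact: test_differentiable tw x.
- exact: (integrableZl measurableT M (integrable_norm iF)).
- move=> n x _; rewrite normrM mulrC ler_wpM2r //.
  by apply: fdq_bound => //; exact: test_differentiable tw.
Qed.

Lemma patchM w (f g : R * R -> R) :
  (fun x => f x * g x) \_ w = (fun x => (f \_ w) x * (g \_ w) x).
Proof. by apply/funext => x; rewrite !patchE; case: ifP; rewrite ?mulr0. Qed.

Lemma integrable_L2M w f g : open w -> L2 w f -> L2 w g ->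
  leb2.-integrable (w : set T) (EFin \o (fun x => f x * g x)).
Proof.
move=> ow Lf Lg; have mw := open_measurable2 ow.
have := integrable_mulL2 (L2T_patch ow Lf) (L2T_patch ow Lg).
move=> /(integrableS measurableT mw (@subsetT _ _)); apply: eq_integrable => // x xw /=.
by rewrite !patchE xw.
Qed.

Lemma integrable_L1loc w f : open w -> leb2.-integrable (w : set T) (EFin \o f) ->
  L1loc w f.
Proof.
move=> ow iw; split; first by have /measurable_EFinP := measurable_int _ iw.
move=> K cK Kw; apply: integrableS iw => //; first exact: open_measurable2.
exact: compact_measurable2.
Qed.

(** The limit of the discrete rule D(f g) = (D f) g + f(. - h e_i) D g. In each term both factors
    converge in L^2 once [phi] has been attached to the difference quotient. *)
Lemma weak_partialM w i f g f' g' : open w -> bounded_set w ->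
  L2 w f -> L2 w g -> L2 w f' -> L2 w g' ->
  is_weak_partial w i f f' -> is_weak_partial w i g g' ->
  is_weak_partial w i (fun x => f x * g x) (fun x => f' x * g x + f x * g' x).
Proof.
move=> ow bw Lf Lg Lf' Lg' wf wg; have mw := open_measurable2 ow.
have ifg := integrable_L2M ow Lf Lg.
have i1 := integrable_L2M ow Lf' Lg; have i2 := integrable_L2M ow Lf Lg'.
have i12 : leb2.-integrable (w : set T) (EFin \o (fun x => f' x * g x + f x * g' x)).
  by have := integrableD mw i1 i2.
split; [exact: integrable_L1loc|exact: integrable_L1loc|] => phi tw.
have [V [h_ m]] := test_margin ow tw.
have LF := L2T_patch ow Lf; have LG := L2T_patch ow Lg.
have LF' := L2T_patch ow Lf'; have LG' := L2T_patch ow Lg'.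
have iFG := integrable_mulL2 LF LG.
have [M _ bM] := test_bounded tw.
have mphi : measurable_fun setT (phi : T -> R).
  by apply: continuous_measurable_fun2; exact: test_continuous tw.
have h0 n : 0 <= (0 : R) <= h_ n by rewrite lexx ltW // (margin_gt0 m).
have offV (n : nat) x : ~ V x -> phi x = 0 by exact: (margin_off m).
have cphi x : phi x @[n --> \oo] --> phi x by exact: cvg_cst.
have [Lp [Lpn cp]] := @dq_cvg w V phi h_ i i f f' (fun=> 0) (fun=> phi) phi M
  ow bw m Lf Lf' wf h0 (fun=> mphi) (fun=> bM) cphi offV.
have [Lq [Lqn cq]] := @dq_cvg w V phi h_ i i g g' (fun=> 0) (fun=> phi) phi M
  ow bw m Lg Lg' wg h0 (fun=> mphi) (fun=> bM) cphi offV.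
have cF := cvgL2_shift i (fun=> LF) LF (cvgL2_cst _) (fun n => ltW (margin_gt0 m n)) (margin_cvg m).
have c1 := cvgL2_mul Lpn (fun=> LG) Lp LG cp (cvgL2_cst _).
have c2 := cvgL2_mul (fun n => L2T_shift i (h_ n) LF) Lqn LF Lq cF cq.
have := dq_parts_cvg (i := i) tw m iFG.
rewrite (_ : (fun n => _) = (fun n =>
  \int[leb2]_x (dq i (h_ n) (f \_ w) (shift2 i 0 x) * phi x * (g \_ w) x) +
  \int[leb2]_x ((f \_ w) (shift2 i (h_ n) x) * (dq i (h_ n) (g \_ w) (shift2 i 0 x) * phi x)))); last first.
  apply/funext => n; rewrite -RintegralD //; [|exact: integrable_mulL2|].
    by apply: eq_Rintegral => x _; rewrite shift2_0 /dq; ring.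
  by apply: integrable_mulL2 => //; exact: L2T_shift.
move/(cvg_unique _ (cvgD c1 c2)) => /(_ (@Rhausdorff R)) E.
rewrite (Rintegral_patch w (fun x => f x * g x)) patchM.
rewrite (Rintegral_patch w (fun x => f' x * g x + f x * g' x)).
apply: oppr_inj; rewrite opprK -E -RintegralD //; [|exact: integrable_mulL2..].
apply: eq_Rintegral => x _; rewrite !patchE; case: ifP => _; first by ring.
by rewrite (_ : point = 0 :> R) // !mul0r addr0.
Qed.

(* Both sides are limits of the integral of
   D_i(f D_j g) - D_j(f D_i g) = D_i f (D_j g)(. - h e_i) - D_j f (D_i g)(. - h e_j)
   against [phi], with difference quotients D_i, D_j of step h. *)
Lemma weak_jacobian w i j f fi fj g gi gj phi : open w -> bounded_set w ->
  L2 w f -> L2 w fi -> L2 w fj -> L2 w g -> L2 w gi -> L2 w gj ->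
  is_weak_partial w i f fi -> is_weak_partial w j f fj ->
  is_weak_partial w i g gi -> is_weak_partial w j g gj ->
  test_function w phi ->
  \int[leb2]_(x in w) ((fi x * gj x - fj x * gi x) * phi x) =
  - \int[leb2]_(x in w) (f x * (gj x * pderiv i phi x - gi x * pderiv j phi x)).
Proof.
move=> ow bw Lf Lfi Lfj Lg Lgi Lgj wfi wfj wgi wgj tw.
have [V [h_ m]] := test_margin ow tw; have [M _ bM] := test_bounded tw.
have mphi : measurable_fun setT (phi : T -> R).
  by apply: continuous_measurable_fun2; exact: test_continuous tw.
have LF := L2T_patch ow Lf; have LG := L2T_patch ow Lg.
have LFi := L2T_patch ow Lfi; have LFj := L2T_patch ow Lfj.
have LGi := L2T_patch ow Lgi; have LGj := L2T_patch ow Lgj.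
have h0 n := ltW (margin_gt0 m n).
have s0 n : 0 <= (0 : R) <= h_ n by rewrite lexx h0.
have sh n : 0 <= h_ n <= h_ n by rewrite lexx h0.
have offV (n : nat) x : ~ V x -> phi x = 0 by exact: (margin_off m).
have cphi x : phi x @[n --> \oo] --> phi x by exact: cvg_cst.
have mV : measurable (V : set T) by apply: open_measurable2; exact: margin_open m.
have bI x : `|ind V x| <= 1.
  by rewrite /ind indicE; case: (x \in V); rewrite ?normr1 ?normr0.
have cI x : ind V x @[n --> \oo] --> ind V x by exact: cvg_cst.
have mI : measurable_fun setT (ind V) by exact: measurable_indic.
have offI (n : nat) x : ~ V x -> ind V x = 0 by move=> ?; rewrite /ind indicE memNset.
have offd k n x : ~ V x -> fdq k (h_ n) phi x = 0 by exact: (fdq_off _ _ m).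
have cd k x : fdq k (h_ n) phi x @[n --> \oo] --> pderiv k phi x.
  by apply: fdq_cvg (margin_gt0 m) (margin_cvg m); exact: test_differentiable tw x.
have md k n : measurable_fun setT (fdq k (h_ n) phi) by exact: measurable_fdq.
have [Mi _ bMi] := test_pderiv_bounded i tw.
have [Mj _ bMj] := test_pderiv_bounded j tw.
have bdi n x : `|fdq i (h_ n) phi x| <= Mi.
  by apply: fdq_bound (margin_gt0 m n) _ bMi; exact: test_differentiable tw.
have bdj n x : `|fdq j (h_ n) phi x| <= Mj.
  by apply: fdq_bound (margin_gt0 m n) _ bMj; exact: test_differentiable tw.
have [A1 [A2 A3]] := dq_cvg i ow bw m Lg Lgj wgj s0 (md i) bdi (cd i) (offd i).
have [B1 [B2 B3]] := dq_cvg i ow bw m Lg Lgi wgi s0 (md j) bdj (cd j) (offd j).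
have [C1 [C2 C3]] := dq_cvg i ow bw m Lf Lfi wfi s0 (fun=> mphi) (fun=> bM) cphi offV.
have [D1 [D2 D3]] := dq_cvg i ow bw m Lf Lfj wfj s0 (fun=> mphi) (fun=> bM) cphi offV.
(* In these products [phi] already multiplies the quotient of [f]; the translated quotient of [g] is
   localised by the indicator of [V], which is 1 wherever [phi] is nonzero. *)
have [P1 [P2 P3]] := dq_cvg i ow bw m Lg Lgj wgj sh (fun=> mI) (fun=> bI) cI offI.
have [Q1 [Q2 Q3]] := dq_cvg j ow bw m Lg Lgi wgi sh (fun=> mI) (fun=> bI) cI offI.
have cA := cvgL2_mul (fun=> LF) A2 LF A1 (cvgL2_cst _) A3.
have cB := cvgL2_mul (fun=> LF) B2 LF B1 (cvgL2_cst _) B3.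
have cC := cvgL2_mul C2 P2 C1 P1 C3 P3.
have cD := cvgL2_mul D2 Q2 D1 Q1 D3 Q3.
have := cvgB cC cD.
set a_ := (X in X @ _ --> _).
have -> : a_ = (fun n =>
  - (\int[leb2]_x ((f \_ w) x * (dq j (h_ n) (g \_ w) (shift2 i 0 x) * fdq i (h_ n) phi x)) -
    \int[leb2]_x ((f \_ w) x * (dq i (h_ n) (g \_ w) (shift2 i 0 x) * fdq j (h_ n) phi x)))).
  apply/funext => n; rewrite /a_ fctE /=.
  have LDi := L2T_dq i (h_ n) LG; have LDj := L2T_dq j (h_ n) LG.
  have IJ := integrable_mulL2 LF LDj; have II := integrable_mulL2 LF LDi.
  have E1 := dq_parts i (h_ n) IJ mphi bM; have E2 := dq_parts j (h_ n) II mphi bM.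
  have S1 : \int[leb2]_x ((f \_ w) x * (dq j (h_ n) (g \_ w) (shift2 i 0 x) * fdq i (h_ n) phi x)) =
      \int[leb2]_x ((f \_ w) x * dq j (h_ n) (g \_ w) x * fdq i (h_ n) phi x).
    by apply: eq_Rintegral => x _; rewrite shift2_0 mulrA.
  have S2 : \int[leb2]_x ((f \_ w) x * (dq i (h_ n) (g \_ w) (shift2 i 0 x) * fdq j (h_ n) phi x)) =
      \int[leb2]_x ((f \_ w) x * dq i (h_ n) (g \_ w) x * fdq j (h_ n) phi x).
    by apply: eq_Rintegral => x _; rewrite shift2_0 mulrA.
  rewrite S1 S2 opprB [RHS]addrC -E1 -[X in _ = _ + X]opprK -E2.
  have L1 k u : leb2.-integrable setT (EFin \o u) ->
      leb2.-integrable setT (EFin \o (fun x => dq k (h_ n) u x * phi x)).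
    move=> iu; apply: (integrable_mul_bounded _ mphi bM).
    have := integrableB measurableT iu (integrable_shift2 k (h_ n) iu).
    by move=> /(integrableZl measurableT (h_ n)^-1).
  rewrite -RintegralB //; [|exact: integrable_mulL2..].
  rewrite -RintegralB //; [|exact: L1..].
  apply: eq_Rintegral => x _; rewrite !shift2_0.
  have [xV|xV] := pselect (V x); last by rewrite (margin_off m xV) !mulr0 !mul0r.
  (* The two translations commute, so the second-order quotients of [g] cancel: no second derivative
     of [g] enters. *)
  rewrite /ind indicE mem_set // !mulr1 /dq (shift2C j i (h_ n) (h_ n) x).
  by ring.
move=> /(_ _) cE; have E := cvg_unique (@Rhausdorff R) cE (cvgN (cvgB cA cB)).
rewrite (Rintegral_patch w (fun x => fi x * gj x - fj x * gi x)).
have -> : \int[leb2]_(x in w) (f x * (gj x * pderiv i phi x - gi x * pderiv j phi x)) =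
    \int[leb2]_x ((f \_ w) x * ((gj \_ w) x * pderiv i phi x)) -
    \int[leb2]_x ((f \_ w) x * ((gi \_ w) x * pderiv j phi x)).
  rewrite (Rintegral_patch w f) -RintegralB //; [|exact: integrable_mulL2..].
  apply: eq_Rintegral => x _; rewrite !patchE; case: ifP => _; first by ring.
  by rewrite (_ : point = 0 :> R) // !mul0r subrr.
rewrite -E -RintegralB //; [|exact: integrable_mulL2..].
apply: eq_Rintegral => x _; rewrite /ind indicE.
have [xV|xV] := pselect (V x); last by rewrite (margin_off m xV) !mulr0 !mul0r subrr.
rewrite mem_set // !mulr1 !patchE; case: ifP => _; first by ring.
by rewrite (_ : point = 0 :> R) // !mul0r subrr.
Qed.

Lemma integrable_cst2 (A : set T) (c : R) : measurable A -> (leb2 A < +oo)%E ->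
  leb2.-integrable A (EFin \o cst c).
Proof.
move=> mA fA; apply/integrableP; split.
  by apply/measurable_EFinP; exact: measurable_cst.
have := integral_cst leb2 mA `|c%:E|%E => ->.
by rewrite lte_mul_pinfty //= lee_fin.
Qed.

Lemma cont_integrable (A : set T) (f : R * R -> R) : measurable A ->
  bounded_set (A : set (R * R)) -> continuous f -> leb2.-integrable A (EFin \o f).
Proof.
move=> mA bA cf; have [n An] := bounded_sub_bigbox bA.
have K := @compact_cbox R (- n%:R, - n%:R) (n%:R, n%:R).
have /compact_bounded[M [_ bM]] := continuous_compact (continuous_subspaceT cf) K.
apply: (@integrable_dominated _ T R leb2 A mA _ (cst (`|M| + 1))).
- exact: continuous_measurable_fun2.
- move=> x Ax; apply: (bM (`|M| + 1)); first by rewrite ltr_pwDr // ler_norm.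
  exists x => //; have /boxE[? ? ? ?] := An _ Ax.
  by apply/cboxE; split=> //; exact: ltW.
- exact: integrable_cst2 (bounded_leb2 mA bA).
Qed.

Lemma cont_L1loc w (f : R * R -> R) : continuous f -> L1loc w f.
Proof.
move=> cf; split; first exact: continuous_measurable_fun2.
move=> K cK _; apply: cont_integrable => //; first exact: compact_measurable2.
exact: compact_bounded.
Qed.

Lemma cont_L2 w (f : R * R -> R) : open w -> bounded_set w -> continuous f -> L2 w f.
Proof.
move=> ow bw cf; split; first exact: continuous_measurable_fun2.
apply: cont_integrable => //; first exact: open_measurable2.
by move=> x; apply: cvgM; exact: cf.
Qed.

Lemma pderivM i (f g : R * R -> R) x : differentiable f x -> differentiable g x ->
  pderiv i (fun z => f z * g z) x = pderiv i f x * g x + f x * pderiv i g x.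
Proof.
move=> df dg; rewrite /pderiv.
have := deriveM (@diff_derivable _ _ _ _ _ (basis2 i) df) (@diff_derivable _ _ _ _ _ (basis2 i) dg).
rewrite (_ : f * g = fun z => f z * g z) // => ->.
by rewrite addrC; congr (_ + _); rewrite mulrC.
Qed.

(* The difference quotients of [f * phi] have integral 0. *)
Lemma C1_weak_partial w i (f : R * R -> R) : open w -> bounded_set w ->
  (forall x, differentiable f x) -> continuous (pderiv i f) ->
  is_weak_partial w i f (pderiv i f).
Proof.
move=> ow bw df cdf; have mw := open_measurable2 ow.
have cf : continuous f by move=> x; exact: differentiable_continuous.
have l1 := cont_L1loc w cf; have l2 := cont_L1loc w cdf.
split=> // phi tw.
have [V [h_ m]] := test_margin ow tw; have h0 := margin_gt0 m.
have Vw : V `<=` w.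
  move=> x Vx; have := margin_in m i i Vx (n := 0%N) (s := 0) (t := 0).
  by rewrite !shift2_0; apply; rewrite lexx ltW.
pose F (x : R * R) := f x * phi x.
have dphi := test_differentiable tw; have cphi := test_continuous tw.
have cdphi := test_pderiv_continuous (i := i) tw.
have dF x : differentiable F x by exact: differentiableM.
have DF x : pderiv i F x = pderiv i f x * phi x + f x * pderiv i phi x by exact: pderivM.
have cF : continuous F by move=> x; exact: differentiable_continuous.
have cDF : continuous (pderiv i F).
  rewrite (_ : pderiv i F = fun x => pderiv i f x * phi x + f x * pderiv i phi x).
    move=> x; exact: (cvgD (cvgM (cdf x) (cphi x)) (cvgM (cf x) (cdphi x))).
  exact/funext.
have [_ cK _] := tw.
have F0 x : ~ csupp phi x -> F x = 0 by move=> xK; rewrite /F (csupp_off xK) mulr0.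
have [M' M'0 bF] := continuous_compact_bounded cF cK F0.
have DF0 := @pderiv_off _ (csupp phi) i F (@closed_closure _ _) F0.
have [M M0 bDF] := continuous_compact_bounded cDF cK DF0.
have FV x : ~ V x -> F x = 0 by move=> xV; rewrite /F (margin_off m xV) mulr0.
have LI := L2T_ind mw (bounded_leb2 mw bw).
have iI (c : R) := integrableZl measurableT c (integrable_mulL2 LI LI).
have iF : leb2.-integrable setT (EFin \o F).
  apply: (@integrable_dominated _ T R leb2 setT measurableT _ (fun x => M' * (ind w x * ind w x))).
  - exact: continuous_measurable_fun2.
  - move=> x _; rewrite /ind indicE; have [xw|xw] := pselect (w x).
      by rewrite mem_set // !mulr1.
    by rewrite FV ?normr0 ?mulr_ge0 // => /Vw.
  - exact: iI.
have mF : measurable_fun setT (F : T -> R) by exact: continuous_measurable_fun2.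
have [] := @Rintegral_dominated_cvg _ T R leb2 setT measurableT
  (fun n x => fdq i (h_ n) F x) (pderiv i F) (fun x => M * (ind w x * ind w x)).
- by move=> n; exact: measurable_fdq.
- by move=> x _; exact: fdq_cvg h0 (margin_cvg m).
- exact: iI.
- move=> n x _; rewrite /ind indicE; have [xw|xw] := pselect (w x).
    by rewrite mem_set // !mulr1; exact: fdq_bound.
  have xV : ~ V x by move=> /Vw.
  rewrite /fdq /F (margin_off m xV) (margin_shift_off m _ _ xV) !mulr0 subrr mulr0 normr0.
  by rewrite !mulr_ge0.
move=> _; rewrite (_ : (fun n => _) = fun=> 0); last first.
  apply/funext => n; have iS := integrable_shift2 i (- h_ n) iF.
  rewrite /fdq RintegralZl //; last by have := integrableB measurableT iS iF.
  by rewrite RintegralB // Rintegral_shift2 // subrr mulr0.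
move=> c0; have E : 0 = \int[leb2]_x (pderiv i F x).
  rewrite -(cvg_lim (@Rhausdorff R) c0); apply/esym.
  by apply: cvg_lim => //; exact: cvg_cst.
have E' : \int[leb2]_x (pderiv i F x) =
    \int[leb2]_(x in w) (pderiv i f x * phi x + f x * pderiv i phi x).
  rewrite [RHS]Rintegral_mkcond; apply: eq_Rintegral => x _; rewrite patchE DF.
  case: ifPn => //; rewrite notin_setE => xw.
  by rewrite (test_off tw xw) (test_pderiv_off _ tw xw) !mulr0 addr0.
move: E; rewrite E' RintegralD //; last 2 first.
- exact: integrable_mul_test.
- exact: integrable_mul_pderiv.
by move=> /eqP; rewrite eq_sym addr_eq0 => /eqP ->; rewrite opprK.
Qed.

Lemma smooth_pderiv i (f : R * R -> R) : smooth f -> smooth (pderiv i f).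
Proof. by move=> sf s x; have := sf (rcons s i) x; rewrite foldr_rcons. Qed.

Lemma smooth_weak_partial w i (f : R * R -> R) : open w -> bounded_set w ->
  smooth f -> is_weak_partial w i f (pderiv i f).
Proof.
move=> ow bw sf; apply: C1_weak_partial => //; first exact: (sf [::]).
by move=> x; apply: differentiable_continuous; exact: (sf [:: i]).
Qed.

Lemma smooth_sobolev2 k w (f : R * R -> R) : open w -> bounded_set w ->
  smooth f -> sobolev2 k w f.
Proof.
move=> ow bw; elim: k f => [|k ih] f sf.
  split=> //; apply: cont_L2 => // x.
  by apply: differentiable_continuous; exact: (sf [::]).
split; first by apply: cont_L2 => // x; apply: differentiable_continuous; exact: (sf [::]).
move=> i; exists (pderiv i f); split; first exact: smooth_weak_partial.
by apply: ih; exact: smooth_pderiv.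
Qed.

End SobolevProducts.

(** * Linearity, representatives and symmetry of weak derivatives *)

Section WeakCalculus.
Context {R : realType}.
Local Notation T1 := (measurableTypeR R).
Local Notation T := (T1 * T1)%type.
Implicit Types (w : set (R * R)) (f g : R * R -> R) (i j : 'I_2).

Lemma ae_onW w (P : R * R -> Prop) : (forall x, w x -> P x) -> ae_on w P.
Proof. by move=> H; apply: aeW. Qed.

Lemma ae_onS w (P Q : R * R -> Prop) : (forall x, w x -> P x -> Q x) ->
  ae_on w P -> ae_on w Q.
Proof. by move=> PQ; apply: ae_leb2S => x Px wx; apply: PQ => //; exact: Px. Qed.

Lemma ae_onS2 w (P Q S : R * R -> Prop) : (forall x, w x -> P x -> Q x -> S x) ->
  ae_on w P -> ae_on w Q -> ae_on w S.
Proof.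
move=> PQ; apply: ae_leb2S2 => x Px Qx wx.
by apply: PQ => //; [exact: Px|exact: Qx].
Qed.

Lemma ae_on_forall (I : finType) w (P : I -> R * R -> Prop) :
  (forall k, ae_on w (P k)) -> ae_on w (fun x => forall k, P k x).
Proof.
move=> H; have := @filter_forall T I (fun k x => w x -> P k x) _
  (ae_filter_ringOfSetsType leb2) H.
by apply: ae_leb2S => x Hx wx k; exact: Hx.
Qed.

Lemma mfun_onD w f g : mfun_on w f -> mfun_on w g -> mfun_on w (fun x => f x + g x).
Proof. by move=> mf mg; exact: measurable_funD. Qed.

Lemma mfun_onM w f g : mfun_on w f -> mfun_on w g -> mfun_on w (fun x => f x * g x).
Proof. by move=> mf mg; exact: measurable_funM. Qed.

Lemma mfun_onB w f g : mfun_on w f -> mfun_on w g -> mfun_on w (fun x => f x - g x).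
Proof. by move=> mf mg; exact: measurable_funB. Qed.

Lemma L1loc_lin w (a b : R) f g : L1loc w f -> L1loc w g ->
  L1loc w (fun x => a * f x + b * g x).
Proof.
move=> [mf lf] [mg lg]; split.
  by apply: mfun_onD; apply: measurable_funM => //; exact: measurable_cst.
move=> K cK Kw; have mK := compact_measurable2 cK.
have := integrableD mK (integrableZl mK a (lf K cK Kw)) (integrableZl mK b (lg K cK Kw)).
by congr (_.-integrable _ _).
Qed.

Lemma weak_partial_lin w i (a b : R) f g f' g' : open w ->
  is_weak_partial w i f f' -> is_weak_partial w i g g' ->
  is_weak_partial w i (fun x => a * f x + b * g x) (fun x => a * f' x + b * g' x).
Proof.
move=> ow [lf lf' Hf] [lg lg' Hg]; have mw := open_measurable2 ow.
split; [exact: L1loc_lin|exact: L1loc_lin|] => phi tw.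
have lin (u v psi : T -> R) :
    leb2.-integrable (w : set T) (EFin \o (fun x => u x * psi x)) ->
    leb2.-integrable (w : set T) (EFin \o (fun x => v x * psi x)) ->
    \int[leb2]_(x in w) ((a * u x + b * v x) * psi x) =
    a * \int[leb2]_(x in w) (u x * psi x) + b * \int[leb2]_(x in w) (v x * psi x).
  move=> iu iv; rewrite -!RintegralZl // -RintegralD //.
  - by apply: eq_Rintegral => x _; ring.
  - by have := integrableZl mw a iu.
  - by have := integrableZl mw b iv.
rewrite lin; [|exact: integrable_mul_pderiv..].
rewrite lin; [|exact: integrable_mul_test..].
by rewrite Hf // Hg //; ring.
Qed.

Lemma pderiv_cst i (c : R) : pderiv i (cst c) = cst 0.
Proof. by apply/funext => x; rewrite /pderiv derive_cst. Qed.

Lemma weak_partial_cst w i (c : R) : open w -> bounded_set w ->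
  is_weak_partial w i (cst c) (cst 0).
Proof.
move=> ow bw; rewrite -(pderiv_cst i c); apply: C1_weak_partial => //.
by rewrite pderiv_cst => x; exact: cst_continuous.
Qed.

Lemma weak_partial_sum (I : Type) (r : seq I) w i (f f' : I -> R * R -> R) :
  open w -> bounded_set w -> (forall k, is_weak_partial w i (f k) (f' k)) ->
  is_weak_partial w i (fun x => \sum_(k <- r) f k x) (fun x => \sum_(k <- r) f' k x).
Proof.
move=> ow bw H; elim: r => [|k r ih].
  under [X in is_weak_partial _ _ X]eq_fun do rewrite big_nil.
  under [X in is_weak_partial _ _ _ X]eq_fun do rewrite big_nil.
  exact: weak_partial_cst.
have := weak_partial_lin 1 1 ow (H k) ih.
by congr is_weak_partial; apply/funext => x; rewrite big_cons !mul1r.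
Qed.

Lemma L2_ae w f g : open w -> L2 w f -> mfun_on w g -> ae_on w (fun x => f x = g x) ->
  L2 w g.
Proof.
move=> ow [mf /integrableP[mf2 i2]] mg e; have mw := open_measurable2 ow; split=> //.
have mg2 : measurable_fun (w : set T) (EFin \o (fun x => g x ^+ 2)).
  by apply/measurable_EFinP; exact: measurable_funX.
apply/integrableP; split=> //; apply: le_lt_trans i2.
rewrite le_eqVlt; apply/orP; left; apply/eqP; apply: ae_eq_integral => //.
- exact: measurableT_comp.
- exact: measurableT_comp.
- by apply: ae_leb2S e => x E wx /=; rewrite E.
Qed.

Lemma sobolev2_ae k w f g : open w -> sobolev2 k w f -> mfun_on w g ->
  ae_on w (fun x => f x = g x) -> sobolev2 k w g.
Proof.
move=> ow; case: k => [|k] [Lf H] mg e; split; try exact: L2_ae Lf mg e; first by [].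
move=> i; have [f' [wf sf]] := H i; exists f'; split=> //.
by have [_ [mf' _] _] := wf; apply: (is_weak_partial_ae ow wf) => //; exact: ae_onW.
Qed.

(** [sobolev2] provides some weak derivative of lower Sobolev order; the order passes to the chosen
    representative, so that [weak_partial] can be iterated. *)
Lemma sobolev2_weak_partial k w i f : open w -> sobolev2 k.+1 w f ->
  is_weak_partial w i f (weak_partial w i f) /\ sobolev2 k w (weak_partial w i f).
Proof.
move=> ow [_ /(_ i)[g [wfg sg]]]; have [wf e] := weak_partialP ow wfg; split=> //.
have [_ [mD _] _] := wf; apply: (sobolev2_ae ow sg mD).
by apply: ae_onS e.
Qed.

Lemma sobolev2_L2 k w f : sobolev2 k w f -> L2 w f.
Proof. by case: k => [|k] []. Qed.

Lemma test_pderiv w j phi : test_function w phi -> test_function w (pderiv j phi).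
Proof.
move=> [sp cK Kw].
have S : closure [set x | pderiv j phi x != 0] `<=` csupp phi.
  rewrite [X in _ `<=` X]((closure_id (csupp phi)).1 (@closed_closure _ _)).
  apply: closure_subset.
  move=> x /= /eqP; apply: contra_notP => xK.
  by apply: (@pderiv_off _ (csupp phi)) => //; [exact: closed_closure|exact: csupp_off].
split; first exact: smooth_pderiv.
  by apply: (subclosed_compact _ cK) => //; exact: closed_closure.
by move=> x /S/Kw.
Qed.

(** For tensor products the symmetry of second derivatives is immediate: the two derivatives act on
    different factors or are the same operation. *)
Lemma pderiv_tensC i j (a b : R -> R) : smooth1 a -> smooth1 b ->
  pderiv i (pderiv j (tens a b)) = pderiv j (pderiv i (tens a b)).
Proof.
move=> sa sb; have da := smooth1_derivable sa; have db := smooth1_derivable sb.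
have da' := smooth1_derivable (smooth1_derive1 sa).
have db' := smooth1_derivable (smooth1_derive1 sb).
have E k : pderiv k (tens a b) = if k == ord0 then tens (derive1 a) b else tens a (derive1 b).
  by apply/funext => x; rewrite pderiv_tens //; case: (k == ord0).
rewrite !E; case: ifPn => [/eqP ->|j0]; case: ifPn => [/eqP ->|i0].
- reflexivity.
- by apply/funext => x; rewrite !pderiv_tens // eqxx (negbTE i0).
- by apply/funext => x; rewrite !pderiv_tens // eqxx (negbTE j0).
- by apply/funext => x; rewrite !pderiv_tens // (negbTE i0) (negbTE j0).
Qed.

(** Both derivatives are moved to the test function, where the order does not matter by
    [pderiv_tensC]. *)
Lemma weak_partialC w i j f fi fj fij fji : open w ->
  is_weak_partial w i f fi -> is_weak_partial w j f fj ->
  is_weak_partial w j fi fij -> is_weak_partial w i fj fji ->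
  ae_on w (fun x => fij x = fji x).
Proof.
move=> ow [_ _ Hi] [_ _ Hj] [_ lij Hij] [_ lji Hji]; have mw := open_measurable2 ow.
have : ae_on w (fun x => (fij \- fji) x = 0).
  apply: fundamental_lemma => //; first exact: L1locB.
  move=> n p q pq; set phi := tbump n p q.
  have tw : test_function w phi by exact: tbump_test.
  have C : pderiv i (pderiv j phi) = pderiv j (pderiv i phi).
    by apply: pderiv_tensC; exact: smooth1_bump.
  have E1 := Hij _ tw; have H1 := Hi _ (test_pderiv j tw).
  have E2 := Hji _ tw; have H2 := Hj _ (test_pderiv i tw).
  rewrite -C in H2.
  have E := oppr_inj (etrans (esym E1) (etrans (oppr_inj (etrans (esym H1) H2)) E2)).
  transitivity (\int[leb2]_(x in w) (fij x * phi x - fji x * phi x)).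
    by apply: eq_Rintegral => x _ /=; ring.
  have I1 := integrable_mul_test ow lij tw; have I2 := integrable_mul_test ow lji tw.
  by rewrite (RintegralB mw I1 I2) E subrr.
by apply: ae_onS => x _ /= /eqP; rewrite subr_eq0 => /eqP.
Qed.

End WeakCalculus.

Lemma ord2P (i : 'I_2) : i = ord0 \/ i = ord_max.
Proof. by case: i => -[|[|//]] ?; [left|right]; apply/val_inj. Qed.

(** * Vector algebra in three dimensions *)

Section CrossProduct.
Context {R : realFieldType}.
Implicit Types u v a b : 'I_3 -> R.

Definition cross u v (k : 'I_3) : R := u (k + 1) * v (k + 2%:R) - u (k + 2%:R) * v (k + 1).

Definition dot u v : R := \sum_k u k * v k.

Lemma addI3 : (0 + 1 = 1 :> 'I_3) * (0 + 2%:R = 2%:R :> 'I_3) *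
  (1 + 1 = 2%:R :> 'I_3) * (1 + 2%:R = 0 :> 'I_3) *
  (2%:R + 1 = 0 :> 'I_3) * (2%:R + 2%:R = 1 :> 'I_3).
Proof. by do !split; apply/val_inj. Qed.

Lemma sum3 (F : 'I_3 -> R) : \sum_k F k = F 0 + F 1 + F 2%:R.
Proof.
rewrite !big_ord_recl big_ord0 addr0 addrA.
by congr (F _ + F _ + F _); apply/val_inj.
Qed.

Lemma dotC u v : dot u v = dot v u.
Proof. by apply: eq_bigr => k _; rewrite mulrC. Qed.

Lemma dot_ge0 u : 0 <= dot u u.
Proof. by apply: sumr_ge0 => k _; rewrite -expr2 sqr_ge0. Qed.

Lemma le_double_sum (I J : finType) (F : I -> J -> R) i j :
  (forall i j, 0 <= F i j) -> F i j <= \sum_i \sum_j F i j.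
Proof.
move=> F0; rewrite (bigD1 i) //= (bigD1 j) //= -addrA lerDl addr_ge0 //.
  exact: sumr_ge0.
by apply: sumr_ge0 => i' _; exact: sumr_ge0.
Qed.

Lemma sum_dotB_eq0 u a b (s t : R) : dot a u = 0 -> dot b u = 0 ->
  \sum_k u k * (a k * s - b k * t) = 0.
Proof.
move=> au bu; transitivity (dot a u * s - dot b u * t); last by rewrite au bu !mul0r subrr.
by rewrite /dot !mulr_suml -sumrB; apply: eq_bigr => k _; ring.
Qed.

(** The left-hand side has the shape that [weak_partial_lin] with coefficients 1 and -1 gives for a
    component of the derivative of a cross product. *)
Lemma cross_leibniz u v a b k :
  1 * (a (k + 1) * v (k + 2%:R) + u (k + 1) * b (k + 2%:R)) +
  (-1) * (a (k + 2%:R) * v (k + 1) + u (k + 2%:R) * b (k + 1)) =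
  cross a v k + cross u b k.
Proof. by rewrite /cross; ring. Qed.

(** The triple product u . (a x v) is - a . (u x v), and u . (u x b) vanishes. *)
Lemma dot_cross_derivl u v a b :
  dot u (fun k => cross a v k + cross u b k) = - dot a (cross u v).
Proof. by rewrite /dot /cross !sum3 !addI3; ring. Qed.

Lemma dot_cross_derivr u v a b :
  dot v (fun k => cross a v k + cross u b k) = - dot b (cross u v).
Proof. by rewrite /dot /cross !sum3 !addI3; ring. Qed.

(* The product of two triple products is a Gram determinant. *)
Lemma dot_normal u v a b : dot u u = 1 -> dot u v = 0 -> dot v v = 1 ->
  dot a u = 0 -> dot a v = 0 -> dot b u = 0 -> dot b v = 0 ->
  dot a (cross u v) * dot b (cross u v) = dot a b.
Proof.
move=> uu uv vv au av bu bv.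
transitivity (dot a b * (dot u u * dot v v - dot u v ^+ 2)
  - dot a u * (dot b u * dot v v - dot u v * dot b v)
  + dot a v * (dot b u * dot u v - dot u u * dot b v)).
  by rewrite /dot /cross !sum3 !addI3; ring.
by rewrite uu uv vv au av bu bv; ring.
Qed.

(* Applying the two symmetries alternately comes back to the same term with sign -1. *)
Lemma christoffel_eq0 (I : Type) (D : I -> 'I_3 -> R) (S : I -> I -> 'I_3 -> R) :
  (forall i l j, dot (S i j) (D l) + dot (D i) (S l j) = 0) ->
  (forall i j, S i j = S j i) -> forall i j l, dot (S i j) (D l) = 0.
Proof.
move=> A B i j l.
have P i' j' l' : dot (S i' j') (D l') = - dot (S l' j') (D i').
  by rewrite (dotC (S l' j')) -(addr0_eq (A i' l' j')) opprK.
have : dot (S i j) (D l) = - dot (S i j) (D l).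
  by rewrite {1}P (B l j) P opprK (B i l) P (B j i).
lra.
Qed.

End CrossProduct.

Lemma integrable_bigsum d (U : measurableType d) (R : realType)
    (m : {measure set U -> \bar R}) (D : set U) (I : Type) (r : seq I) (F : I -> U -> R) :
  measurable D -> (forall k, m.-integrable D (EFin \o F k)) ->
  m.-integrable D (EFin \o (fun x => \sum_(k <- r) F k x)).
Proof.
move=> mD iF; rewrite (_ : EFin \o _ = fun x => (\sum_(k <- r) (F k x)%:E)%E).
  by apply: integrable_sum => // l _; exact: iF.
by apply/funext => x /=; rewrite sumEFin.
Qed.

Lemma Rintegral_sum d (U : measurableType d) (R : realType)
    (m : {measure set U -> \bar R}) (D : set U) (I : Type) (r : seq I) (F : I -> U -> R) :
  measurable D -> (forall k, m.-integrable D (EFin \o F k)) ->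
  \int[m]_(x in D) (\sum_(k <- r) F k x) = \sum_(k <- r) \int[m]_(x in D) F k x.
Proof.
move=> mD iF; elim: r => [|k r ih].
  rewrite big_nil; under eq_Rintegral do rewrite big_nil.
  by rewrite Rintegral_cst // mul0r.
rewrite big_cons -ih -RintegralD //; last exact: integrable_bigsum.
by apply: eq_Rintegral => x _; rewrite big_cons.
Qed.

Lemma Rintegral_ae_eq0 (R : realType) (w : set (R * R)) (f : R * R -> R) : open w ->
  mfun_on w f -> ae_on w (fun x => f x = 0) -> \int[leb2]_(x in w) f x = 0.
Proof.
move=> ow mf f0; have mw := open_measurable2 ow.
rewrite -(mul0r (fine (leb2 w))) -Rintegral_cst //; congr fine.
apply: ae_eq_integral => //; first exact/measurable_EFinP.
by apply: ae_leb2S f0 => x H wx; rewrite H.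
Qed.

(** * Gauss' equation for isometric immersions of class W^{2,2} *)

Section Isometry.
Context {R : realType}.
Local Notation T1 := (measurableTypeR R).
Local Notation T := (T1 * T1)%type.
Variables (w : set (R * R)) (y : R * R -> 'cV[R]_3).
Hypotheses (ow : open w) (bw : bounded_set w) (yA : A_iso w y).
Implicit Types (i j l : 'I_2) (k : 'I_3) (x : R * R).

Let D i x k := weak_partial w i (fun z => y z k ord0) x.
Let S i j x k := weak_partial w j (fun z => D i z k) x.

Let DP i k : is_weak_partial w i (fun z => y z k ord0) (fun z => D i z k) /\
  sobolev2 1 w (fun z => D i z k).
Proof. by have [H _] := yA; exact: sobolev2_weak_partial (H k). Qed.

Let DL2 i k : L2 w (fun z => D i z k).
Proof. by have [_ /sobolev2_L2] := DP i k. Qed.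

Let SP i j k : is_weak_partial w j (fun z => D i z k) (fun z => S i j z k).
Proof. by have [_ s1] := DP i k; have [] := sobolev2_weak_partial j ow s1. Qed.

Let SL2 i j k : L2 w (fun z => S i j z k).
Proof.
by have [_ s1] := DP i k; have [_ /sobolev2_L2] := sobolev2_weak_partial j ow s1.
Qed.

Let iso : ae_on w (fun x => forall i j, dot (D i x) (D j x) = (i == j)%:R).
Proof.
have [_] := yA; apply: ae_onS => x _ /matrixP H i j; have := H i j.
rewrite !mxE => <-; apply: eq_bigr => k _; by rewrite !mxE.
Qed.

Let leibniz i l j : is_weak_partial w j (fun x => dot (D i x) (D l x))
  (fun x => dot (S i j x) (D l x) + dot (D i x) (S l j x)).
Proof.
rewrite (_ : (fun x => dot (S i j x) (D l x) + _) = fun x =>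
    \sum_k (S i j x k * D l x k + D i x k * S l j x k)).
  by apply: weak_partial_sum => // k; apply: weak_partialM.
by apply/funext => x; rewrite big_split.
Qed.

(** The dot product of two first derivatives is almost everywhere a constant, so its Leibniz
    derivative coincides with 0 by uniqueness of weak derivatives. *)
Let antisym i l j : ae_on w (fun x => dot (S i j x) (D l x) + dot (D i x) (S l j x) = 0).
Proof.
apply: (weak_partial_unique ow (leibniz i l j)).
have wc := weak_partial_cst j (i == l)%:R ow bw.
have [[m _] _ _] := leibniz i l j; have [_ [m0 _] _] := wc.
apply: (is_weak_partial_ae ow wc m m0); last exact: ae_onW.
by apply: ae_onS iso => x _ ->.
Qed.

Let sym i j : ae_on w (fun x => S i j x = S j i x).
Proof.
have : ae_on w (fun x => forall k, S i j x k = S j i x k).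
  apply: ae_on_forall => k.
  exact: (weak_partialC ow (DP i k).1 (DP j k).1 (SP i j k) (SP j i k)).
by apply: ae_onS => x _ H; apply/funext.
Qed.

Lemma tangential : ae_on w (fun x => forall i j l, dot (S i j x) (D l x) = 0).
Proof.
have A : ae_on w (fun x => forall i l j, dot (S i j x) (D l x) + dot (D i x) (S l j x) = 0).
  by do 3 (apply: ae_on_forall => ?); exact: antisym.
have B : ae_on w (fun x => forall i j, S i j x = S j i x).
  by do 2 (apply: ae_on_forall => ?); exact: sym.
apply: ae_onS2 A B => x _ A B i j l.
by apply: (@christoffel_eq0 R 'I_2 (fun i => D i x) (fun i j => S i j x)).
Qed.

(** The sum of these over [k] is the determinant of A_y, by [second_ff_prod] below. *)
Let J k x := S ord0 ord0 x k * S ord_max ord_max x k -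
             S ord0 ord_max x k * S ord_max ord0 x k.

Let J_integrable k : leb2.-integrable (w : set T) (EFin \o J k).
Proof.
have := integrableB (open_measurable2 ow)
  (integrable_L2M ow (SL2 ord0 ord0 k) (SL2 ord_max ord_max k))
  (integrable_L2M ow (SL2 ord0 ord_max k) (SL2 ord_max ord0 k)).
by congr (_.-integrable _ _).
Qed.

Lemma jacobian_eq0 : ae_on w (fun x => \sum_k J k x = 0).
Proof.
have mw := open_measurable2 ow.
have iS := integrable_bigsum (index_enum 'I_3) mw J_integrable.
apply: L1loc_ae_eq0 => //; first exact: integrable_L1loc.
move=> phi tw; have lJ k := integrable_L1loc ow (J_integrable k).
have I1 k := integrable_mul_test ow (lJ k) tw.
have E k := weak_jacobian ow bw (DL2 ord0 k) (SL2 ord0 ord0 k) (SL2 ord0 ord_max k)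
  (DL2 ord_max k) (SL2 ord_max ord0 k) (SL2 ord_max ord_max k)
  (SP ord0 ord0 k) (SP ord0 ord_max k) (SP ord_max ord0 k) (SP ord_max ord_max k) tw.
transitivity (\sum_k \int[leb2]_(x in w) (J k x * phi x)).
  by rewrite -Rintegral_sum //; apply: eq_Rintegral => x _; rewrite mulr_suml.
rewrite (eq_bigr _ (fun k _ => E k)) sumrN.
have L k i l : L1loc w (fun x => D ord0 x k * S i l x k).
  exact: integrable_L1loc (integrable_L2M ow (DL2 _ _) (SL2 _ _ _)).
have I2 k : leb2.-integrable (w : set T) (EFin \o (fun x => D ord0 x k *
    (S ord_max ord_max x k * pderiv ord0 phi x - S ord_max ord0 x k * pderiv ord_max phi x))).
  have := integrableB mw (integrable_mul_pderiv ord0 ow (L k ord_max ord_max) tw)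
    (integrable_mul_pderiv ord_max ow (L k ord_max ord0) tw).
  by congr (_.-integrable _ _); apply/funext => x /=; rewrite -EFinD mulrBr !mulrA.
rewrite -Rintegral_sum // Rintegral_ae_eq0 ?oppr0 //.
  have := integrable_bigsum (index_enum 'I_3) mw I2.
  by move/measurable_int/measurable_EFinP.
apply: ae_onS tangential => x _ H.
exact: (sum_dotB_eq0 _ _ (H ord_max ord_max ord0) (H ord_max ord0 ord0)).
Qed.

Let nu x := cross (D ord0 x) (D ord_max x).

Let dnu j x k := cross (S ord0 j x) (D ord_max x) k + cross (D ord0 x) (S ord_max j x) k.

Let nuE k x : normal_field w y x k ord0 = nu x k.
Proof. by rewrite !mxE. Qed.

(** Existence is the point: it ensures that the weak gradient of [normal_field] inside [second_ff]
    is [dnu] almost everywhere and not a default value. *)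
Let nuP j k : is_weak_partial w j (fun x => normal_field w y x k ord0) (fun x => dnu j x k).
Proof.
have H k1 k2 := weak_partialM ow bw (DL2 ord0 k1) (DL2 ord_max k2) (SL2 ord0 j k1)
  (SL2 ord_max j k2) (SP ord0 j k1) (SP ord_max j k2).
have := weak_partial_lin 1 (-1) ow (H (k + 1) (k + 2%:R)) (H (k + 2%:R) (k + 1)).
congr is_weak_partial; apply/funext => x; last exact: cross_leibniz.
by rewrite nuE /nu /cross mul1r mulN1r.
Qed.

Lemma mfun_on_second_ff i j : mfun_on w (fun x => second_ff w y x i j).
Proof.
rewrite (_ : (fun x => _) = fun x =>
    \sum_k D i x k * weak_partial w j (fun z => normal_field w y z k ord0) x).
  apply: measurable_sum => k; apply: mfun_onM; first by have [] := DL2 i k.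
  by have [[_ [m _] _] _] := weak_partialP ow (nuP j k).
by apply/funext => x; rewrite !mxE; apply: eq_bigr => k _; rewrite !mxE.
Qed.

Let second_ffE : ae_on w (fun x => forall i j, second_ff w y x i j = - dot (S i j x) (nu x)).
Proof.
have H : ae_on w (fun x => forall j k,
    weak_partial w j (fun z => normal_field w y z k ord0) x = dnu j x k).
  apply: ae_on_forall => j; apply: ae_on_forall => k.
  by have [_] := weak_partialP ow (nuP j k).
apply: ae_onS H => x _ H i j.
have -> : second_ff w y x i j = dot (D i x) (dnu j x).
  by rewrite !mxE; apply: eq_bigr => k _; rewrite !mxE H.
case: (ord2P i) => ->.
- exact: dot_cross_derivl.
- exact: dot_cross_derivr.
Qed.

(** Second derivatives of y are multiples of the unit normal, so their coefficients along it
    multiply to their dot products; the sign in [second_ffE] cancels. *)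
Let second_ff_prod : ae_on w (fun x => forall i j i' j',
  second_ff w y x i j * second_ff w y x i' j' = dot (S i j x) (S i' j' x)).
Proof.
apply: ae_onS2 second_ffE (ae_onS2 (fun x _ a b => conj a b) iso tangential).
move=> x _ H [I N] i j i' j'; rewrite !H mulrNN.
apply: dot_normal; try exact: N; exact: I.
Qed.

(* Gauss' equation *)
Lemma second_ff_flat : ae_on w (fun x =>
  second_ff w y x ord0 ord_max = second_ff w y x ord_max ord0 /\
  second_ff w y x ord0 ord0 * second_ff w y x ord_max ord_max =
    second_ff w y x ord0 ord_max ^+ 2).
Proof.
have H := ae_onS2 (fun x _ a b => conj a b) second_ffE (sym ord0 ord_max).
apply: ae_onS2 H (ae_onS2 (fun x _ a b => conj a b) second_ff_prod jacobian_eq0).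
move=> x _ [H Hs] [P]; rewrite sumrB => /subr0_eq J0.
have E : second_ff w y x ord0 ord_max = second_ff w y x ord_max ord0 by rewrite !H Hs.
split; first exact: E.
(* a_11 a_22 = d_11 y . d_22 y = d_12 y . d_21 y = a_12 a_21, the middle equality being the
   vanishing of the summed Jacobians. *)
apply: etrans (P _ _ _ _) (etrans J0 (etrans (esym (P _ _ _ _)) _)).
by rewrite -E expr2.
Qed.

(** The derivatives of the normal come out of the product rule merely integrable, but a_ij^2 = |d_ij
    y|^2, which is integrable. This is what makes the energy finite. *)
Lemma second_ff_bound : exists2 g : R * R -> R,
  leb2.-integrable (w : set T) (EFin \o g) &
  ae_on w (fun x => forall i j, second_ff w y x i j ^+ 2 <= g x).
Proof.
have mw := open_measurable2 ow.
exists (fun x => \sum_i \sum_j dot (S i j x) (S i j x)).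
  by do 3 (apply: integrable_bigsum => // ?); exact: integrable_L2M.
apply: ae_onS second_ff_prod => x _ P i j; rewrite expr2 P.
apply: (le_double_sum (F := fun i j => dot (S i j x) (S i j x))) => i' j'.
exact: dot_ge0.
Qed.

End Isometry.

(** * Pointwise minimisation of the energy density, and bounds on the energy *)

Section Energy.
Context {R : realType}.
Local Notation T1 := (measurableTypeR R).
Local Notation T := (T1 * T1)%type.
Implicit Types (w : set (R * R)) (A : 'M[R]_2) (c gamma : R).

Lemma sum2 (F : 'I_2 -> R) : \sum_i F i = F ord0 + F ord_max.
Proof. by rewrite !big_ord_recl big_ord0 addr0; congr (_ + F _); apply/val_inj. Qed.

Definition density c gamma A : R :=
  frob2 (A - c *: diag2 (-1) 1) + gamma * (\tr A) ^+ 2.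

Definition min_density c gamma : R := c ^+ 2 * ((1 + 2 * gamma) / (1 + gamma)).

Lemma densityE c gamma A : density c gamma A =
  (A ord0 ord0 + c) ^+ 2 + A ord0 ord_max ^+ 2 + A ord_max ord0 ^+ 2 +
  (A ord_max ord_max - c) ^+ 2 + gamma * (A ord0 ord0 + A ord_max ord_max) ^+ 2.
Proof. by rewrite /density /frob2 /mxtrace !sum2 !mxE !sum2 !mxE /=; ring. Qed.

Lemma density_ge0 c gamma A : 0 <= gamma -> 0 <= density c gamma A.
Proof. by move=> g0; rewrite densityE !addr_ge0 ?sqr_ge0 // mulr_ge0 // sqr_ge0. Qed.

Lemma density_flat c gamma A : 1 + gamma != 0 -> A ord0 ord_max = A ord_max ord0 ->
  A ord0 ord0 * A ord_max ord_max = A ord0 ord_max ^+ 2 ->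
  density c gamma A = min_density c gamma +
    (1 + gamma) * (A ord0 ord0 - A ord_max ord_max + c / (1 + gamma)) ^+ 2 +
    4 * (1 + gamma) * A ord0 ord_max ^+ 2.
Proof.
move=> g1 sA dA; rewrite densityE -sA /min_density.
set a := A ord0 ord0 in dA *; set d := A ord_max ord_max in dA *.
set b := A ord0 ord_max in dA *.
(* An identity in independent a, b, d. With a d = b^2 its last two terms add up to 4 (1 + gamma)
   b^2. *)
suff -> : (a + c) ^+ 2 + b ^+ 2 + b ^+ 2 + (d - c) ^+ 2 + gamma * (a + d) ^+ 2 =
   c ^+ 2 * ((1 + 2 * gamma) / (1 + gamma)) + (1 + gamma) * (a - d + c / (1 + gamma)) ^+ 2 +
     (2 + 4 * gamma) * (a * d) + 2 * b ^+ 2.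
  by rewrite dA; ring.
by field.
Qed.

Lemma min_density_le c gamma A : 0 < gamma -> A ord0 ord_max = A ord_max ord0 ->
  A ord0 ord0 * A ord_max ord_max = A ord0 ord_max ^+ 2 ->
  min_density c gamma <= density c gamma A.
Proof.
move=> g0 sA dA; have g1 : 0 < 1 + gamma by rewrite addr_gt0.
rewrite density_flat ?gt_eqF // -addrA lerDl.
by rewrite addr_ge0 // mulr_ge0 ?sqr_ge0 // ?mulr_ge0 // ltW.
Qed.

Lemma diag2E (a d : R) : (diag2 a d ord0 ord0 = a) * (diag2 a d ord0 ord_max = 0) *
  (diag2 a d ord_max ord0 = 0) * (diag2 a d ord_max ord_max = d).
Proof. by do !split; rewrite !mxE. Qed.

(** The hypotheses say that the determinant and both squares of [density_flat] vanish; the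
    off-diagonal square does so for any diagonal matrix. *)
Lemma density_diag c gamma (a d : R) : 1 + gamma != 0 -> a * d = 0 ->
  d - a = c / (1 + gamma) -> density c gamma (diag2 a d) = min_density c gamma.
Proof.
move=> g1 ad E; rewrite density_flat ?diag2E //; last by rewrite ad expr0n.
by rewrite -E; ring.
Qed.

(** In the coefficient of [g], the shifted diagonal entries contribute 2 + 2, the off-diagonal ones
    1 + 1, and the squared trace 4 [gamma]. *)
Lemma density_le c gamma A (g : R) : 0 <= gamma -> (forall i j, A i j ^+ 2 <= g) ->
  density c gamma A <= (6 + 4 * gamma) * g + 4 * c ^+ 2.
Proof.
move=> g0 H; rewrite densityE.
have := H ord0 ord0; have := H ord0 ord_max; have := H ord_max ord0; have := H ord_max ord_max.
set a := A ord0 ord0; set d := A ord_max ord_max; set b := A ord0 ord_max.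
set e := A ord_max ord0 => h1 h2 h3 h4.
have k1 : (a + c) ^+ 2 <= 2 * g + 2 * c ^+ 2 by have := sqr_ge0 (a - c); nra.
have k2 : (d - c) ^+ 2 <= 2 * g + 2 * c ^+ 2 by have := sqr_ge0 (d + c); nra.
have k3 : (a + d) ^+ 2 <= 4 * g by have := sqr_ge0 (a - d); nra.
have k4 : gamma * (a + d) ^+ 2 <= gamma * (4 * g) by rewrite ler_wpM2l.
lra.
Qed.

(* [0 = cos (pi / 2) = 1 - 2 sin (pi / 4) ^ 2] and [sin x <= x] *)
Lemma pi_sqr_ge8 : 8 <= (pi : R) ^+ 2.
Proof.
have p0 : 0 < (pi : R) / 4 by rewrite divr_gt0 // pi_gt0.
have sle : sin (pi / 4 : R) <= pi / 4.
  have [|c _] := MVT p0 (fun s _ => is_derive_sin s).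
    by apply: continuous_subspaceT; exact: continuous_sin.
  by rewrite sin0 !subr0 => ->; rewrite ler_piMl ?cos_le1 // ltW.
have s0 : 0 <= sin (pi / 4 : R).
  apply: sin_ge0_pi; rewrite ltW //=; have := pi_gt0 R; lra.
have := cos_mulr2n (pi / 4 : R).
have -> : (pi / 4 : R) *+ 2 = pi / 2 by rewrite mulr2n; field.
rewrite cos_pihalf; have := cos2Dsin2 (pi / 4 : R).
set p : R := pi in s0 sle *; move: s0 sle; set s := sin _; set c := cos _ => s0 sle.
rewrite mulr2n => h1 h2; have s2 : s ^+ 2 = 1 / 2 by lra.
have : s ^+ 2 <= (p / 4) ^+ 2 by rewrite lerXn2r ?nnegrE // (le_trans s0).
rewrite s2 exprMn exprVn; lra.
Qed.

Lemma E_min_density (mu delta0 gamma : R) w : 0 < mu -> 0 < gamma -> (leb2 w < +oo)%E ->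
  E_min mu delta0 gamma w =
  ((mu / 12)%:E * ((min_density (12 * delta0 / pi ^+ 2) gamma)%:E * leb2 w)
   + (mu * delta0 ^+ 2 / pi ^+ 4 * ((pi ^+ 4 - 4 * pi ^+ 2 - 48) / 2))%:E * leb2 w)%E.
Proof.
move=> mu0 g0 fw; have fin : leb2 w \is a fin_num by rewrite ge0_fin_numE.
rewrite /E_min -(fineK fin) -!EFinM -EFinD /min_density; congr (_%:E).
have p0 : (pi : R) != 0 by rewrite gt_eqF // pi_gt0.
move: p0; generalize (pi : R) => p p0.
by field; rewrite p0 gt_eqF // addr_gt0.
Qed.

(** Nonnegativity of the energy is obtained through its minimum. With q = pi^2 >= 8 alone, (q^2 - 4
    q - 48) / 2 could still be negative, but q^2 >= 8 q bounds it below by -8, and the other term of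
    the bracket is at least 12. *)
Lemma E_min_ge0 (mu delta0 gamma : R) w : 0 < mu -> 0 < gamma ->
  (0 <= E_min mu delta0 gamma w)%E.
Proof.
move=> mu0 g0; rewrite /E_min mule_ge0 // lee_fin.
have p0 : 0 < (pi : R) by exact: pi_gt0.
apply: mulr_ge0.
  apply: divr_ge0; first by apply: mulr_ge0; [exact: ltW|exact: sqr_ge0].
  by apply: exprn_ge0; exact: ltW.
have g1 : 0 < 1 + gamma by rewrite addr_gt0.
have h1 : 1 <= (1 + 2 * gamma) / (1 + gamma) by rewrite ler_pdivlMr //; lra.
have := pi_sqr_ge8; rewrite (_ : pi ^+ 4 = (pi ^+ 2) ^+ 2); last by rewrite -exprM.
move: h1; set t := _ / (1 + gamma); generalize (pi ^+ 2 : R) => q h1 q8.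
have : 8 * q <= q ^+ 2 by rewrite expr2 ler_wpM2r // (le_trans _ q8).
lra.
Qed.

Lemma mfun_on_density w (y : R * R -> 'cV[R]_3) c gamma : open w -> bounded_set w ->
  A_iso w y -> mfun_on w (fun x => density c gamma (second_ff w y x)).
Proof.
move=> ow bw yA; have m i j := mfun_on_second_ff ow bw yA i j.
have mc (k : R) : mfun_on w (fun=> k) by exact: measurable_cst.
under [X in mfun_on _ X]eq_fun do rewrite densityE !expr2.
apply: mfun_onD; [apply: mfun_onD; [apply: mfun_onD; [apply: mfun_onD|]|]|].
- by apply: mfun_onM; apply: mfun_onD.
- by apply: mfun_onM.
- by apply: mfun_onM.
- by apply: mfun_onM; apply: mfun_onB.
- by apply: mfun_onM => //; apply: mfun_onM; apply: mfun_onD.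
Qed.

Section EnergyBounds.
Variables (mu delta0 gamma : R) (w : set (R * R)) (y : R * R -> 'cV[R]_3).
Hypotheses (mu_gt0 : 0 < mu) (gamma_gt0 : 0 < gamma).
Hypotheses (ow : open w) (bw : bounded_set w) (yA : A_iso w y).

Let c := 12 * delta0 / pi ^+ 2.
Let mw : measurable (w : set T) := open_measurable2 ow.
Let fw : (leb2 w < +oo)%E := bounded_leb2 mw bw.
Let Q x := density c gamma (second_ff w y x).

Let mQ : measurable_fun (w : set T) (EFin \o Q).
Proof. by apply/measurable_EFinP; exact: mfun_on_density. Qed.

Let Q0 x : w x -> (0 <= (Q x)%:E)%E.
Proof. by move=> _; rewrite lee_fin density_ge0 // ltW. Qed.

Lemma E_min_le : (E_min mu delta0 gamma w <= E_lim mu delta0 gamma w y)%E.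
Proof.
rewrite E_min_density // /E_lim leeD2r // lee_pmul2l // ?lte_fin ?divr_gt0 //.
have := integral_cst leb2 mw (min_density c gamma)%:E => <-.
apply: ae_ge0_le_integral => //.
- move=> x _; rewrite lee_fin /min_density mulr_ge0 ?sqr_ge0 //.
  by rewrite divr_ge0 // addr_ge0 // ?mulr_ge0 // ltW.
- apply: ae_onS (second_ff_flat ow bw yA) => x _ [h1 h2].
  by rewrite lee_fin min_density_le.
Qed.

Lemma E_lim_lty : (E_lim mu delta0 gamma w y < +oo)%E.
Proof.
rewrite /E_lim lte_add_pinfty //; last first.
  by rewrite -(fineK (_ : leb2 w \is a fin_num)) ?ltry // ge0_fin_numE.
have [g ig gA] := second_ff_bound ow bw yA.
rewrite lte_mul_pinfty ?lee_fin ?divr_ge0 // ?ltW //.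
have ib : leb2.-integrable (w : set T)
    (EFin \o (fun x => (6 + 4 * gamma) * g x + 4 * c ^+ 2)).
  by have := integrableD mw (integrableZl mw (6 + 4 * gamma) ig) (integrable_cst2 (4 * c ^+ 2) mw fw).
have /integrableP[mb] := ib; apply: le_lt_trans.
apply: ae_ge0_le_integral => //; first exact: measurableT_comp.
apply: ae_onS gA => x _ H; rewrite lee_fin; apply: le_trans (ler_norm _).
by apply: density_le => //; exact: ltW.
Qed.

Lemma E_lim_eq (A : 'M[R]_2) : density c gamma A = min_density c gamma ->
  ae_on w (fun x => second_ff w y x = A) ->
  E_lim mu delta0 gamma w y = E_min mu delta0 gamma w.
Proof.
move=> E yE; rewrite E_min_density // /E_lim; congr (_ * _ + _)%E.
rewrite -/c -E -(integral_cst leb2 mw); apply: ae_eq_integral => //.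
by apply: ae_leb2S yE => x H wx; rewrite (H wx).
Qed.

End EnergyBounds.

End Energy.

(** * Smooth isometric surfaces and the two families of cylinders *)

Section ClassicalSurface.
Context {R : realType}.
Local Notation T1 := (measurableTypeR R).
Local Notation T := (T1 * T1)%type.
Implicit Types (w : set (R * R)) (y n : R * R -> 'cV[R]_3) (i j : 'I_2) (k : 'I_3).

Definition cgrad y (x : R * R) : 'M[R]_(3, 2) :=
  \matrix_(k, i) pderiv i (fun z => y z k ord0) x.

Lemma wgrad_smooth w y : open w -> bounded_set w ->
  (forall k, smooth (fun z => y z k ord0)) ->
  ae_on w (fun x => wgrad w y x = cgrad y x).
Proof.
move=> ow bw sy.
have : ae_on w (fun x => forall k i,
    weak_partial w i (fun z => y z k ord0) x = pderiv i (fun z => y z k ord0) x).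
  apply: ae_on_forall => k; apply: ae_on_forall => i.
  by have [_] := weak_partialP ow (smooth_weak_partial i ow bw (sy k)).
by apply: ae_onS => x _ H; apply/matrixP => k i; rewrite !mxE H.
Qed.

(** The classical normal [n] agrees with [normal_field] only almost everywhere, the latter being
    built from chosen weak derivatives. Weak derivatives do not see the difference, so the classical
    ones of [n] serve for both. *)
Lemma second_ff_smooth w y n : open w -> bounded_set w ->
  (forall k, smooth (fun z => y z k ord0)) -> (forall k, smooth (fun z => n z k ord0)) ->
  (forall x, (cgrad y x)^T *m cgrad y x = 1%:M) ->
  (forall x, n x = crossp (col ord0 (cgrad y x)) (col ord_max (cgrad y x))) ->
  A_iso w y /\ ae_on w (fun x => second_ff w y x = (cgrad y x)^T *m cgrad n x).
Proof.
move=> ow bw sy sn iso nE; have gE := wgrad_smooth ow bw sy.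
have mD i k : mfun_on w (fun x => wgrad w y x k i).
  have [[_ [m _] _] _] := weak_partialP ow (smooth_weak_partial i ow bw (sy k)).
  by rewrite (_ : (fun x => _) = weak_partial w i (fun z => y z k ord0)) //;
    apply/funext => x; rewrite mxE.
split.
  split; first by move=> k; exact: smooth_sobolev2.
  by apply: ae_onS gE => x _ ->.
have mn k : mfun_on w (fun x => normal_field w y x k ord0).
  rewrite (_ : (fun x => _) = fun x =>
    wgrad w y x (k + 1) ord0 * wgrad w y x (k + 2%:R) ord_max -
    wgrad w y x (k + 2%:R) ord0 * wgrad w y x (k + 1) ord_max).
    by apply: mfun_onB; apply: mfun_onM.
  by apply/funext => x; rewrite !mxE.
have nwE : ae_on w (fun x => n x = normal_field w y x).
  by apply: ae_onS gE => x _ H; rewrite nE /normal_field H.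
have wn k i : is_weak_partial w i (fun x => normal_field w y x k ord0)
    (pderiv i (fun z => n z k ord0)).
  have wi := smooth_weak_partial i ow bw (sn k).
  have [_ [md _] _] := wi.
  apply: (is_weak_partial_ae ow wi (mn k) md); last exact: ae_onW.
  by apply: ae_onS nwE => x _ ->.
have : ae_on w (fun x => forall k i,
    weak_partial w i (fun z => normal_field w y z k ord0) x = pderiv i (fun z => n z k ord0) x).
  apply: ae_on_forall => k; apply: ae_on_forall => i.
  by have [_] := weak_partialP ow (wn k i).
apply: ae_onS2 gE => x _ gE H; rewrite /second_ff gE; congr (_ *m _).
by apply/matrixP => k i; rewrite !mxE H.
Qed.

Definition vec3 (a b c : R) : 'cV[R]_3 :=
  \col_k (if k == 0 then a else if k == 1 then b else c).

Definition mx32 (u v : 'cV[R]_3) : 'M[R]_(3, 2) :=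
  \matrix_(k, i) (if i == ord0 then u else v) k ord0.

Lemma crossp_vec3 a b c a' b' c' : crossp (vec3 a b c) (vec3 a' b' c') =
  vec3 (b * c' - c * b') (c * a' - a * c') (a * b' - b * a').
Proof.
apply/matrixP => k z; rewrite !mxE.
by case: k => -[|[|[|//]]] ?; rewrite /eq_op /=.
Qed.

Lemma mulmx_mx32 (a b c d e f a' b' c' d' e' f' : R) i j :
  ((mx32 (vec3 a b c) (vec3 d e f))^T *m mx32 (vec3 a' b' c') (vec3 d' e' f')) i j =
  if i == ord0 then if j == ord0 then a * a' + b * b' + c * c' else a * d' + b * e' + c * f'
  else if j == ord0 then d * a' + e * b' + f * c' else d * d' + e * e' + f * f'.
Proof.
by rewrite mxE sum3 !mxE; case: (i == ord0); case: (j == ord0); rewrite !mxE.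
Qed.

Lemma col_mx32 u v : (col ord0 (mx32 u v) = u) * (col ord_max (mx32 u v) = v).
Proof. by split; apply/matrixP => k z; rewrite !mxE (ord1 z). Qed.

Lemma smooth_coord (a b : R -> R) : smooth1 a -> smooth1 b ->
  smooth (fun x : R * R => a x.1) /\ smooth (fun x : R * R => b x.2).
Proof.
have s1 : smooth1 (cst 1 : R -> R) by move=> n; exact: Cn_cst.
move=> sa sb; split.
  have := smooth_tens sa s1; congr smooth; apply/funext => x.
  by rewrite /tens mulr1.
have := smooth_tens s1 sb; congr smooth; apply/funext => x.
by rewrite /tens mul1r.
Qed.

Lemma pderiv_coord1 i (a a' : R -> R) x : (forall t : R, is_derive t 1 a (a' t)) ->
  pderiv i (fun x : R * R => a x.1) x = if i == ord0 then a' x.1 else 0.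
Proof.
move=> da; have da1 t : derivable a t 1 by case: (da t).
rewrite (_ : (fun x => a x.1) = tens a (cst 1)); last first.
  by apply/funext => z; rewrite /tens mulr1.
rewrite pderiv_tens // /tens (derive1_eq da) /= mulr1.
by rewrite (derive1_eq (fun t : R => is_derive_cst (1 : R) t 1)) mulr0.
Qed.

Lemma pderiv_coord2 i (a a' : R -> R) x : (forall t : R, is_derive t 1 a (a' t)) ->
  pderiv i (fun x : R * R => a x.2) x = if i == ord0 then 0 else a' x.2.
Proof.
move=> da; have da1 t : derivable a t 1 by case: (da t).
rewrite (_ : (fun x => a x.2) = tens (cst 1) a); last first.
  by apply/funext => z; rewrite /tens mul1r.
rewrite pderiv_tens // /tens (derive1_eq da) /= mul1r.
by rewrite (derive1_eq (fun t : R => is_derive_cst (1 : R) t 1)) mul0r.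
Qed.

Lemma is_derive_scale (f f' : R -> R) (K t : R) : (forall t : R, is_derive t 1 f (f' t)) ->
  is_derive t 1 (fun t => f (K * t)) (K * f' (K * t)).
Proof.
move=> df; have E : (fun t => f (K * t)) = (fun t => f (K * t + 0)).
  by apply/funext => s; rewrite addr0.
have d1 : derivable f (K * t + 0) 1 by case: (df (K * t + 0)).
have := is_derive_affine d1; rewrite -E (derive1_eq df) addr0.
by rewrite mulrC.
Qed.

Lemma smooth1_trig (K a : R) : smooth1 (fun t => a * sin (K * t)) /\
  smooth1 (fun t => a * cos (K * t)).
Proof.
split=> n.
- have := CnM (Cn_cst n a) (Cn_affine K 0 (Cn_sin n).1).
  by congr Cn; apply/funext => t /=; rewrite addr0.
- have := CnM (Cn_cst n a) (Cn_affine K 0 (Cn_sin n).2).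
  by congr Cn; apply/funext => t /=; rewrite addr0.
Qed.

Lemma vec3_comp (f g h : R * R -> R) k : (fun z => vec3 (f z) (g z) (h z) k ord0) =
  if k == 0 then f else if k == 1 then g else h.
Proof. by apply/funext => z; rewrite mxE; case: (k == 0) => //; case: (k == 1). Qed.

Lemma smooth_vec3 (f g h : R * R -> R) k : smooth f -> smooth g -> smooth h ->
  smooth (fun z => vec3 (f z) (g z) (h z) k ord0).
Proof. by rewrite vec3_comp; case: (k == 0) => //; case: (k == 1). Qed.

Lemma cgrad_vec3 (f g h : R * R -> R) x : cgrad (fun z => vec3 (f z) (g z) (h z)) x =
  mx32 (vec3 (pderiv ord0 f x) (pderiv ord0 g x) (pderiv ord0 h x))
    (vec3 (pderiv ord_max f x) (pderiv ord_max g x) (pderiv ord_max h x)).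
Proof.
apply/matrixP => k i; rewrite !mxE vec3_comp.
case: (ord2P i) => ->.
- by rewrite eqxx mxE; case: (k == 0) => //; case: (k == 1).
- by rewrite /= mxE; case: (k == 0) => //; case: (k == 1).
Qed.

(** A circular cylinder of radius 1/|K|, curved along the first coordinate. The components are
    ordered so that the normal is [K] times the radial part of the surface point, which gives A_y =
    diag(K, 0) with the sign of [K], for either sign. [cylinder2] is arranged likewise for the
    second coordinate. *)
Definition cylinder1 (K : R) (x : R * R) : 'cV[R]_3 :=
  vec3 (K^-1 * sin (K * x.1)) x.2 (K^-1 * cos (K * x.1)).

Definition cylinder2 (K : R) (x : R * R) : 'cV[R]_3 :=
  vec3 x.1 (K^-1 * sin (K * x.2)) (K^-1 * cos (K * x.2)).

Lemma is_derive_trig (K a t : R) :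
  is_derive t 1 (fun t => a * sin (K * t)) (a * (K * cos (K * t))) /\
  is_derive t 1 (fun t => a * cos (K * t)) (a * (K * - sin (K * t))).
Proof.
have ds := is_derive_scale K t (fun t : R => is_derive_sin t).
have dc := is_derive_scale K t (fun t : R => is_derive_cos t).
by split; [exact: (is_deriveZ a ds)|exact: (is_deriveZ a dc)].
Qed.

Lemma cylinder1_second_ff w (K : R) : open w -> bounded_set w -> K != 0 ->
  A_iso w (cylinder1 K) /\
  ae_on w (fun x => second_ff w (cylinder1 K) x = diag2 K 0).
Proof.
move=> ow bw K0.
(* The factors 1 give [n] the form treated by [smooth1_trig] and [is_derive_trig], with amplitude 1
   in place of [K^-1]. *)
pose n (x : R * R) := vec3 (1 * sin (K * x.1)) 0 (1 * cos (K * x.1)).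
have [s1 s2] := smooth1_trig K K^-1; have [s3 s4] := smooth1_trig K 1.
have sid : smooth1 (@id R) by move=> m; exact: Cn_id.
have s0 : smooth1 (cst 0 : R -> R) by move=> m; exact: Cn_cst.
have did (t : R) : is_derive t 1 id (1 : R) by exact: is_derive_id.
have gy x : cgrad (cylinder1 K) x =
    mx32 (vec3 (cos (K * x.1)) 0 (- sin (K * x.1))) (vec3 0 1 0).
  rewrite /cylinder1 cgrad_vec3.
  rewrite !(pderiv_coord1 _ _ (fun t => (is_derive_trig K K^-1 t).1)).
  rewrite !(pderiv_coord1 _ _ (fun t => (is_derive_trig K K^-1 t).2)).
  by rewrite !(pderiv_coord2 _ _ did) /= !mulKf.
have gn x : cgrad n x =
    mx32 (vec3 (K * cos (K * x.1)) 0 (- (K * sin (K * x.1)))) (vec3 0 0 0).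
  rewrite /n cgrad_vec3.
  rewrite !(pderiv_coord1 _ _ (fun t => (is_derive_trig K 1 t).1)).
  rewrite !(pderiv_coord1 _ _ (fun t => (is_derive_trig K 1 t).2)).
  by rewrite !(pderiv_cst _ 0) /= !mul1r mulrN.
have [|||x|yA yE] := @second_ff_smooth w (cylinder1 K) n ow bw.
- move=> k; apply: smooth_vec3; first exact: (smooth_coord s1 sid).1.
    exact: (smooth_coord s1 sid).2.
  exact: (smooth_coord s2 sid).1.
- move=> k; apply: smooth_vec3; first exact: (smooth_coord s3 sid).1.
    exact: (smooth_coord s0 sid).1.
  exact: (smooth_coord s4 sid).1.
- move=> x; apply/matrixP => i j; rewrite gy mulmx_mx32 mxE.
  have := cos2Dsin2 (K * x.1).
  by case: (ord2P i) => ->; case: (ord2P j) => -> /= E; lra.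
- by rewrite gy !col_mx32 crossp_vec3 /n; congr vec3; ring.
split=> //; apply: ae_onS yE => x _ ->; apply/matrixP => i j.
rewrite gy gn mulmx_mx32.
case: (ord2P i) => ->; case: (ord2P j) => ->; rewrite diag2E /=; [|ring|ring|ring].
(* The only nontrivial entry is K (cos^2 + sin^2). *)
by rewrite -[RHS]mulr1 -(cos2Dsin2 (K * x.1)); ring.
Qed.

Lemma cylinder2_second_ff w (K : R) : open w -> bounded_set w -> K != 0 ->
  A_iso w (cylinder2 K) /\
  ae_on w (fun x => second_ff w (cylinder2 K) x = diag2 0 K).
Proof.
move=> ow bw K0.
pose n (x : R * R) := vec3 0 (1 * sin (K * x.2)) (1 * cos (K * x.2)).
have [s1 s2] := smooth1_trig K K^-1; have [s3 s4] := smooth1_trig K 1.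
have sid : smooth1 (@id R) by move=> m; exact: Cn_id.
have s0 : smooth1 (cst 0 : R -> R) by move=> m; exact: Cn_cst.
have did (t : R) : is_derive t 1 id (1 : R) by exact: is_derive_id.
have gy x : cgrad (cylinder2 K) x =
    mx32 (vec3 1 0 0) (vec3 0 (cos (K * x.2)) (- sin (K * x.2))).
  rewrite /cylinder2 cgrad_vec3.
  rewrite !(pderiv_coord2 _ _ (fun t => (is_derive_trig K K^-1 t).1)).
  rewrite !(pderiv_coord2 _ _ (fun t => (is_derive_trig K K^-1 t).2)).
  by rewrite !(pderiv_coord1 _ _ did) /= !mulKf.
have gn x : cgrad n x =
    mx32 (vec3 0 0 0) (vec3 0 (K * cos (K * x.2)) (- (K * sin (K * x.2)))).
  rewrite /n cgrad_vec3.
  rewrite !(pderiv_coord2 _ _ (fun t => (is_derive_trig K 1 t).1)).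
  rewrite !(pderiv_coord2 _ _ (fun t => (is_derive_trig K 1 t).2)).
  by rewrite !(pderiv_cst _ 0) /= !mul1r mulrN.
have [|||x|yA yE] := @second_ff_smooth w (cylinder2 K) n ow bw.
- move=> k; apply: smooth_vec3; first exact: (smooth_coord sid sid).1.
    exact: (smooth_coord sid s1).2.
  exact: (smooth_coord sid s2).2.
- move=> k; apply: smooth_vec3; first exact: (smooth_coord s0 sid).1.
    exact: (smooth_coord sid s3).2.
  exact: (smooth_coord sid s4).2.
- move=> x; apply/matrixP => i j; rewrite gy mulmx_mx32 mxE.
  have := cos2Dsin2 (K * x.2).
  by case: (ord2P i) => ->; case: (ord2P j) => -> /= E; lra.
- by rewrite gy !col_mx32 crossp_vec3 /n; congr vec3; ring.
split=> //; apply: ae_onS yE => x _ ->; apply/matrixP => i j.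
rewrite gy gn mulmx_mx32.
case: (ord2P i) => ->; case: (ord2P j) => ->; rewrite diag2E /=; [ring|ring|ring|].
by rewrite -[RHS]mulr1 -(cos2Dsin2 (K * x.2)); ring.
Qed.

End ClassicalSurface.

(** * Minimum of the limit energy and its minimisers *)

Theorem lemma3p8 (R : realType) (w : set (R * R)) (mu delta0 gamma : R)
    (w_lip : bounded_lipschitz_domain w)
    (w_bdry : normal_continuous_off_null_set w)
    (mu_gt0 : 0 < mu) (delta0_gt0 : 0 < delta0) (gamma_gt0 : 0 < gamma) :
  let E := E_lim mu delta0 gamma w in
  let kappa := 12 * delta0 / (pi ^+ 2 * (1 + gamma)) in
  let A1 := diag2 (- kappa) 0 in
  let A2 := diag2 0 kappa in
  [/\ forall y, A_iso w y -> (0 <= E y < +oo)%E,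
      is_minimum E (A_iso w) (E_min mu delta0 gamma w),
      forall yT, A_iso w yT ->
        ae_on w (fun x => second_ff w yT x = A1) \/
        ae_on w (fun x => second_ff w yT x = A2) ->
        E yT = E_min mu delta0 gamma w,
      exists2 yT, A_iso w yT & ae_on w (fun x => second_ff w yT x = A1) &
      exists2 yT, A_iso w yT & ae_on w (fun x => second_ff w yT x = A2)].
Proof.
move=> E kappa A1 A2; have [_ ow _ bw _] := w_lip.
have g1 : 1 + gamma != 0 by rewrite gt_eqF // addr_gt0.
have kE : kappa = 12 * delta0 / pi ^+ 2 / (1 + gamma) by rewrite /kappa invfM mulrA.
have k0 : kappa != 0.
  have p0 : 0 < (pi : R) ^+ 2 by rewrite exprn_gt0 // pi_gt0.
  by rewrite gt_eqF //; apply: divr_gt0; apply: mulr_gt0 => //; exact: addr_gt0.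
have min_le y : A_iso w y -> (E_min mu delta0 gamma w <= E y)%E by exact: E_min_le.
have E_A yT : A_iso w yT -> ae_on w (fun x => second_ff w yT x = A1) \/
    ae_on w (fun x => second_ff w yT x = A2) -> E yT = E_min mu delta0 gamma w.
  move=> yA [yE|yE]; apply: E_lim_eq yE => //; apply: density_diag => //.
  - by rewrite mulr0.
  - by rewrite sub0r opprK.
  - by rewrite mul0r.
  - by rewrite subr0.
have [y1A y1E] : A_iso w (cylinder1 (- kappa)) /\
    ae_on w (fun x => second_ff w (cylinder1 (- kappa)) x = A1).
  by apply: cylinder1_second_ff => //; rewrite oppr_eq0.
have [y2A y2E] := cylinder2_second_ff ow bw k0.
split=> //.
- move=> y yA; rewrite (le_trans _ (min_le y yA)) ?E_min_ge0 //=.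
  exact: E_lim_lty.
- split=> //; exists (cylinder1 (- kappa)) => //; apply: E_A => //; by left.
- by exists (cylinder1 (- kappa)).
- by exists (cylinder2 kappa).
Qed.
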